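(* Let $m_1\ge\dots\ge m_n=0$ be integers. In the irreducible representation $V$ of $\mathfrak{gl}_n$ with highest weight $[m_1,\dots,m_n]$, the base $F_\gamma(a)$, where $\gamma$ runs over shift vectors corresponding to all Gelfand-Tsetlin diagrams with upper row $[m_1,\dots,m_n]$, is related with the Gelfand-Tsetlin base $G_\gamma(a)$ by a transformation that is lower-triangular with respect to the order $\preceq$; that is, for every such $\gamma$ $$F_\gamma(a)=\sum_{\delta:\ \delta+B\preceq\gamma+B}c_{\gamma,\delta}\,G_\delta(a),\qquad c_{\gamma,\delta}\in\mathbb{C},\ c_{\gamma,\gamma}\neq0,$$ where $\delta$ runs over the shift vectors of the Gelfand-Tsetlin diagrams with the given upper row.
   Context: Fix $n\ge2$. Functions on $GL_n(\mathbb{C})$ form a representation by right shifts $(Xf)(g)=f(gX)$, hence a representation of $\mathfrak{gl}_n$ (generators $E_{i,j}$). Let $a_i^j$ be the matrix element in row $j$, column $i$; for a nonempty proper subset $X=\{i_1<\dots<i_l\}\subset\{1,\dots,n\}$ put $a_X=a_{i_1,\dots,i_l}=\det(a_i^j)_{i=i_1,\dots,i_l}^{j=1,\dots,l}$. $V$ is the irreducible subrepresentation generated by the highest vector $\prod_{p=1}^{n-1}\frac{a_{1,\dots,p}^{m_p-m_{p+1}}}{(m_p-m_{p+1})!}$. Let $N=2^n-2$ and index coordinates of $\mathbb{Z}^N$ by nonempty proper subsets $X$ of $\{1,\dots,n\}$; $e_X$ are unit vectors. $B\subset\mathbb{Z}^N$ consists of all $v$ with $\sum_{X:\,|X\cap\{1,\dots,q\}|\ge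 p}v_X=0$ for all $1\le p\le q\le n$. For $1\le i<j<x\le n$ and $X$ (possibly empty) with all elements greater than $x$, put $v_+=e_{1,\dots,i-1,i,X}+e_{1,\dots,i-1,j,x,X}$, $v_-=e_{1,\dots,i-1,j,X}+e_{1,\dots,i-1,i,x,X}$, $v_0=e_{1,\dots,i-1,x,X}+e_{1,\dots,i-1,i,j,X}$ (juxtaposition means union of sets). Enumerate these quadruples by $\alpha=1,\dots,k$; $v^\alpha=v^\alpha_+-v^\alpha_-$ (these form a base of $B$), $r^\alpha=v^\alpha_0-v^\alpha_+$; $tv=\sum_\alpha t_\alpha v^\alpha$, $sr=\sum_\alpha s_\alpha r^\alpha$. The partial order: $\gamma+B\preceq\delta+B$ if $\gamma+sr\equiv\delta\pmod B$ for some $s\in\mathbb{Z}^k_{\ge0}$. Notation: $z^x=\prod_Xz_X^{x_X}$, $x!=\prod_Xx_X!$, $1/m!=0$ for negative integers $m$; for $s\in\mathbb{Z}^k_{\ge0}$, $s!=\prod_\alpha s_\alpha!$, $(-1)^s=(-1)^{\sum s_\alpha}$. Define $$J^s_\gamma(z)=\sum_{t\in\mathbb{Z}^k}\frac{\prod_\alpha(t_\alpha+1)\cdots(t_\alpha+s_\alpha)}{(\gamma+tv)!}z^{\gamma+tv},\qquad F_\gamma(z)=\sum_{s\in\mathbb{Z}^k_{\ge0}}\frac{(-1)^s}{s!}J^s_{\gamma-sr}(z);$$ $F_\gamma(a)$ is obtained by substituting $z_X=a_X$. A Gelfand-Tsetlin diagram with upper row $[m_1,\dots,m_n]$ is an array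 of integers $m_{p,q}$, $1\le p\le q\le n$, with $m_{p,n}=m_p$ and $m_{p,q+1}\ge m_{p,q}\ge m_{p+1,q+1}$. The set of $x\in\mathbb{Z}^N$ with $\sum_{X:\,|X\cap\{1,\dots,q\}|\ge p}x_X=m_{p,q}$ for all $p\le q$ has the form $\gamma+B$; $\gamma$ (one fixed choice per diagram) is the shift vector of the diagram. $G_\gamma(a)$ denotes the Gelfand-Tsetlin base vector (defined up to a nonzero scalar) of $V$ corresponding to the diagram with shift vector $\gamma$: a nonzero vector which, for the chain $\mathfrak{gl}_n\supset\dots\supset\mathfrak{gl}_1$ ($\mathfrak{gl}_q$ spanned by $E_{i,j}$, $i,j\le q$), lies for each $q$ in an irreducible $\mathfrak{gl}_q$-submodule with highest weight $(m_{1,q},\dots,m_{q,q})$. *)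

(* Defs.v *)
From HB Require Import structures.
From mathcomp Require Import all_boot all_order all_algebra.
From mathcomp Require Import all_classical all_reals all_analysis.

Set Implicit Arguments.
Unset Strict Implicit.
Unset Printing Implicit Defensive.

Import Order.TTheory GRing.Theory Num.Theory.
Import numFieldNormedType.Exports.
Local Open Scope classical_set_scope.
Local Open Scope ring_scope.

(* The element y : 'I_n stands for the number y + 1 of {1, ..., n}, so that
   {1, ..., q} is [seg n q]; the indices p, q of Gelfand-Tsetlin diagrams and of
   highest weights are natural numbers starting from 1. *)

Definition seg (n q : nat) : {set 'I_n} := [set y : 'I_n | (y < q)%N]%SET.

Definition GL (K : fieldType) (n : nat) := {g : 'M[K]_n | g \in unitmx}.

Definition GLmul (K : fieldType) (n : nat) (g h : GL K n) : GL K n :=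
  exist _ (val g *m val h)
    (eq_ind_r is_true (introT andP (conj (valP g) (valP h)))
       (unitmx_mul (val g) (val h))).

Definition shift_right (K : fieldType) (n : nat) (X : GL K n)
  (f : GL K n -> K) : GL K n -> K := fun g => f (GLmul g X).

(* The generator E_{i,j} acts by differentiating the right shift along the curve
   1 + t E_{i,j}, which has the same tangent vector at t = 0 as exp(t E_{i,j}).
   The default value g of [insubd] is only used for t such that 1 + t E_{i,j} is
   singular, i.e. i = j and t = -1. *)
Definition gl_act (K : numFieldType) (n : nat) (i j : 'I_n)
  (f : GL K n -> K) : GL K n -> K :=
  fun g => derive1
    (fun t : K => f (insubd g (val g *m (1%:M + t *: delta_mx i j))) : K^o) 0.

Definition is_subspace (K : fieldType) (T : Type) (W : set (T -> K)) : Prop :=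
  W (fun _ => 0) /\
  forall (c : K) (f h : T -> K), W f -> W h -> W (fun x => c * f x + h x).

Definition nonzero (K : fieldType) (T : Type) (f : T -> K) : Prop :=
  exists x, f x != 0.

Definition gl_submodule (K : numFieldType) (n q : nat)
  (W : set (GL K n -> K)) : Prop :=
  is_subspace W /\
  forall (i j : 'I_n) (f : GL K n -> K),
    (i < q)%N -> (j < q)%N -> W f -> W (gl_act i j f).

Definition gl_irreducible (K : numFieldType) (n q : nat)
  (W : set (GL K n -> K)) : Prop :=
  [/\ gl_submodule q W,
      exists f, W f /\ nonzero f &
      forall W' : set (GL K n -> K), gl_submodule q W' -> W' `<=` W ->
        (exists f, W' f /\ nonzero f) -> W' = W].

Definition has_highest_weight (K : numFieldType) (n q : nat) (l : nat -> int)
  (W : set (GL K n -> K)) : Prop :=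
  exists w, [/\ W w, nonzero w,
    forall i j : 'I_n, (i < j)%N -> (j < q)%N ->
      forall g, gl_act i j w g = 0 &
    forall i : 'I_n, (i < q)%N -> forall g, gl_act i i w g = (l i.+1)%:~R * w g].

Lemma card_set_ord (n : nat) (X : {set 'I_n}) : (#|X| <= n)%N.
Proof. by rewrite -[leqRHS]card_ord max_card. Qed.

(* [enum_val] enumerates the columns X in increasing order. *)
Definition minor (K : fieldType) (n : nat) (g : 'M[K]_n) (X : {set 'I_n}) : K :=
  \det (\matrix_(r < #|X|, c < #|X|) g (widen_ord (card_set_ord X) r) (enum_val c)).

Definition inv_fact (K : fieldType) (x : int) : K :=
  if x is Posz k then (k`!%:R)^-1 else 0.

Definition highest_vector (K : fieldType) (n : nat) (m : nat -> int) :
  GL K n -> K :=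
  fun g => \prod_(1 <= p < n)
    (minor (val g) (seg n p) ^ (m p - m p.+1) * inv_fact K (m p - m p.+1)).

(* The subrepresentation generated by the highest vector, as the intersection of
   all subrepresentations of the space of functions on GL_n containing it. *)
Definition rep_V (K : fieldType) (n : nat) (m : nat -> int) : set (GL K n -> K) :=
  [set f | forall W : set (GL K n -> K), is_subspace W ->
     (forall (X : GL K n) (h : GL K n -> K), W h -> W (shift_right X h)) ->
     W (highest_vector m) -> W f].

Definition proper_sets (n : nat) :=
  {X : {set 'I_n} | (X != finset.set0) && (X != finset.setT)}.

Definition lattice (n : nat) := {ffun proper_sets n -> int}.

(* The sets to which [evec] is applied below are all nonempty and proper. *)
Definition evec (n : nat) (X : {set 'I_n}) : lattice n :=
  [ffun Y : proper_sets n => (val Y == X)%:R].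

Definition row_sum (n : nat) (p q : nat) (x : lattice n) : int :=
  \sum_(X : proper_sets n | (p <= #|val X :&: seg n q|)%N) x X.

Definition in_B (n : nat) (v : lattice n) : Prop :=
  forall p q : nat, (1 <= p)%N -> (p <= q)%N -> (q <= n)%N -> row_sum p q v = 0.

Definition is_quad (n : nat) (a : 'I_n * 'I_n * 'I_n * {set 'I_n}) : bool :=
  let: (i, j, x, X) := a in
  [&& (i < j)%N, (j < x)%N & [forall y in X, (x < y)%N]].

Definition quad (n : nat) :=
  {a : 'I_n * 'I_n * 'I_n * {set 'I_n} | is_quad a}.

Definition v_plus (n : nat) (a : quad n) : lattice n :=
  let: (i, j, x, X) := val a in
  evec (seg n i :|: [set i] :|: X)%SET + evec (seg n i :|: [set j; x] :|: X)%SET.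

Definition v_minus (n : nat) (a : quad n) : lattice n :=
  let: (i, j, x, X) := val a in
  evec (seg n i :|: [set j] :|: X)%SET + evec (seg n i :|: [set i; x] :|: X)%SET.

Definition v_zero (n : nat) (a : quad n) : lattice n :=
  let: (i, j, x, X) := val a in
  evec (seg n i :|: [set x] :|: X)%SET + evec (seg n i :|: [set i; j] :|: X)%SET.

Definition tv (n : nat) (t : {ffun quad n -> int}) : lattice n :=
  \sum_(a : quad n) (v_plus a - v_minus a) *~ t a.

Definition sr (n : nat) (s : {ffun quad n -> nat}) : lattice n :=
  \sum_(a : quad n) (v_zero a - v_plus a) *+ s a.

Definition prec (n : nat) (gamma delta : lattice n) : Prop :=
  exists s : {ffun quad n -> nat}, in_B (gamma + sr s - delta).

(* The sums over t and s have only finitely many nonzero terms.  A term vanishes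
   unless gamma - sr + tv is nonnegative, which leaves finitely many t for each s
   (the v^alpha are linearly independent) and finitely many s: modulo B, each
   r^alpha moves down in the dominance order of the rows of diagrams. *)
Definition J (K : numFieldType) (n : nat) (s : {ffun quad n -> nat})
  (gamma : lattice n) (z : proper_sets n -> K) : K :=
  \sum_(t \in [set: {ffun quad n -> int}])
    ((\prod_(a : quad n) \prod_(1 <= l < (s a).+1) (t a + l%:Z))%:~R
     * (\prod_(X : proper_sets n) inv_fact K ((gamma + tv t) X))
     * (\prod_(X : proper_sets n) z X ^ ((gamma + tv t) X))).

Definition F (K : numFieldType) (n : nat) (gamma : lattice n)
  (z : proper_sets n -> K) : K :=
  \sum_(s \in [set: {ffun quad n -> nat}])
    ((-1) ^+ (\sum_(a : quad n) s a)%N / (\prod_(a : quad n) (s a)`!)%N%:R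
     * J s (gamma - sr s) z).

Definition F_a (K : numFieldType) (n : nat) (gamma : lattice n) : GL K n -> K :=
  fun g => F gamma (fun X => minor (val g) (val X)).

(* d p q is m_{p,q}; the entries outside the triangle 1 <= p <= q <= n are set
   to 0 so that every diagram is represented by exactly one function. *)
Definition GT_diagram (n : nat) (m : nat -> int) (d : nat -> nat -> int) : Prop :=
  [/\ forall p, (1 <= p <= n)%N -> d p n = m p,
      forall p q, (1 <= p <= q)%N -> (q < n)%N ->
        d p q <= d p q.+1 /\ d p.+1 q.+1 <= d p q &
      forall p q, ~~ [&& (1 <= p)%N, (p <= q)%N & (q <= n)%N] -> d p q = 0].

Definition shift_vector (n : nat) (d : nat -> nat -> int) (gamma : lattice n) : Prop :=
  forall p q, (1 <= p)%N -> (p <= q)%N -> (q <= n)%N -> row_sum p q gamma = d p q.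

Definition GT_vector (K : numFieldType) (n : nat) (m : nat -> int)
  (d : nat -> nat -> int) (f : GL K n -> K) : Prop :=
  [/\ rep_V m f, nonzero f &
    forall q, (1 <= q <= n)%N ->
      exists W : set (GL K n -> K),
        [/\ W `<=` rep_V m, gl_irreducible q W,
            has_highest_weight q (fun p => d p q) W & W f]].

(* Main.v *)
Require Import Defs.
From HB Require Import structures.
From mathcomp Require Import all_boot all_order all_algebra all_fingroup.
From mathcomp Require Import complex.
From mathcomp Require Import all_classical all_reals all_analysis.
From mathcomp Require Import ring zify.
Set Implicit Arguments.
Unset Strict Implicit.
Unset Printing Implicit Defensive.
Import Order.TTheory GRing.Theory Num.Theory.
Import numFieldNormedType.Exports.
Local Open Scope ring_scope.

(** Write D_X for the minor of the first |X| rows and the columns X, and D^x for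
    the product of the powers D_X^(x_X).

    By the Cauchy-Binet and the multinomial formulas, the highest vector at a b^T
    is the kernel sum_x D^x(a) D^x(b) / x!, where x runs over the exponents with
    m_p - m_(p+1) factors of size p ([kernE]). So V lies in the span of the
    functions a |-> kern a b, on which <f, kern(., b)> = f(conj b) defines a
    positive definite hermitian form. E_ij and E_ji are adjoint for it
    ([hform_lie]); hence Gelfand-Tsetlin vectors of different diagrams are
    orthogonal ([GT_orth]), and the vector of a diagram d is orthogonal to D^x
    unless d is dominated, row by row, by the diagram of x ([GT_triangular]).

    Straightening makes every D^x a combination of standard monomials
    ([mono_straighten]), and a standard monomial is determined by its diagram
    ([standard_inj]). So there are at least as many independent Gelfand-Tsetlin
    vectors as standard monomials; both are therefore bases of V, and the
    Gelfand-Tsetlin vector of d is a combination, triangular for dominance, of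
    the standard monomials ([GT_expansion]).

    On the other side F_gamma = sum_x Phi(x - gamma) D^x / x!, where Phi(u) is
    the sum over tv - sr = u of (-1)^s times the product of the binomial
    coefficients of t + s over s ([F_a_expansion]). By Pascal's rule
      Phi(u + v_+) - Phi(u + v_-) + Phi(u + v_0) = 0 for each quadruple
    ([Phi_agkz]), and the minors satisfy the relation of the same shape
    ([minor_quad]). These relations generate, up to factors D_X, all relations
    between minors: they eliminate every column set that is not of the form
    {1, ..., i} + {j}, and the remaining minors are algebraically independent.
    So Phi, and each of its translates, satisfies every linear relation between
    the D^x ([relation_agkz]). Consequently <F_gamma, D^x> = Phi(x - gamma)
    ([hform_F_mono]), although the D^x are neither independent nor orthogonal.

    The coefficient of G_delta in F_gamma is <F_gamma, G_delta> / <G_delta,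
    G_delta>. Its numerator is a sum of terms conj(A_x) Phi(x - gamma) over
    standard x. If Phi(x - gamma) is nonzero, then x - gamma + sr is in B for some
    s, so that the diagram of gamma is dominated by that of x ([prec_dominated]);
    if A_x is nonzero, the latter is dominated by that of delta. Dominance of
    diagrams implies the order of the theorem ([dominated_prec]). For delta =
    gamma only one x is left, and there Phi is 1. *)

(** * Minors as alternating functions of columns *)

Section Minors.
Variables (K : numFieldType) (n : nat).
Implicit Types (g : 'M[K]_n) (X : {set 'I_n}).

(** Rows past the n-th are taken to be zero, so that minors of any size can be
    formed without a bound on p. *)
Definition row_ext g (r : nat) (c : 'I_n) : K :=
  if insub r is Some i then g i c else 0.

(** The minor of the first p rows in an arbitrary list of columns: unlike minors
    of sets, it can be permuted and can repeat columns. *)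
Definition mdet g p (c : 'I_p -> 'I_n) : K :=
  \det (\matrix_(r < p, k < p) row_ext g r (c k)).

Lemma minorE g X : minor g X = mdet g (fun k : 'I_#|X| => enum_val k).
Proof.
congr (\det _); apply/matrixP=> r k; rewrite !mxE /row_ext.
have rn : (r < n)%N by apply: leq_trans (ltn_ord r) (card_set_ord X).
by rewrite insubT; congr (g _ _); apply: val_inj.
Qed.

Lemma mdet_sum g p (c : 'I_p -> 'I_n) :
  mdet g c = \sum_(s : 'S_p) (-1) ^+ s * \prod_k row_ext g (s k) (c k).
Proof.
rewrite /mdet -det_tr; apply: eq_bigr => s _; congr (_ * _).
by apply: eq_bigr => k _; rewrite !mxE.
Qed.

Lemma mdet_perm g p (c : 'I_p -> 'I_n) (s : 'S_p) :
  mdet g (fun k => c (s k)) = (-1) ^+ s * mdet g c.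
Proof.
rewrite /mdet; set M := (X in _ = _ * \det X).
rewrite -odd_permV -det_perm mulrC -det_mulmx -col_permE.
by congr (\det _); apply/matrixP=> r k; rewrite !mxE.
Qed.

Lemma mdet_alt g p (c : 'I_p -> 'I_n) i j : i != j -> c i = c j -> mdet g c = 0.
Proof.
move=> nij cij; rewrite /mdet -det_tr.
by apply: (determinant_alternate nij) => r; rewrite !mxE cij.
Qed.

Lemma eq_mdet g p (c c' : 'I_p -> 'I_n) : c =1 c' -> mdet g c = mdet g c'.
Proof.
by move=> cc; congr (\det _); apply/matrixP=> r k; rewrite !mxE cc.
Qed.

Lemma enum_val_mono X (c : 'I_#|X| -> 'I_n) :
  {homo c : i j / (i < j)%N} -> (forall k, c k \in X) ->
  forall k, c k = enum_val k.
Proof.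
move=> cmono cX.
have cinj : injective c.
  move=> i j cij; case: (ltngtP i j) => [/cmono|/cmono|/val_inj//];
  by rewrite cij ltnn.
have cE : [seq c k | k <- enum 'I_#|X|] = enum X.
  apply: (inj_map val_inj).
  apply: (@irr_sorted_eq _ ltn); [exact: ltn_trans|exact: ltnn|..].
  - rewrite sorted_map sorted_map.
    have : sorted ltn (map val (enum 'I_#|X|)) by rewrite val_enum_ord iota_ltn_sorted.
    by rewrite sorted_map; apply: sub_sorted => i j; apply: cmono.
  - have : subseq (map val (enum X)) (iota 0 n).
      by rewrite -val_enum_ord; apply: map_subseq; rewrite enumT; apply: filter_subseq.
    by move/(subseq_sorted ltn_trans); apply; apply: iota_ltn_sorted.
  - apply/eq_mem_map => x; rewrite mem_enum.
    have /subset_cardP H : #|codom c| = #|X| by rewrite card_codom // card_ord.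
    have /H <- : codom c \subset X by apply/fintype.subsetP=> _ /codomP [k ->].
    by rewrite codomE.
move=> k; rewrite /enum_val -cE (nth_map k) ?size_enum_ord //.
by rewrite nth_ord_enum.
Qed.

Lemma mdet_mono g X p (c : 'I_p -> 'I_n) : (#|X| <= p)%N ->
  {homo c : i j / (i < j)%N} -> (forall k, c k \in X) ->
  mdet g c = minor g X.
Proof.
move=> Xp cm cX.
have cinj : injective c.
  move=> i j cij; case: (ltngtP i j) => [/cm|/cm|/val_inj//];
  by rewrite cij ltnn.
have pX : #|X| = p.
  apply/eqP; rewrite eqn_leq Xp -[p in (p <= _)%N]card_ord -(card_codom cinj).
  by apply/subset_leq_card/fintype.subsetP=> _ /codomP [k ->].
subst p; rewrite minorE; apply: eq_mdet.
exact: enum_val_mono.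
Qed.

Lemma card_seg q : (q <= n)%N -> #|seg n q| = q.
Proof.
move=> qn; have inj : injective (widen_ord qn) by move=> a b /(congr1 val) /= /val_inj.
rewrite -[RHS]card_ord -(card_imset _ inj).
apply: eq_card => y; rewrite inE; apply/idP/imsetP => [yq|[z _ ->]] /=.
  by exists (Ordinal yq) => //; apply: val_inj.
exact: ltn_ord.
Qed.

(** The sign that sorts the columns depends on the list only, not on the matrix. *)
Lemma mdet_set p (c : 'I_p -> 'I_n) : injective c ->
  exists b : bool, forall g, mdet g c = (-1) ^+ b * minor g (c @: 'I_p)%SET.
Proof.
move=> cinj; set X := (c @: 'I_p)%SET.
have pX : #|X| = p by rewrite card_imset // card_ord.
have cX k : c k \in X by apply: imset_f.
clearbody X; subst p.
pose s k := enum_rank_in (cX k) (c k).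
have sK k : enum_val (s k) = c k by rewrite /s enum_rankK_in.
have sinj : injective s by move=> i j /(congr1 enum_val); rewrite !sK; apply: cinj.
exists (odd_perm (perm sinj)) => g.
rewrite minorE -mdet_perm; apply: eq_mdet => k; rewrite permE sK //.
Qed.

Lemma mdet_cases p (c : 'I_p -> 'I_n) :
  (exists b : bool, #|(c @: 'I_p)%SET| = p /\
     forall g, mdet g c = (-1) ^+ b * minor g (c @: 'I_p)%SET)
  \/ (~ injective c /\ forall g, mdet g c = 0).
Proof.
case: (boolP (injectiveb c)) => [/injectiveP cinj|/injectivePn [i [j nij cij]]].
  left; have [b bP] := mdet_set cinj; exists b.
  by rewrite card_imset // card_ord.
right; split; first by move=> /(_ _ _ cij) /eqP; rewrite (negPf nij).
by move=> g; apply: mdet_alt nij cij.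
Qed.

(** After expanding both determinants, each of the more than p alternating
    columns carries the index of one of p rows, so two of them share it, and
    their transposition cancels the terms in pairs. *)
Lemma exchange g p q (c : 'I_p + 'I_q -> 'I_n) (A : {set 'I_p + 'I_q}) :
  (q <= p)%N -> (p < #|A|)%N ->
  \sum_(s : {perm 'I_p + 'I_q} | perm_on A s)
    (-1) ^+ s * (mdet g (fun i => c (s (inl i))) * mdet g (fun j => c (s (inr j))))
  = 0.
Proof.
move=> qp pA.
under eq_bigr => s _ do rewrite !mdet_sum big_distrl /= mulr_sumr.
rewrite exchange_big /= big1 // => pi _.
under eq_bigr => s _ do rewrite mulr_sumr mulr_sumr.
rewrite exchange_big /= big1 // => rho _.
(* the row that the Leibniz term of pi and rho uses at the position z *)
pose f (z : 'I_p + 'I_q) : 'I_p :=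
  match z with inl i => pi i | inr j => widen_ord qp (rho j) end.
have fninj : ~~ dinjectiveb f (mem A).
  apply/negP => /dinjectiveP fi.
  have : (#|A| <= #|'I_p|)%N by rewrite -(card_in_imset fi) max_card.
  by rewrite card_ord leqNgt pA.
have /dinjectivePn [z zA [z' /andP[nz z'A] fz]] := fninj.
pose t := tperm z z'.
have tA : perm_on A t.
  apply/fintype.subsetP => x; rewrite inE; case: tpermP => [->|->|_ _]; rewrite ?eqxx //.
have ft x : f (t x) = f x by rewrite /t; case: tpermP => [->|->|].
have -> : \sum_(s | perm_on A s) (-1) ^+ s *
    ((-1) ^+ pi * (\prod_k row_ext g (pi k) (c (s (inl k)))) *
     ((-1) ^+ rho * (\prod_k row_ext g (rho k) (c (s (inr k))))))
  = (-1) ^+ pi * (-1) ^+ rho * \sum_(s : {perm 'I_p + 'I_q} | perm_on A s)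
    (-1) ^+ s * \prod_z row_ext g (f z) (c (s z)) :> K.
  rewrite mulr_sumr; apply: eq_bigr => s _.
  have E (a b c' P Q : K) : a * (b * P * (c' * Q)) = b * c' * (a * (P * Q)) by ring.
  by rewrite big_sumType E.
rewrite [X in _ * X](_ : _ = 0) ?mulr0 //; set S := \sum_(s | _) _.
suff /eqP : S = - S by rewrite -addr_eq0 -mulr2n mulrn_eq0 => /eqP.
rewrite {1}/S (reindex_inj (mulgI t)) /= -sumrN.
apply: eq_big => [s|s _].
  apply/idP/idP => [ts|]; last exact: perm_onM.
  by rewrite -[s](mulKg t) tpermV; apply: perm_onM.
rewrite odd_permM odd_tperm eq_sym nz signr_addb expr1 mulN1r mulNr; congr (- (_ * _)).
rewrite (reindex_inj (@perm_inj _ t)) /=; apply: eq_bigr => x _.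
by rewrite ft permM tpermK.
Qed.

(** Add to the rows of the first p + 1 rows of g, restricted to the columns
    e_0, ..., e_(p+1) of seg i, i, j, x and X in this order, a last row whose
    k-th entry is the p-minor with e_k in place of i. By cofactor expansion
    that row is a combination of the first p, so the determinant vanishes.
    Expanding it along the last row leaves three terms, since elsewhere the
    p-minor repeats a column. *)
Lemma minor_quad g (a : quad n) :
  let: (i, j, x, X) := val a in
  minor g (seg n i :|: [set i] :|: X)%SET * minor g (seg n i :|: [set j; x] :|: X)%SET
  - minor g (seg n i :|: [set j] :|: X)%SET * minor g (seg n i :|: [set i; x] :|: X)%SET
  + minor g (seg n i :|: [set x] :|: X)%SET * minor g (seg n i :|: [set i; j] :|: X)%SET
  = 0.
Proof.
case: a => [[[[i j] x] X]] /= /and3P [ij jx /forall_inP xX].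
pose h := #|X|; pose p := (i + h).+1.
pose e (k : nat) : 'I_n := if (k < i)%N then insubd i k else
  if k == i then i else if k == i.+1 then j else if k == i.+2 then x else
  nth x (enum X) (k - i.+3).
have ei : e i = i by rewrite /e ltnn eqxx.
have ej : e i.+1 = j by rewrite /e ltnNge leqnSn /= eqn_leq ltnn eqxx.
have ex : e i.+2 = x by rewrite /e; do ! case: ifP => //; lia.
have elo k : (k < i)%N -> e k = k :> nat.
  move=> ki; rewrite /e ki val_insubd; case: ltnP => //; have := ltn_ord i; lia.
have eX k : (i.+3 <= k < p.+2)%N -> e k \in X.
  move=> kp; rewrite /e; do 4 ! [case: ifP => [?|_]; first by exfalso; lia].
  by rewrite -mem_enum mem_nth // -cardE -/h; lia.
have emono k l : (k < l)%N -> (l < p.+2)%N -> (e k < e l)%N.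
  move=> kl lp; case: (ltnP l i.+3) => li; last first.
    case: (ltnP k i.+3) => ki; last first.
      rewrite /e; do 8 ! [case: ifP => [?|_]; first by exfalso; lia].
      have : sorted ltn (map val (enum X)).
        have : subseq (map val (enum X)) (iota 0 n).
          by rewrite -val_enum_ord; apply: map_subseq; rewrite enumT; apply: filter_subseq.
        by move/(subseq_sorted ltn_trans); apply; apply: iota_ltn_sorted.
      move=> so; rewrite -(nth_map x (val x)) -?cardE -/h; last lia.
      rewrite -[X in (_ < X)%N](nth_map x (val x)) -?cardE -/h; last lia.
      apply: (sorted_ltn_nth ltn_trans) => //; rewrite ?inE ?size_map -?cardE -/h; lia.
    have xl : (x < e l)%N by apply/xX/eX; lia.
    apply: leq_ltn_trans xl; have [ki'|ki'] := ltnP k i; first by rewrite elo; lia.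
    have : k = i \/ k = i.+1 \/ k = i.+2 by lia.
    by move=> [->|[->|->]]; rewrite ?ei ?ej ?ex; lia.
  have [li'|li'] := ltnP l i; first by rewrite !elo; lia.
  have [ki'|ki'] := ltnP k i.
    rewrite elo //; have : l = i \/ l = i.+1 \/ l = i.+2 by lia.
    by move=> [->|[->|->]]; rewrite ?ei ?ej ?ex; lia.
  have : k = i /\ l = i.+1 \/ k = i /\ l = i.+2 \/ k = i.+1 /\ l = i.+2 by lia.
  by move=> [[-> ->]|[[-> ->]|[-> ->]]]; rewrite ?ei ?ej ?ex; lia.
pose c (u : 'I_n) (k : 'I_p) := if (k < i)%N then e k else if k == i :> nat then u else e k.+2.
have uX (u : 'I_n) (uL : (u <= x)%N) k : (i.+2 < k < p.+2)%N -> (u < e k)%N.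
  by move=> /eX/xX; apply: leq_ltn_trans.
have cE (u : 'I_n) : (i <= u)%N -> (u <= x)%N -> mdet g (c u) = minor g (seg n i :|: [set u] :|: X)%SET.
  move=> iu ux; apply: mdet_mono => [|k l kl|k].
  - apply: leq_trans (leq_card_setU _ _) _.
    rewrite /p -addSn leq_add2r; apply: leq_trans (leq_card_setU _ _) _.
    by rewrite cards1 card_seg ?addn1 // ltnW.
  - have lp := ltn_ord l; rewrite /c; case: (ltnP l i) => li.
      by rewrite (ltn_trans kl li); apply: emono; lia.
    case: (ltnP k i) => ki.
      rewrite (elo k ki); case: eqP => li'; first by lia.
      by apply: ltn_trans (uX u ux l.+2 _); lia.
    have -> : (l == i :> nat) = false by lia.
    by case: eqP => ki'; [apply: uX|apply: emono]; lia.
  - have kp := ltn_ord k; rewrite /c !inE; case: (ltnP k i) => ki; first by rewrite elo ?ki.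
    by case: eqP => ki'; rewrite ?eqxx ?orbT // eX ?orbT //; lia.
have eE l (Y : {set 'I_n}) : (i <= l <= i.+2)%N -> 
    Y = ((seg n i :|: [set e (bump l i); e (bump l i.+1)]) :|: X)%SET ->
    mdet g (fun k : 'I_p.+1 => e (bump l k)) = minor g Y.
  move=> il ->; apply: mdet_mono => [|k1 k2 kl|k].
  - apply: leq_trans (leq_card_setU _ _) _.
    rewrite /p -!addSn leq_add2r; apply: leq_trans (leq_card_setU _ _) _.
    by rewrite cards2 card_seg ?(ltnW (ltn_ord i)) //; case: eqP => _ /=; lia.
  - by apply: emono; rewrite /bump; have := ltn_ord k2; lia.
  - have kp := ltn_ord k; rewrite !inE; case: (ltnP k i) => ki.
      by rewrite elo /bump; lia.
    have [->|[->|ki']] : k = i :> nat \/ k = i.+1 :> nat \/ (k > i.+1)%N by lia.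
    + by rewrite eqxx !orbT.
    + by rewrite eqxx !orbT.
    + by rewrite eX ?orbT // /bump; lia.
pose M := \matrix_(r < p.+2, k < p.+2)
  if (r < p.+1)%N then row_ext g r (e k) else mdet g (c (e k)).
have M0 : \det M = 0.
  apply/eqP/det0P.
  pose ip : 'I_p := inord i.
  have ipE : ip = i :> nat by rewrite inordK // /p; lia.
  have expand u : mdet g (c u) = \sum_(r < p) row_ext g r u * cofactor
      (\matrix_(r < p, k < p) row_ext g r (c i k)) r ip.
    rewrite /mdet (expand_det_col _ ip); apply: eq_bigr => r _.
    rewrite !mxE /c ipE ltnn eqxx; congr (_ * (_ * \det _)).
    apply/matrixP=> r' k'; rewrite !mxE /c.
    case: ifP => // _; case: eqP => // li; case/eqP: (neq_lift ip k').
    by apply: val_inj; apply: etrans ipE (esym li).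
  (* the coefficients of the dependence: the cofactors along the column of i *)
  pose w := \row_(r < p.+2) (if r == ord_max then -1 else
     if insub (val r) is Some r' then cofactor
      (\matrix_(r < p, k < p) row_ext g r (c i k)) r' ip else 0).
  exists w.
    by apply/eqP => /rowP /(_ ord_max) /eqP; rewrite !mxE eqxx oppr_eq0 oner_eq0.
  apply/rowP => k; rewrite !mxE big_ord_recr /= !mxE eqxx ltnn big_ord_recr /= !mxE.
  rewrite -val_eqE /= ltn_eqF // insubF ?ltnn // mul0r addr0 expand mulN1r.
  apply/eqP; rewrite subr_eq0; apply/eqP; apply: eq_bigr => r _; rewrite !mxE /=.
  rewrite ifF; last by apply/negP => /eqP/(congr1 val) /=; have := ltn_ord r; lia.
  rewrite insubT //= => rp; rewrite (ltn_trans rp) // mulrC; congr (_ * cofactor _ _ _).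
have := expand_det_row M ord_max; rewrite M0.
pose o0 : 'I_p.+2 := inord i.
pose o1 : 'I_p.+2 := inord i.+1.
pose o2 : 'I_p.+2 := inord i.+2.
have pE : p = (i + h).+1 by [].
have oE l : (l < p.+2)%N -> (inord l : 'I_p.+2) = l :> nat by move=> lp; rewrite inordK.
rewrite (bigD1 o0) // (bigD1 o1) /=; last by rewrite -val_eqE /= !oE /p; lia.
rewrite (bigD1 o2) /=; last by rewrite -!val_eqE /= !oE /p; lia.
rewrite big1 => [|l /andP[/andP[l0 l1] l2]]; last first.
  rewrite mxE /= ltnn; suff -> : mdet g (c (e l)) = 0 by rewrite mul0r.
  move: l0 l1 l2; rewrite -!val_eqE /= !oE ?addr0; try lia; move=> /eqP l0 /eqP l1 /eqP l2.
  have lp := ltn_ord l.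
  pose l' := if (l < i)%N then l : nat else (l - 2)%N.
  have l'p : (l' < p)%N.
    by rewrite /l'; case: (ltnP l i) => li; clear -li lp pE l0 l1 l2; lia.
  have ip : (i < p)%N by rewrite /p; lia.
  apply: (@mdet_alt _ _ _ (Ordinal ip) (Ordinal l'p)).
    by rewrite -val_eqE /= /l'; case: (ltnP l i) => li; clear -li lp pE l0 l1 l2; lia.
  rewrite /c /= ltnn eqxx /l'; case: (ltnP l i) => li; first by rewrite li.
  have -> : (l - 2 < i)%N = false by clear -li lp pE l0 l1 l2; lia.
  have -> : (l - 2 == i)%N = false by clear -li lp pE l0 l1 l2; lia.
  by congr e; clear -li lp pE l0 l1 l2; lia.
have cof l : (i <= l <= i.+2)%N -> cofactor M ord_max (inord l : 'I_p.+2) =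
    (-1) ^+ (p.+1 + l) * mdet g (fun k : 'I_p.+1 => e (bump l k)).
  move=> il; rewrite /cofactor /= oE /p; last lia.
  congr (_ * \det _); apply/matrixP=> r k; rewrite !mxE /= oE /p; last lia.
  have -> : bump (i + h).+2 r = r by rewrite /bump leqNgt ltn_ord.
  by rewrite ltn_ord.
have Mrow l : (l < p.+2)%N -> M ord_max (inord l : 'I_p.+2) = mdet g (c (e l)).
  by move=> lp; rewrite mxE /= ltnn oE.
have il0 : (i <= i <= i.+2)%N by lia.
have il1 : (i <= i.+1 <= i.+2)%N by lia.
have il2 : (i <= i.+2 <= i.+2)%N by lia.
have ix : (i <= x)%N by apply: ltnW (ltn_trans ij jx).
rewrite /o0 /o1 /o2 (cof _ il0) (cof _ il1) (cof _ il2) !Mrow ?ei ?ej ?ex; try by rewrite pE; lia.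
rewrite !cE ?(ltnW ij) ?(ltnW jx) //.
have b0 : bump i i = i.+1 by rewrite /bump leqnn.
have b1 : bump i i.+1 = i.+2 by rewrite /bump leqnSn.
have b2 : bump i.+1 i = i by rewrite /bump ltnn.
have b3 : bump i.+1 i.+1 = i.+2 by rewrite /bump leqnn.
have b4 : bump i.+2 i = i by rewrite /bump ltnNge leqnSn.
have b5 : bump i.+2 i.+1 = i.+1 by rewrite /bump ltnn.
rewrite (eE i (seg n i :|: [set j; x] :|: X)%SET il0) ?b0 ?b1 ?ej ?ex //.
rewrite (eE i.+1 (seg n i :|: [set i; x] :|: X)%SET il1) ?b2 ?b3 ?ei ?ex //.
rewrite (eE i.+2 (seg n i :|: [set i; j] :|: X)%SET il2) ?b4 ?b5 ?ei ?ej //.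
have -> : (p.+1 + i.+2 = (p.+1 + i).+2)%N by lia.
rewrite addnS; move: (p.+1 + i)%N => N; rewrite !exprS.
have s0 : (-1) ^+ N != 0 :> K by rewrite signr_eq0.
move: ((-1) ^+ N) s0 => s s0 H; apply: (mulfI s0); rewrite mulr0 [RHS]H; ring.
Qed.

(** Cauchy-Binet. *)
Lemma minor_mul_tr g h p : (p <= n)%N ->
  minor (g *m h^T) (seg n p) =
  \sum_(X : {set 'I_n} | #|X| == p) minor g X * minor h X.
Proof.
move=> pn.
have seqE : minor (g *m h^T) (seg n p) =
  \det (\matrix_(r < p, k < p) \sum_c row_ext g r c * row_ext h k c).
  rewrite -(@mdet_mono _ (seg n p) p (widen_ord pn)) ?card_seg //; last first.
    by move=> k; rewrite inE /=.
  congr (\det _); apply/matrixP=> r k; rewrite !mxE /row_ext.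
  have rn := leq_trans (ltn_ord r) pn; have kn := leq_trans (ltn_ord k) pn.
  rewrite !insubT mxE; apply: eq_bigr => c _; rewrite !mxE.
  by congr (_ * h _ _); apply: val_inj.
rewrite seqE.
(* expansion of each column by multilinearity *)
have -> : \det (\matrix_(r < p, k < p) \sum_c row_ext g r c * row_ext h k c) =
  \sum_(f : {ffun 'I_p -> 'I_n}) mdet g f * \prod_(k < p) row_ext h k (f k).
  rewrite -det_tr; transitivity (\sum_(s : 'S_p) (-1) ^+ s *
     \sum_(f : {ffun 'I_p -> 'I_n}) \prod_k (row_ext g (s k) (f k) * row_ext h k (f k))).
    apply: eq_bigr => s _; congr (_ * _).
    rewrite -(bigA_distr_bigA (fun k c => row_ext g (s k) c * row_ext h k c)) /=.
    by apply: eq_bigr => k _; rewrite !mxE.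
  under eq_bigr => s _ do rewrite mulr_sumr.
  rewrite exchange_big; apply: eq_bigr => f _.
  rewrite mdet_sum mulr_suml; apply: eq_bigr => s _.
  by rewrite big_split /= mulrA.
rewrite (bigID (fun f : {ffun 'I_p -> 'I_n} => injectiveb f)) /= [X in _ + X]big1 ?addr0;
  last first.
  move=> f /injectivePn [i [j nij fij]]; rewrite (mdet_alt _ nij fij) mul0r //.
rewrite (partition_big (fun f : {ffun 'I_p -> 'I_n} => (f @: 'I_p)%SET)
   (fun X => #|X| == p)) /=; last first.
  by move=> f /injectiveP fi; rewrite card_imset // card_ord.
apply: eq_bigr => X /eqP pX.
subst p; pose e (k : 'I_#|X|) : 'I_n := enum_val k.
have einj : injective e by apply: enum_val_inj.
pose F (s : 'S_#|X|) := [ffun k => e (s k)].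
have Finj : injective F.
  by move=> s t /ffunP st; apply/permP => k; apply: einj; have := st k; rewrite !ffunE.
rewrite (eq_bigl (mem (F @: 'S_#|X|)%SET)); last first.
  move=> f; apply/andP/imsetP => [[/injectiveP fi /eqP fX]|[s _ ->]]; last first.
    split; first by apply/injectiveP => k l; rewrite !ffunE => /einj /perm_inj.
    apply/eqP/setP => y; apply/imsetP/idP => [[k _ ->]|yX].
      by rewrite ffunE; apply: enum_valP.
    exists ((s^-1)%g (enum_rank_in yX y)) => //.
    by rewrite ffunE permKV /e enum_rankK_in.
  have fk k : f k \in X by move/setP/(_ (f k)): fX => <-; apply: imset_f.
  pose s k := enum_rank_in (fk k) (f k).
  have sK k : e (s k) = f k by rewrite /e /s enum_rankK_in.
  have sinj : injective s by move=> k l /(congr1 e); rewrite !sK => /fi.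
  by exists (perm sinj) => //; apply/ffunP => k; rewrite ffunE permE sK.
rewrite big_imset /=; last by move=> s t _ _; apply: Finj.
rewrite !minorE [X in _ * X]/mdet /determinant mulr_sumr.
apply: eq_big => [s|s _]; first by rewrite inE.
have -> : mdet g (F s) = (-1) ^+ s * mdet g e.
  by rewrite -mdet_perm; apply: eq_mdet => k; rewrite ffunE.
rewrite -mulrA mulrCA; congr (_ * (_ * _)).
by apply: eq_bigr => k _; rewrite !mxE ffunE.
Qed.

End Minors.

(** * Straightening a product of two minors *)

Section PushPerm.
Variables (S T : finType) (h : S -> T) (hinj : injective h).
Implicit Types s t : {perm S}.

(** The extension of a permutation along an injection h, by the identity off
    the image. *)
Definition push_fun s (z : T) : T := if [pick i | h i == z] is Some i then h (s i) else z.

Lemma push_funE s i : push_fun s (h i) = h (s i).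
Proof.
by rewrite /push_fun; case: pickP => [j /eqP /hinj -> //|/(_ i)]; rewrite eqxx.
Qed.

Lemma push_fun_out s z : (forall i, h i != z) -> push_fun s z = z.
Proof. by rewrite /push_fun => H; case: pickP => // i; rewrite (negPf (H i)). Qed.

Lemma push_cases (z : T) : (exists i, z = h i) \/ (forall i, h i != z).
Proof.
case: (boolP [exists i, h i == z]) => [/existsP [i /eqP <-]|/existsPn H]; last by right.
by left; exists i.
Qed.

Lemma push_fun_inj s : injective (push_fun s).
Proof.
move=> z z'; case: (push_cases z) => [[i ->]|Hz]; case: (push_cases z') => [[i' ->]|Hz'];
  rewrite ?push_funE ?push_fun_out //.
- by move=> /hinj /perm_inj ->.
- by move=> H; case/eqP: (Hz' (s i)).
- by move=> H; case/eqP: (Hz (s i')).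
Qed.

Definition push_perm s := perm (@push_fun_inj s).

Lemma push_permE s i : push_perm s (h i) = h (s i).
Proof. by rewrite permE push_funE. Qed.

Lemma push_perm_out s z : (forall i, h i != z) -> push_perm s z = z.
Proof. by move=> H; rewrite permE push_fun_out. Qed.

Lemma push_permM s t : push_perm (s * t)%g = (push_perm s * push_perm t)%g.
Proof.
apply/permP => z; rewrite permM; case: (push_cases z) => [[i ->]|H].
  by rewrite !push_permE permM.
by rewrite !push_perm_out.
Qed.

Lemma push_perm1 : push_perm 1%g = 1%g.
Proof.
apply/permP => z; rewrite perm1; case: (push_cases z) => [[i ->]|H].
  by rewrite !push_permE perm1.
by rewrite !push_perm_out.
Qed.

Lemma odd_push_perm s : odd_perm (push_perm s) = odd_perm s.
Proof.
have [ts -> _] := prod_tpermP s.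
elim: ts => [|t ts IH]; first by rewrite !big_nil push_perm1 !odd_perm1.
rewrite !big_cons push_permM !odd_permM IH.
congr (_ (+) _); suff -> : push_perm (tperm t.1 t.2) = tperm (h t.1) (h t.2).
  by rewrite !odd_tperm (inj_eq hinj).
apply/permP => z; case: (push_cases z) => [[i ->]|H].
  rewrite push_permE; case: (tpermP t.1 t.2 i) => [->|->|/eqP a /eqP b].
  - by rewrite tpermL.
  - by rewrite tpermR.
  - by rewrite tpermD // (inj_eq hinj) eq_sym.
by rewrite push_perm_out // tpermD.
Qed.
End PushPerm.

(** A permutation of a finite disjoint union that preserves the first summand
    also preserves the second one. *)
Lemma sum_perm_split (S T : finType) (s : {perm S + T}) :
  (forall i, exists i', s (inl i) = inl i') ->
  exists (s1 : {perm S}) (s2 : {perm T}),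
    [/\ forall i, s (inl i) = inl (s1 i), forall j, s (inr j) = inr (s2 j) &
      odd_perm s = odd_perm s1 (+) odd_perm s2].
Proof.
move=> sl.
pose f1 i := if s (inl i) is inl i' then i' else i.
have f1E i : s (inl i) = inl (f1 i) by rewrite /f1; have [i' ->] := sl i.
have f1inj : injective f1.
  by move=> i i' H; have := f1E i; rewrite H -f1E => /perm_inj [].
have sr j : exists j', s (inr j) = inr j'.
  case E : (s (inr j)) => [i|j']; last by exists j'.
  have := f1E (invF f1inj i); rewrite f_invF -E => /perm_inj //.
pose f2 j := if s (inr j) is inr j' then j' else j.
have f2E j : s (inr j) = inr (f2 j) by rewrite /f2; have [j' ->] := sr j.
have f2inj : injective f2.
  by move=> i i' H; have := f2E i; rewrite H -f2E => /perm_inj [].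
exists (perm f1inj), (perm f2inj); split=> [i|j|]; rewrite ?permE //.
have il : injective (@inl S T) by move=> ? ? [].
have ir : injective (@inr S T) by move=> ? ? [].
rewrite -(odd_push_perm il) -(odd_push_perm ir) -odd_permM; congr odd_perm.
apply/permP => -[i|j]; rewrite permM.
  by rewrite push_permE permE push_perm_out // f1E.
by rewrite (@push_perm_out _ _ _ il) // push_permE permE f2E.
Qed.

Section Straighten.
Variables (K : numFieldType) (n : nat).
Implicit Types (g : 'M[K]_n) (X Y : {set 'I_n}).

Definition wsum X : nat := \sum_(y in X) y.

(** Alternate the columns of X from q on together with those of Y below q: there
    are more than |X| of them, so [exchange] applies. A permutation that does not
    keep X brings into it an element below q for one from q on, which lowers the
    sum of X; those that keep X all contribute the same product. *)
Lemma minor_straighten X Y q : (#|Y| <= #|X|)%N ->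
  (#|X :&: seg n q| < #|Y :&: seg n q|)%N ->
  exists2 L : seq (K * ({set 'I_n} * {set 'I_n})),
   (forall t, t \in L -> [/\ #|t.2.1| = #|X|, #|t.2.2| = #|Y|,
      (wsum t.2.1 < wsum X)%N & (wsum t.2.1 + wsum t.2.2 = wsum X + wsum Y)%N]) &
   forall g, minor g X * minor g Y = \sum_(t <- L) t.1 * (minor g t.2.1 * minor g t.2.2).
Proof.
move=> YX XY.
pose c (z : 'I_#|X| + 'I_#|Y|) : 'I_n := match z with inl i => enum_val i | inr j => enum_val j end.
pose A := [set z | match z with inl i => (q <= c z)%N | inr j => (c z < q)%N end]%SET.
have cardA : (#|X| < #|A|)%N.
  have -> : #|A| = (\sum_(x in X) (q <= x) + \sum_(y in Y) (y < q))%N.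
    rewrite -sum1_card big_mkcond big_sumType /=.
    by congr addn; rewrite [RHS]big_enum_val; apply: eq_bigr => i _; rewrite inE /=; case: ifP.
  have -> : (\sum_(y in Y) (y < q) = #|Y :&: seg n q|)%N.
    rewrite -sum1_card big_mkcond [RHS]big_mkcond /=; apply: eq_bigr => y _.
    by rewrite !inE; case: (y \in Y); case: (y < q)%N.
  apply: leq_trans (_ : \sum_(x in X) (q <= x) + #|X :&: seg n q| < _)%N; last first.
    by rewrite ltn_add2l.
  rewrite ltnS -sum1_card -[in X in (_ <= _ + X)%N]sum1_card ![X in (X <= _)%N]big_mkcond
    ![X in (_ <= X + _)%N]big_mkcond ![X in (_ <= _ + X)%N]big_mkcond -big_split /=.
  by apply: leq_sum => x _; rewrite !inE; case: (x \in X); case: (leqP q x).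
pose good (s : {perm 'I_#|X| + 'I_#|Y|}) := [forall i, if s (inl i) is inl _ then true else false].
pose D g (s : {perm 'I_#|X| + 'I_#|Y|}) := (-1) ^+ s * (mdet g (fun i => c (s (inl i))) * mdet g (fun j => c (s (inr j)))).
have Dgood g s : good s -> D g s = minor g X * minor g Y.
  move=> /forallP gs; have [i|s1 [s2 [s1E s2E odds]]] := @sum_perm_split _ _ s.
    by have := gs i; case: (s (inl i)) => // i' _; exists i'.
  rewrite /D (eq_mdet _ (c' := fun i => enum_val (s1 i))); last by move=> i; rewrite s1E.
  rewrite (eq_mdet _ (c' := fun i => enum_val (s2 i))); last by move=> i; rewrite s2E.
  rewrite !mdet_perm -!minorE odds signr_addb mulrACA -mulrA mulrA.
  by rewrite !signrMK.
have bad s : exists t : K * ({set 'I_n} * {set 'I_n}), perm_on A s -> ~~ good s ->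
   (t.1 != 0 -> [/\ #|t.2.1| = #|X|, #|t.2.2| = #|Y|,
      (wsum t.2.1 < wsum X)%N & (wsum t.2.1 + wsum t.2.2 = wsum X + wsum Y)%N]) /\
   forall g, D g s = t.1 * (minor g t.2.1 * minor g t.2.2).
  case: (boolP (perm_on A s)) => sA; last by exists (0, (finset.set0, finset.set0)).
  case: (boolP (good s)) => gs; first by exists (0, (finset.set0, finset.set0)).
  case: (mdet_cases K (fun i => c (s (inl i)))) => [[b [cb bP]]|[_ z]]; last first.
    exists (0, (finset.set0, finset.set0)) => _ _; split; first by rewrite eqxx.
    by move=> g; rewrite /D z !(mulr0, mul0r).
  case: (mdet_cases K (fun i => c (s (inr i)))) => [[b' [cb' bP']]|[_ z]]; last first.
    exists (0, (finset.set0, finset.set0)) => _ _; split; first by rewrite eqxx.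
    by move=> g; rewrite /D z !(mulr0, mul0r).
  set X' := (_ @: _)%SET in cb bP; set Y' := (_ @: _)%SET in cb' bP'.
  exists ((-1) ^+ s * ((-1) ^+ b * (-1) ^+ b'), (X', Y')) => _ _; split; last first.
    by move=> g; rewrite /D bP bP' /= mulrACA !mulrA.
  move=> _ /=.
  have inj1 : injective (fun i => c (s (inl i))).
    by apply/injectiveP/dinjectiveP/imset_injP; rewrite -/X' cb card_ord.
  have inj2 : injective (fun i => c (s (inr i))).
    by apply/injectiveP/dinjectiveP/imset_injP; rewrite -/Y' cb' card_ord.
  have wX' : wsum X' = (\sum_i c (s (inl i)))%N by rewrite /wsum big_imset //= => ? ? _ _ /inj1.
  have wY' : wsum Y' = (\sum_i c (s (inr i)))%N by rewrite /wsum big_imset //= => ? ? _ _ /inj2.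
  have wXE : wsum X = (\sum_i c (inl i))%N by rewrite /wsum big_enum_val.
  have wYE : wsum Y = (\sum_i c (inr i))%N by rewrite /wsum big_enum_val.
  split=> //; last first.
    rewrite wX' wY' wXE wYE.
    transitivity (\sum_z c (s z))%N; first by rewrite big_sumType.
    rewrite -(reindex_inj (@perm_inj _ s) (P := fun _ => true) (F := fun z => c z : nat)).
    by rewrite big_sumType.
  pose isl (z : 'I_#|X| + 'I_#|Y|) : nat := if z is inl _ then 1%N else 0%N.
  have sumisl : (\sum_z isl (s z) = \sum_z isl z)%N.
    by rewrite [RHS](reindex_inj (@perm_inj _ s)).
  have wX'2 : wsum X' = (\sum_z isl z * c (s z))%N.
    rewrite wX' big_sumType /= [X in (_ + X)%N]big1 ?addn0 //.
    by apply: eq_bigr => i _; rewrite mul1n.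
  have wX2 : wsum X = (\sum_z isl (s z) * c (s z))%N.
    rewrite -(reindex_inj (@perm_inj _ s) (P := fun _ => true) (F := fun z => isl z * c z)%N).
    rewrite wXE big_sumType /= [X in (_ + X)%N]big1 ?addn0 //.
    by apply: eq_bigr => i _; rewrite mul1n.
  have moved z : s z != z -> s z \in A.
    move=> sz; rewrite perm_closed //; by move/fintype.subsetP: sA; apply; rewrite inE.
  (* a position whose occupant changes side exchanges columns on both sides of q *)
  have pw z : (isl z * c (s z) + isl (s z) * q <= isl (s z) * c (s z) + isl z * q)%N.
    have := moved z; rewrite inE; case: z => [i|j]; case: (s _) => [i'|j'] /=; lia.
  have [i0 i0P] := forallPn gs.
  rewrite -(ltn_add2r ((\sum_z isl (s z)) * q)) {2}sumisl !big_distrl /= wX'2 wX2 -!big_split /=.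
  rewrite (bigD1 (inl i0)) //= [X in (_ < X)%N](bigD1 (inl i0)) //= -addSn leq_add ?leq_sum //.
  have := moved (inl i0); rewrite inE; move: i0P; case: (s _) => [//|j'] _ /=.
  by move=> /(_ isT); lia.
have [t tP] := choice bad.
pose N : nat := #|[set s : {perm 'I_#|X| + 'I_#|Y|} | perm_on A s && good s]%SET|.
have N0 : N%:R != 0 :> K.
  rewrite pnatr_eq0 -lt0n card_gt0; apply/set0Pn; exists 1%g.
  by rewrite inE perm_on1; apply/forallP => i; rewrite perm1.
pose B := [seq s <- enum {: {perm 'I_#|X| + 'I_#|Y|}} | [&& perm_on A s, ~~ good s & (t s).1 != 0]].
exists [seq (- (N%:R)^-1 * (t s).1, (t s).2) | s <- B].
  move=> _ /mapP [s + ->] /=; rewrite mem_filter => /andP [/and3P [sA gs ts] _].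
  by have [+ _] := tP s sA gs; apply.
move=> g; rewrite big_map big_filter big_enum_cond /=.
have := @exchange K n g _ _ c A YX cardA; rewrite -/(D g) (bigID good) /=.
rewrite (eq_bigr (fun=> minor g X * minor g Y)) => [|s /andP [_ /(Dgood g)]//].
have -> : \sum_(s | perm_on A s && good s) minor g X * minor g Y = minor g X * minor g Y * N%:R.
  by rewrite sumr_const mulr_natr; congr (_ *+ _); apply: eq_card => s; rewrite inE.
move/eqP; rewrite addr_eq0 => /eqP H.
apply: (mulIf N0); rewrite H mulr_suml -sumrN.
rewrite (bigID (fun s => (t s).1 == 0)) /= big1 ?add0r; last first.
  by move=> s /andP [/andP [sA gs] /eqP ts]; have [_ /(_ g)] := tP s sA gs; rewrite /D ts mul0r => ->; rewrite oppr0.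
apply: eq_big => [s|s /andP [/andP [sA gs] _]]; first by rewrite -andbA.
have [_ /(_ g)] := tP s sA gs; rewrite /D => ->.
move: (t s).1 (_ * minor _ _) => a u.
move: (N%:R : K) N0 => b b0; field; exact: b0.
Qed.
End Straighten.

(** * Monomials in minors *)

Definition ex (n : nat) := {ffun proper_sets n -> nat}.

(** Locked, because comparing distinct exponents up to unfolding is expensive. *)
HB.lock Definition addx (n : nat) (x y : ex n) : ex n := [ffun X => x X + y X]%N.
HB.lock Definition e1 (n : nat) (X : proper_sets n) : ex n := [ffun Y => Y == X : nat].

Section Exponents.
Variable n : nat.
Implicit Types (x y : ex n) (X Y : proper_sets n).

Definition deg x p : nat := \sum_(X : proper_sets n | #|val X| == p) x X.
(** The number of columns of the monomial with at least p entries below q: the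
    entry m_(p,q) of its diagram. *)
Definition rsum x p q : nat := \sum_(X : proper_sets n | (p <= #|val X :&: seg n q|)%N) x X.
Definition total x : nat := \sum_X x X.

Lemma proper_cardE (S : {set 'I_n}) :
  ((S != finset.set0) && (S != finset.setT)) = (0 < #|S| < n)%N.
Proof.
rewrite -card_gt0 andbC [RHS]andbC; congr andb.
by rewrite -finset.properT properEcard finset.subsetT cardsT card_ord.
Qed.

Lemma addxE x y X : addx x y X = (x X + y X)%N. Proof. by rewrite unlock ffunE. Qed.
Lemma e1E X Y : e1 X Y = (Y == X) :> nat. Proof. by rewrite unlock ffunE. Qed.

Lemma deg_add x y p : deg (addx x y) p = (deg x p + deg y p)%N.
Proof. by rewrite /deg -big_split; apply: eq_bigr => X _; rewrite (e1E, addxE). Qed.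

Lemma sum_e1 (P : pred (proper_sets n)) (F : proper_sets n -> nat) X :
  (\sum_(Y | P Y) e1 X Y * F Y = P X * F X)%N.
Proof.
rewrite big_mkcond (bigD1 X) //= big1 => [|Y YX].
  by rewrite (e1E, addxE) eqxx addn0; case: (P X).
by rewrite (e1E, addxE) (negPf YX); case: (P Y).
Qed.

Lemma deg_e1 X p : deg (e1 X) p = (#|val X| == p).
Proof.
rewrite /deg -[RHS]muln1 -(sum_e1 (fun X => #|val X| == p) (fun=> 1%N)).
by apply: eq_bigr => Y _; rewrite muln1.
Qed.

Lemma total_deg x : total x = (\sum_(p < n.+1) deg x p)%N.
Proof.
rewrite /total (partition_big (fun X : proper_sets n => inord #|val X| : 'I_n.+1) xpredT) //=.
apply: eq_bigr => p _; apply: eq_bigl => X; rewrite -val_eqE /= inordK //.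
by rewrite ltnS card_set_ord.
Qed.

Lemma exB x X : (0 < x X)%N -> exists y, x = addx y (e1 X).
Proof.
move=> xX; exists [ffun Z => x Z - (Z == X)]%N; apply/ffunP => Z; rewrite !(ffunE, addxE, e1E).
by case: eqP => [->|_]; rewrite ?subnK // subn0 addn0.
Qed.

(** The order on columns of semistandard tableaux. *)
Definition above X Y : bool :=
  [forall q : 'I_n.+1, (#|val Y :&: seg n q| <= #|val X :&: seg n q|)%N].

Definition standard x : bool :=
  [forall X, forall Y, (0 < x X)%N && (0 < x Y)%N ==> above X Y || above Y X].

(** The offset makes shorter columns heavier than longer ones. The square is
    convex, so that [energy] grows when a lighter column passes some of its sum
    to a heavier one. *)
Definition weight_sq (S : {set 'I_n}) : nat := ((wsum S + (n - #|S|) * n ^ 2) ^ 2)%N.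
Definition energy x : nat := (\sum_X x X * weight_sq (val X))%N.

Lemma energy_add x y : energy (addx x y) = (energy x + energy y)%N.
Proof. by rewrite /energy -big_split; apply: eq_bigr => X _; rewrite (e1E, addxE) mulnDl. Qed.

Lemma energy_e1 X : energy (e1 X) = weight_sq (val X).
Proof. by rewrite /energy (sum_e1 xpredT) mul1n. Qed.

Lemma wsum_le (S : {set 'I_n}) : (wsum S <= n ^ 2)%N.
Proof.
rewrite /wsum; apply: leq_trans (_ : \sum_(y in S) n <= _)%N.
  by apply: leq_sum => y _; apply: ltnW.
by rewrite sum_nat_const -mulnn leq_mul2r card_set_ord orbT.
Qed.

Lemma energy_le x : (energy x <= total x * (n ^ 2 + n * n ^ 2) ^ 2)%N.
Proof.
rewrite /energy /total big_distrl /=; apply: leq_sum => X _.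
rewrite leq_mul2l leq_sqr leq_add ?wsum_le ?orbT // leq_mul2r leq_subr orbT //.
Qed.
End Exponents.

Section Swap.
Variable n : nat.
Implicit Types (x y : ex n) (X Y : proper_sets n).

(** Before squaring, the weights u <= w of X and Y become u - d and w + d. *)
Lemma swap_columns y X Y X' Y' :
  #|val X'| = #|val X| -> #|val Y'| = #|val Y| -> (#|val Y| <= #|val X|)%N ->
  (#|val X| = #|val Y| -> wsum (val X) <= wsum (val Y))%N ->
  (wsum (val X') < wsum (val X))%N ->
  (wsum (val X') + wsum (val Y') = wsum (val X) + wsum (val Y))%N ->
  let x := addx (addx y (e1 Y)) (e1 X) in
  let x' := addx (addx y (e1 Y')) (e1 X') in
  [/\ forall p, deg x' p = deg x p, total x' = total x & (energy x < energy x')%N].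
Proof.
move=> tX tY cXY wXY wt wtt x x'.
have dx' p : deg x' p = deg x p.
  by rewrite /x /x' deg_add deg_add deg_e1 deg_e1 deg_add deg_add deg_e1 deg_e1 tX tY.
split=> //; first by rewrite !total_deg; apply: eq_bigr => p _; rewrite dx'.
rewrite /x /x' !energy_add !energy_e1 -!addnA ltn_add2l /weight_sq tX tY.
have [d dE] : exists d, wsum (val X) = (wsum (val X') + d.+1)%N.
  by exists (wsum (val X) - wsum (val X')).-1; lia.
have dE' : wsum (val Y') = (wsum (val Y) + d.+1)%N by lia.
have uv : (wsum (val X) + (n - #|val X|) * n ^ 2 <= wsum (val Y) + (n - #|val Y|) * n ^ 2)%N.
  move: cXY; rewrite leq_eqVlt => /predU1P [E|lt].
    by rewrite E leq_add2r wXY.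
  have -> : (n - #|val Y| = (n - #|val X|) + (#|val X| - #|val Y|).-1.+1)%N.
    by have := card_set_ord (val X); lia.
  apply: leq_trans (leq_add (wsum_le _) (leqnn _)) _.
  by rewrite addnC mulnDl mulSn; apply: leq_trans (leq_addl _ _); rewrite leq_add2l leq_addr.
move: uv; rewrite dE' dE; move: ((n - #|val X|) * n ^ 2)%N ((n - #|val Y|) * n ^ 2)%N => a b uv.
rewrite -!mulnn; nia.
Qed.
End Swap.

Section Spans.
Variables (K : numFieldType) (n : nat).
Implicit Types (x y : ex n) (P Q : ex n -> Prop) (f h : GL K n -> K).

Definition mono x : GL K n -> K := fun g => \prod_X minor (val g) (val X) ^+ x X.

Lemma mono_add x y g : mono (addx x y) g = mono x g * mono y g.
Proof. by rewrite /mono -big_split; apply: eq_bigr => X _; rewrite (e1E, addxE) exprD. Qed.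

Lemma mono_e1 X g : mono (e1 X) g = minor (val g) (val X).
Proof.
rewrite /mono (bigD1 X) //= big1 => [|Y YX]; first by rewrite (e1E, addxE) eqxx mulr1.
by rewrite (e1E, addxE) (negPf YX).
Qed.

Definition in_span P f := exists2 L : seq (K * ex n),
  (forall t, t \in L -> P t.2) & forall g, f g = \sum_(t <- L) t.1 * mono t.2 g.

Lemma in_span_mono P x : P x -> in_span P (mono x).
Proof.
move=> Px; exists [:: (1, x)] => [t|g]; first by rewrite inE => /eqP ->.
by rewrite big_seq1 mul1r.
Qed.

Lemma in_span0 P : in_span P (fun=> 0).
Proof. by exists [::] => // g; rewrite big_nil. Qed.

Lemma in_spanD P f h : in_span P f -> in_span P h -> in_span P (fun g => f g + h g).
Proof.
move=> [L LP LE] [M MP ME]; exists (L ++ M) => [t|g]; last by rewrite big_cat LE ME.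
by rewrite mem_cat => /orP [/LP|/MP].
Qed.

Lemma in_spanZ P c f : in_span P f -> in_span P (fun g => c * f g).
Proof.
move=> [L LP LE]; exists [seq (c * t.1, t.2) | t <- L] => [_ /mapP [t /LP tP ->]//|g].
by rewrite big_map LE mulr_sumr; apply: eq_bigr => t _; rewrite mulrA.
Qed.

Lemma in_span_sum P (I : eqType) (r : seq I) (F : I -> GL K n -> K) :
  (forall i, i \in r -> in_span P (F i)) -> in_span P (fun g => \sum_(i <- r) F i g).
Proof.
elim: r => [|i r IH] H.
  by have := in_span0 P; congr in_span; apply: funext => g; rewrite big_nil.
have -> : (fun g => \sum_(j <- i :: r) F j g) = (fun g => F i g + \sum_(j <- r) F j g).
  by apply: funext => g; rewrite big_cons.
apply: in_spanD; first by apply: H; rewrite inE eqxx.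
by apply: IH => j jr; apply: H; rewrite inE jr orbT.
Qed.

Lemma in_span_trans P Q f : (forall x, P x -> in_span Q (mono x)) ->
  in_span P f -> in_span Q f.
Proof.
move=> PQ [L LP LE]; have -> : f = (fun g => \sum_(t <- L) t.1 * mono t.2 g).
  exact: funext.
by apply: in_span_sum => t tL; apply/in_spanZ/PQ/LP.
Qed.

Lemma in_spanW P Q f : (forall x, P x -> Q x) -> in_span P f -> in_span Q f.
Proof. by move=> PQ; apply: in_span_trans => x /PQ; apply: in_span_mono. Qed.

(** Replacing two incomparable columns raises the energy, which is bounded for
    a fixed number of columns. *)
Lemma mono_straighten x :
  in_span (fun y => standard y /\ forall p, deg y p = deg x p) (mono x).
Proof.
pose B := ((n ^ 2 + n * n ^ 2) ^ 2)%N.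
have [k] := ubnP (total x * B - energy x)%N.
elim: k x => [//|k IH] x xk.
have key X Y q : (0 < x X)%N -> (0 < x Y)%N -> X != Y -> (#|val Y| <= #|val X|)%N ->
    (#|val X| = #|val Y| -> wsum (val X) <= wsum (val Y))%N ->
    (#|val X :&: seg n q| < #|val Y :&: seg n q|)%N ->
    in_span (fun y => standard y /\ forall p, deg y p = deg x p) (mono x).
  move=> xX xY XY cXY wXY XYq.
  have [L LP LE] := minor_straighten K cXY XYq.
  have [y1 y1E] := exB xX.
  have y1Y : (0 < y1 Y)%N.
    by move: xY; rewrite y1E addxE e1E eq_sym (negPf XY) addn0.
  have [y yE] := exB y1Y; rewrite {}y1E {}yE in IH xk *.
  have -> : mono (addx (addx y (e1 Y)) (e1 X)) = (fun g =>
     \sum_(t <- L) t.1 * (minor (val g) t.2.1 * minor (val g) t.2.2 * mono y g)).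
    apply: funext => g; rewrite !mono_add !mono_e1 mulrC [mono y g * _]mulrC mulrA.
    rewrite LE mulr_suml; by apply: eq_bigr => t _; rewrite -!mulrA.
  apply: in_span_sum => t /LP [tX tY wt wtt]; apply: in_spanZ.
  have pX : (t.2.1 != finset.set0) && (t.2.1 != finset.setT).
    by rewrite proper_cardE tX -proper_cardE (valP X).
  have pY : (t.2.2 != finset.set0) && (t.2.2 != finset.setT).
    by rewrite proper_cardE tY -proper_cardE (valP Y).
  have [X' X'E] : exists X' : proper_sets n, val X' = t.2.1 by exists (exist _ t.2.1 pX).
  have [Y' Y'E] : exists Y' : proper_sets n, val Y' = t.2.2 by exists (exist _ t.2.2 pY).
  pose x' := addx (addx y (e1 Y')) (e1 X').
  have -> : (fun g => minor (val g) t.2.1 * minor (val g) t.2.2 * mono y g) = mono x'.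
    by apply: funext => g; rewrite !mono_add !mono_e1 X'E Y'E mulrC (mulrC (minor _ t.2.1)) mulrA.
  have [dx' tx' lt] := swap_columns y (etrans (congr1 (fun S : {set 'I_n} => #|S|) X'E) tX)
    (etrans (congr1 (fun S : {set 'I_n} => #|S|) Y'E) tY) cXY wXY
    ltac:(by rewrite X'E) ltac:(by rewrite X'E Y'E).
  have := IH x'; rewrite tx'; have := energy_le x'; rewrite tx' -/B => le; move: xk lt le.
  move: (energy _) (energy _) (_ * B)%N => u v w xk lt le /(_ ltac:(lia)).
  by apply: in_spanW => z [sz dz]; split=> // p; rewrite dz dx'.
case: (boolP (standard x)) => [sx|]; first by apply: in_span_mono.
(* X and Y are incomparable, so the exchange is possible in both directions; the
   lighter of the two has to lose elements *)
move=> /forallPn [X /forallPn [Y]]; rewrite negb_imply negb_or.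
move=> /andP [/andP [xX xY] /andP [/forallPn [q nXY] /forallPn [r nYX]]].
rewrite -!ltnNge in nXY nYX.
have XY : X != Y by apply/eqP => E; move: nXY; rewrite E ltnn.
case: (ltngtP #|val X| #|val Y|) => [lt|gt|eq].
- by apply: (key Y X r); rewrite 1?eq_sym ?(ltnW lt) // => E; move: lt; rewrite E ltnn.
- by apply: (key X Y q); rewrite ?(ltnW gt) // => E; move: gt; rewrite E ltnn.
case: (leqP (wsum (val X)) (wsum (val Y))) => w.
  by apply: (key X Y q); rewrite ?eq.
by apply: (key Y X r); rewrite 1?eq_sym ?eq // ltnW.
Qed.
End Spans.

(** * Standard monomials are determined by their row sums *)

Section StandardInj.
Variable n : nat.
Implicit Types (x y : ex n) (X Y : proper_sets n).

Lemma card_segS (S : {set 'I_n}) (z : 'I_n) :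
  #|S :&: seg n z.+1| = ((z \in S) + #|S :&: seg n z|)%N.
Proof.
have -> : (S :&: seg n z.+1 = (S :&: [set z]) :|: (S :&: seg n z))%SET.
  by apply/setP => t; rewrite !inE ltnS leq_eqVlt val_eqE; case: (t \in S).
have E0 : (S :&: [set z] :&: (S :&: seg n z) = finset.set0)%SET.
  by apply/setP => t; rewrite !inE; case: eqP => [->|_]; rewrite ?ltnn ?andbF.
rewrite cardsU E0 cards0 subn0; congr addn; case: (boolP (z \in S)) => zS.
  by rewrite (finset.setIidPr _) ?cards1 // finset.sub1set.
by apply/eqP; rewrite cards_eq0 finset.setI_eq0 disjoint_sym disjoints1.
Qed.

Lemma profile_inj X Y :
  (forall q, (q <= n)%N -> #|val X :&: seg n q| = #|val Y :&: seg n q|) -> X = Y.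
Proof.
move=> H; apply: val_inj; apply/setP => z.
have := H z.+1 (ltn_ord z); rewrite !card_segS (H z (ltnW (ltn_ord z))).
by move/addIn; case: (z \in _) (z \in _) => [] [].
Qed.

Lemma aboveP X Y : reflect (forall q, (q <= n)%N ->
   #|val Y :&: seg n q| <= #|val X :&: seg n q|)%N (above X Y).
Proof.
apply: (iffP forallP) => [H q qn|H q]; last exact: H (ltn_ord q).
by have := H (inord q); rewrite inordK.
Qed.

(** In a standard monomial the columns form a chain; this is the number of
    entries below q in the k-th column of the chain, read off from the row sums. *)
Definition nth_profile (r : nat -> nat -> nat) k q : nat := \sum_(p < n) (k < r p.+1 q)%N.

Definition col_count (r : nat -> nat -> nat) X : nat :=
  \sum_(k < r 1 n) [forall q : 'I_n.+1, #|val X :&: seg n q| == nth_profile r k q].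

Lemma rsum1 x : rsum x 1 n = total x.
Proof.
apply: eq_bigl => X; have -> : (val X :&: seg n n = val X)%SET.
  by apply/setP => z; rewrite !inE ltn_ord andbT.
by have := valP X; rewrite proper_cardE => /andP [->].
Qed.

Lemma sum_ltn_lead m N : (m <= N)%N -> (\sum_(p < N) (p < m) = m)%N.
Proof.
move=> mN; rewrite -[RHS](card_seg mN) -sum1_card [RHS]big_mkcond.
by apply: eq_bigr => p _; rewrite inE; case: ltnP.
Qed.

(** Let a be the number of columns strictly above X. In the chain, the copies of
    X are the columns a, ..., a + x X - 1, and each has the profile of X. *)
Lemma standard_le_count x X : standard x -> (x X <= col_count (rsum x) X)%N.
Proof.
move=> sx; case: (posnP (x X)) => [->//|xX].
pose a := (\sum_(Z | above Z X && (Z != X)) x Z)%N.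
have aX : (\sum_(Z | above Z X) x Z = a + x X)%N.
  by rewrite (bigD1 X) /= 1?addnC //; apply/aboveP.
have aT : (a + x X <= total x)%N.
  by rewrite -aX /total [leqRHS](bigID (fun Z => above Z X)) leq_addr.
rewrite /col_count rsum1.
rewrite -(big_mkord xpredT (fun k => [forall q : 'I_n.+1, #|val X :&: seg n q| == nth_profile (rsum x) k q] : nat)).
rewrite (@big_cat_nat _ _ _ a) ?(leq_trans (leq_addr _ _) aT) //=.
rewrite (@big_cat_nat _ _ _ (a + x X)%N a) ?leq_addr //=.
apply: leq_trans (leq_addl _ _); apply: leq_trans (leq_addr _ _).
rewrite -[leqLHS](addKn a) -[leqLHS]muln1 -sum_nat_const_nat big_nat [leqRHS]big_nat.
apply: leq_sum => k /andP [ak ka].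
rewrite lt0b; apply/forallP => q; rewrite /nth_profile.
rewrite -[X in X == _](@sum_ltn_lead #|val X :&: seg n q| n); last exact: card_set_ord.
apply/eqP; apply: eq_bigr => p _; congr nat_of_bool.
apply/idP/idP => [pX|]; last first.
  apply: contraTT; rewrite -!leqNgt => Xp; apply: leq_trans ak.
  rewrite /rsum /a [leqLHS]big_mkcond [leqRHS]big_mkcond; apply: leq_sum => Z _.
  case: ifP => // pZ; case: (posnP (x Z)) => [->//|xZ].
  have /forallP/(_ Z)/forallP/(_ X) := sx; rewrite xZ xX /=.
  case: ifP => // /negbT; rewrite negb_and => H /orP [ZX|/aboveP XZ].
    by move: H; rewrite ZX /= negbK => /eqP E; move: Xp; rewrite -E leqNgt pZ.
  by have := XZ q (ltn_ord q); rewrite leqNgt (leq_trans _ pZ) // ltnS.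
apply: leq_trans ka _; rewrite -aX /rsum big_mkcond [leqRHS]big_mkcond.
apply: leq_sum => Z _; case: ifP => // /aboveP ZX; rewrite ifT //.
exact: leq_trans pX (ZX q (ltn_ord q)).
Qed.

Lemma sum_col_count r : (\sum_X col_count r X <= r 1 n)%N.
Proof.
rewrite exchange_big /= -[leqRHS]card_ord -sum1_card; apply: leq_sum => k _.
case: (pickP (fun X => [forall q : 'I_n.+1, #|val X :&: seg n q| == nth_profile r k q])) => [X /forallP HX|H].
  rewrite (bigD1 X) //= big1 ?addn0 ?leq_b1 // => Y YX.
  apply/eqP; rewrite eqb0; apply: contra YX => /forallP HY; apply/eqP/profile_inj => q qn.
  by have := HX (inord q); have := HY (inord q); rewrite !inordK // => /eqP -> /eqP ->.
by rewrite big1 // => X _; rewrite H.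
Qed.

(** The inequality for each X becomes an equality, because the sums over X are
    equal. *)
Lemma standard_count x X : standard x -> x X = col_count (rsum x) X.
Proof.
move=> sx.
have /leqif_sum H : forall Y, true -> (x Y <= col_count (rsum x) Y ?= iff (x Y == col_count (rsum x) Y))%N.
  by move=> Y _; split; rewrite ?standard_le_count.
have := sum_col_count (rsum x); rewrite rsum1 => le.
have : (total x == \sum_Y col_count (rsum x) Y)%N.
  by rewrite eqn_leq le andbT; apply: leq_sum => Y _; apply: standard_le_count.
by rewrite /total H => /forall_inP /(_ X isT) /eqP.
Qed.

Lemma standard_inj x y : standard x -> standard y ->
  (forall p q, (1 <= p)%N -> (p <= q)%N -> (q <= n)%N -> rsum x p q = rsum y p q) -> x = y.
Proof.
move=> sx sy H.
have Hpq p q : (1 <= p)%N -> (q <= n)%N -> rsum x p q = rsum y p q.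
  move=> p1 qn; case: (leqP p q) => [pq|qp]; first exact: H.
  rewrite /rsum !big_pred0 // => X; apply/negbTE; rewrite -ltnNge;
    apply: leq_ltn_trans qp; rewrite -[leqRHS](card_seg qn); exact/subset_leq_card/finset.subsetIr.
case: (posnP n) => [n0|n0].
  by apply/ffunP => X; have := valP X; rewrite proper_cardE; have := card_set_ord (val X); lia.
apply/ffunP => X; rewrite (standard_count X sx) (standard_count X sy) /col_count.
rewrite Hpq //; apply: eq_bigr => k _; congr nat_of_bool; apply: eq_forallb => q.
congr (_ == _); apply: eq_bigr => p _; rewrite Hpq //.
exact: ltn_ord q.
Qed.
End StandardInj.

(** * The action of gl_n on polynomial functions *)

(** Locked, because comparing distinct derivatives up to unfolding is expensive. *)
HB.lock Definition lie (K : numFieldType) (n : nat) (i j : 'I_n) (f : GL K n -> K) : GL K n -> K :=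
  gl_act i j f.

Lemma lieE (K : numFieldType) (n : nat) (i j : 'I_n) (f : GL K n -> K) : gl_act i j f = lie i j f.
Proof. by rewrite unlock. Qed.

Section GlAct.
Variables (K : numFieldType) (n : nat).
Implicit Types (f h : GL K n -> K) (g : GL K n) (i j : 'I_n).

Lemma is_derive_horner (q : {poly K}) (x : K^o) :
  is_derive x (1 : K^o) (fun t : K^o => q.[t] : K^o) q^`().[x].
Proof.
elim/poly_ind: q => [|p c IH].
  by rewrite deriv0 horner0; under eq_fun do rewrite horner0; apply: is_derive_cst.
under eq_fun do rewrite hornerMXaddC.
rewrite derivMXaddC hornerD hornerMX.
have -> : p.[x] + p^`().[x] * x = (p.[x] *: (1 : K^o) + x *: p^`().[x]) + 0 :> K.
  by rewrite addr0 [p.[x] *: _]mulr1 [x *: _]mulrC.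
exact: is_deriveD.
Qed.

(** E_ij^2 is E_ij or 0, so the inverse is 1 + s E_ij for an explicit s. *)
Lemma elem_unitmx i j (t : K) : 1 + t *+ (i == j) != 0 ->
  (1%:M + t *: delta_mx i j : 'M[K]_n) \in unitmx.
Proof.
move=> u; set E : 'M[K]_n := delta_mx i j.
have EE : E *m E = (i == j)%:R *: E.
  by rewrite /E mul_delta_mx_cond eq_sym -scaler_nat.
pose s := - t / (1 + t *+ (i == j)).
suff /mulmx1_unit [-> _] : (1%:M + t *: E) *m (1%:M + s *: E) = 1%:M by [].
rewrite mulmxDl mul1mx mulmxDr mulmx1 -scalemxAl -scalemxAr EE !scalerA -addrA.
rewrite -!scalerDl -[RHS]addr0; congr (_ + _).
suff -> : s + (t + t * s * (i == j)%:R) = 0 by rewrite scale0r.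
rewrite /s -mulr_natr in u *; field; rewrite mulr_natr //.
Qed.

Definition moved g i j (t : K) : GL K n :=
  insubd g (val g *m (1%:M + t *: delta_mx i j)).

Lemma val_moved g i j t : (1%:M + t *: delta_mx i j : 'M[K]_n) \in unitmx ->
  val (moved g i j t) = val g *m (1%:M + t *: delta_mx i j).
Proof. by move=> u; rewrite /moved val_insubd unitmx_mul (valP g) u. Qed.

(** The derivative along the curve only concerns t near 0, so the condition is
    restricted to those t for which the curve stays in the group. *)
Definition poly_curve f g i j (q : {poly K}) :=
  forall t, (1%:M + t *: delta_mx i j : 'M[K]_n) \in unitmx ->
    f (moved g i j t) = q.[t].

Lemma lie_coef f g i j q : poly_curve f g i j q -> lie i j f g = q`_1.
Proof.
move=> fq; have -> : q`_1 = q^`().[0] by rewrite horner_coef0 coef_deriv.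
rewrite unlock /gl_act derive1E.
have := is_derive_horner q (0 : K^o).
move=> /(@near_eq_is_derive K K^o K^o _ (fun t => f (moved g i j t) : K^o)) H.
have {}H := H _; apply: (@derive_val _ _ _ _ _ _ _ (H _)).
near=> t; rewrite fq //; apply: elem_unitmx.
apply/eqP => /eqP; rewrite addrC addr_eq0 => /eqP t1.
have : `|t *+ (i == j)| < 1.
  apply: le_lt_trans (_ : `|t| < 1).
    by case: (i == j); rewrite ?mulr1n ?mulr0n ?normr0.
  by near: t; apply: (@nbhs0_lt K K^o).
by rewrite t1 normrN1 ltxx.
Unshelve. all: by end_near. Qed.

(** On these functions the action is the linear coefficient of a polynomial in t,
    which turns the Leibniz rule and commutators into algebra. *)
Inductive polyfun : (GL K n -> K) -> Prop :=
| polyfun_const c : polyfun (fun=> c)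
| polyfun_entry r c : polyfun (fun g => val g r c)
| polyfunD f h : polyfun f -> polyfun h -> polyfun (fun g => f g + h g)
| polyfunM f h : polyfun f -> polyfun h -> polyfun (fun g => f g * h g).

Lemma const_curve c g i j : poly_curve (fun=> c) g i j c%:P.
Proof. by move=> t _; rewrite hornerC. Qed.

Lemma entry_curve r c g i j :
  poly_curve (fun g => val g r c) g i j ((val g r c)%:P + (val g r i *+ (j == c)) *: 'X).
Proof.
move=> t u; rewrite val_moved // mulmxDr mulmx1 -scalemxAr !mxE !hornerE; congr (_ + _).
rewrite (bigD1 i) //= big1 => [|k ki]; rewrite !mxE ?eqxx ?(negPf ki) /= ?mulr0 //.
by rewrite addr0 eq_sym mulr_natr mulrC.
Qed.

Lemma curveD f h g i j p q : poly_curve f g i j p -> poly_curve h g i j q ->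
  poly_curve (fun g => f g + h g) g i j (p + q).
Proof. by move=> fp hq t u; rewrite hornerD fp ?hq. Qed.

Lemma curveM f h g i j p q : poly_curve f g i j p -> poly_curve h g i j q ->
  poly_curve (fun g => f g * h g) g i j (p * q).
Proof. by move=> fp hq t u; rewrite hornerM fp ?hq. Qed.

Lemma polyfun_curve f g i j : polyfun f -> exists q, poly_curve f g i j q.
Proof.
elim=> {f} [c|r c|f h _ [p fp] _ [q hq]|f h _ [p fp] _ [q hq]].
- by eexists; apply: const_curve.
- by eexists; apply: entry_curve.
- by eexists; apply: curveD fp hq.
- by eexists; apply: curveM fp hq.
Qed.

Lemma moved0 g i j : moved g i j 0 = g.
Proof. by apply: val_inj; rewrite val_moved ?scale0r ?addr0 ?unitmx1 ?mulmx1. Qed.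

Lemma curve0 f g i j q : poly_curve f g i j q -> q`_0 = f g.
Proof.
by move=> /(_ 0); rewrite scale0r addr0 unitmx1 moved0 horner_coef0 => ->.
Qed.

Lemma lie_const c i j : lie i j (fun=> c) = (fun=> 0) :> (GL K n -> K).
Proof.
by apply: funext => g; rewrite (lie_coef (@const_curve c g i j)) coefC.
Qed.

Lemma lie_entry r c i j :
  lie i j (fun g => val g r c) = (fun g => val g r i *+ (j == c)).
Proof.
apply: funext => g; rewrite (lie_coef (@entry_curve r c g i j)).
by rewrite coefD coefC coefZ coefX mulr1 add0r.
Qed.

Lemma lieD f h i j : polyfun f -> polyfun h ->
  lie i j (fun g => f g + h g) = (fun g => lie i j f g + lie i j h g).
Proof.
move=> pf ph; apply: funext => g.
have [p fp] := polyfun_curve g i j pf; have [q hq] := polyfun_curve g i j ph.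
by rewrite (lie_coef (curveD fp hq)) coefD (lie_coef fp) (lie_coef hq).
Qed.

Lemma lieM f h i j : polyfun f -> polyfun h ->
  lie i j (fun g => f g * h g) =
  (fun g => lie i j f g * h g + f g * lie i j h g).
Proof.
move=> pf ph; apply: funext => g.
have [p fp] := polyfun_curve g i j pf; have [q hq] := polyfun_curve g i j ph.
rewrite (lie_coef (curveM fp hq)) (lie_coef fp) (lie_coef hq).
rewrite coefM big_ord_recl big_ord1 /= subn0 subnn (curve0 fp) (curve0 hq).
by rewrite addrC.
Qed.

Lemma lieZ f c i j : polyfun f ->
  lie i j (fun g => c * f g) = (fun g => c * lie i j f g).
Proof.
move=> pf; rewrite lieM //; last exact: polyfun_const.
by apply: funext => g; rewrite lie_const mul0r add0r.
Qed.

Lemma polyfunZ f c : polyfun f -> polyfun (fun g => c * f g).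
Proof. by apply: polyfunM; apply: polyfun_const. Qed.

Lemma polyfun_sum (I : Type) (r : seq I) (P : pred I) (F : I -> GL K n -> K) :
  (forall k, P k -> polyfun (F k)) -> polyfun (fun g => \sum_(k <- r | P k) F k g).
Proof.
move=> PF; elim: r => [|k r IH].
  under eq_fun do rewrite big_nil.
  apply: polyfun_const.
under eq_fun do rewrite big_cons.
  case: (boolP (P k)) => Pk /=; last exact: IH.
by apply: polyfunD => //; apply: PF.
Qed.

Lemma polyfun_prod (I : Type) (r : seq I) (P : pred I) (F : I -> GL K n -> K) :
  (forall k, P k -> polyfun (F k)) -> polyfun (fun g => \prod_(k <- r | P k) F k g).
Proof.
move=> PF; elim: r => [|k r IH].
  under eq_fun do rewrite big_nil.
  apply: polyfun_const.
under eq_fun do rewrite big_cons.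
  case: (boolP (P k)) => Pk /=; last exact: IH.
by apply: polyfunM => //; apply: PF.
Qed.

Lemma polyfunX f k : polyfun f -> polyfun (fun g => f g ^+ k).
Proof.
move=> pf; elim: k => [|k IH]; first exact: polyfun_const.
under eq_fun do rewrite exprS.
by apply: polyfunM.
Qed.

Lemma polyfun_minor X : polyfun (fun g => minor (val g) X).
Proof.
apply: polyfun_sum => s _; apply: polyfunZ; apply: polyfun_prod => r _.
by under eq_fun do rewrite !mxE; apply: polyfun_entry.
Qed.

Lemma lie_sum (I : Type) (r : seq I) (F : I -> GL K n -> K) i j :
  (forall k, polyfun (F k)) ->
  lie i j (fun g => \sum_(k <- r) F k g) = (fun g => \sum_(k <- r) lie i j (F k) g).
Proof.
move=> PF; elim: r => [|k r IH].
  under eq_fun do rewrite big_nil.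
  rewrite lie_const.
  by apply: funext => g; rewrite big_nil.
under eq_fun do rewrite big_cons.
  rewrite lieD //; last exact: polyfun_sum.
by apply: funext => g; rewrite big_cons IH.
Qed.

Lemma polyfun_lie f i j : polyfun f -> polyfun (lie i j f).
Proof.
elim=> {f} [c|r c|f h pf IHf ph IHh|f h pf IHf ph IHh].
- by rewrite lie_const; apply: polyfun_const.
- rewrite lie_entry; case: (j == c); last exact: polyfun_const.
  exact: polyfun_entry.
- by rewrite lieD //; apply: polyfunD.
- by rewrite lieM //; apply: polyfunD; apply: polyfunM.
Qed.

Lemma lie_comm f i j k l : polyfun f -> forall g,
  lie i j (lie k l f) g = lie k l (lie i j f) g
    + lie i l f g *+ (j == k) - lie k j f g *+ (l == i).
Proof.
elim=> {f} [c|r c|f h pf IHf ph IHh|f h pf IHf ph IHh] g.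
- by rewrite !lie_const !mul0rn subr0 addr0.
- have E a b c' d : lie a b (fun g => val g r c' *+ d) =
      (fun g : GL K n => val g r a *+ (b == c') *+ d) :> (GL K n -> K).
    have -> : (fun g : GL K n => val g r c' *+ d) = (fun g => d%:R * val g r c').
      by apply: funext => u; rewrite mulr_natl.
    rewrite lieZ; last exact: polyfun_entry.
    by rewrite lie_entry; apply: funext => u; rewrite mulr_natl.
  rewrite !lie_entry !E.
  by rewrite [LHS]mulrnAC addrAC [X in X - _]mulrnAC subrr add0r.
- have A a b c d : lie a b (lie c d (fun g => f g + h g)) g =
      lie a b (lie c d f) g + lie a b (lie c d h) g.
    by rewrite lieD // lieD //; apply: polyfun_lie.
  rewrite !A IHf IHh (lieD i l pf ph) (lieD k j pf ph).
  by case: (j == k); case: (l == i); rewrite ?mulr1n ?mulr0n; ring.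
- have pa a b f' : polyfun f' -> polyfun (lie a b f') by apply: polyfun_lie.
  have A a b c d : lie a b (lie c d (fun g => f g * h g)) g =
      lie a b (lie c d f) g * h g + lie c d f g * lie a b h g +
      (lie a b f g * lie c d h g + f g * lie a b (lie c d h) g).
    rewrite lieM // lieD; last first.
    + by apply: polyfunM => //; apply: pa.
    + by apply: polyfunM => //; apply: pa.
    by rewrite !lieM //; apply: pa.
  rewrite !A IHf IHh (lieM i l pf ph) (lieM k j pf ph).
  by case: (j == k); case: (l == i); rewrite ?mulr1n ?mulr0n; ring.
Qed.
End GlAct.

(** * Exponents of given multidegree *)

Section Multidegree.
Variable n : nat.
Implicit Types (x y : ex n) (X Y : proper_sets n) (k : nat -> nat).

(** The degree p = 0 is left out, as no column set is empty. *)
Definition multideg k x : bool := [forall p : 'I_n, (0 < p)%N ==> (deg x p == k p)].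

Lemma multidegP k x : reflect (forall p, (0 < p < n)%N -> deg x p = k p) (multideg k x).
Proof.
apply: (iffP forallP) => [H p /andP [p0 pn]|H p].
  by have /implyP/(_ p0)/eqP := H (Ordinal pn).
by apply/implyP => p0; rewrite H // p0 /=.
Qed.

Lemma card_proper X : (0 < #|val X| < n)%N.
Proof. by rewrite -proper_cardE; exact: (valP X). Qed.

Lemma deg_ge x X : (x X <= deg x #|val X|)%N.
Proof. by rewrite /deg (bigD1 X) //= leq_addr. Qed.

(** A common bound for the exponents, which makes those of given multidegree a
    finite list. *)
Definition kbound k := (\sum_(p < n) k p)%N.

Lemma multideg_le k x X : multideg k x -> (x X <= kbound k)%N.
Proof.
move=> /multidegP H; apply: leq_trans (deg_ge x X) _; rewrite H ?card_proper //.
have /andP [_ Xn] := card_proper X.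
by rewrite /kbound (bigD1 (Ordinal Xn)) //= leq_addr.
Qed.

Definition ex_of_box N (f : {ffun proper_sets n -> 'I_N.+1}) : ex n := [ffun X => f X : nat].

Definition exps k : seq (ex n) :=
  [seq x <- [seq ex_of_box f | f <- enum {ffun proper_sets n -> 'I_(kbound k).+1}] | multideg k x].

Lemma mem_exps k x : (x \in exps k) = multideg k x.
Proof.
rewrite mem_filter; case: (boolP (multideg k x)) => //= kx.
apply/mapP; exists [ffun X => inord (x X)]; first by rewrite mem_enum.
by apply/ffunP => X; rewrite !ffunE inordK // ltnS multideg_le.
Qed.

Lemma uniq_exps k : uniq (exps k).
Proof.
apply: filter_uniq; rewrite map_inj_uniq ?enum_uniq // => f g /ffunP fg.
by apply/ffunP => X; apply: val_inj; have := fg X; rewrite !ffunE.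
Qed.

(** The reindexing behind Euler's identity in [multinomial]. *)
Lemma exps_succ k k' p X : #|val X| = p -> (0 < p)%N -> k p = (k' p).+1 ->
  (forall q, q != p -> k q = k' q) ->
  perm_eq [seq x : ex n <- exps k | 0 < x X]%N [seq addx x (e1 X) | x <- exps k'].
Proof.
move=> Xp p0 kp kq; apply: uniq_perm.
- exact/filter_uniq/uniq_exps.
- rewrite map_inj_uniq ?uniq_exps // => x y /ffunP xy; apply/ffunP => Z.
  by have := xy Z; rewrite !addxE => /addIn.
move=> x; rewrite mem_filter mem_exps; apply/andP/mapP => [[xX /multidegP kx]|[y]].
  have [y yE] := exB xX; exists y => //; rewrite mem_exps; apply/multidegP => q qn.
  have := kx q qn; rewrite yE deg_add deg_e1 Xp eq_sym.
  by case: eqP => [->|/eqP qp]; rewrite ?kp ?kq // ?addn0 // addn1 => -[].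
rewrite mem_exps => /multidegP ky ->; rewrite addxE e1E eqxx addn1; split=> //.
apply/multidegP => q qn; rewrite deg_add deg_e1 ky // Xp eq_sym.
by case: eqP => [->|/eqP qp]; rewrite ?kp ?kq // ?addn0 // addn1.
Qed.
End Multidegree.

Section Multinomial.
Variables (K : numFieldType) (n : nat).
Implicit Types (x y : ex n) (X Y : proper_sets n) (k : nat -> nat) (z : proper_sets n -> K).

Definition xfact x : K := \prod_X (x X)`!%:R.

Lemma xfact_neq0 x : xfact x != 0.
Proof. by apply/prodf_neq0 => X _; rewrite pnatr_eq0 -lt0n fact_gt0. Qed.

Definition divpow z x : K := \prod_X (z X ^+ x X / (x X)`!%:R).

Lemma divpow_succ z x X :
  (x X).+1%:R * divpow z (addx x (e1 X)) = z X * divpow z x.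
Proof.
rewrite /divpow (bigD1 X) //= [in RHS](bigD1 X) //= !mulrA.
rewrite addxE e1E eqxx addn1 factS natrM exprS; congr (_ * _); last first.
  by apply: eq_bigr => Y YX; rewrite addxE e1E (negPf YX) addn0.
have f0 : (x X)`!%:R != 0 :> K by rewrite pnatr_eq0 -lt0n fact_gt0.
have s0 : (x X).+1%:R != 0 :> K by rewrite pnatr_eq0.
by move: (_.+1%:R) (_`!%:R) s0 f0 (z X ^+ _) => a b a0 b0 c; field; rewrite a0 b0.
Qed.

(** Induction on the degree, after multiplication by k p for some k p > 0: this
    is Euler's identity for the variables of size p. *)
Lemma multinomial z k :
  \sum_(x <- exps n k) divpow z x =
  \prod_(1 <= p < n) ((\sum_(X : proper_sets n | #|val X| == p) z X) ^+ k p / (k p)`!%:R).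
Proof.
have [N] := ubnP (\sum_(1 <= p < n) k p)%N.
elim: N k => [//|N IH] k kN.
case: (pickP (fun p : 'I_n => (0 < p)%N && (0 < k p)%N)) => [p /andP [p0 kp]|H]; last first.
  have k0 p : (0 < p < n)%N -> k p = 0%N.
    by move=> /andP [p0 pn]; have := H (Ordinal pn); rewrite /= p0 /=; case: (k p).
  have -> : \sum_(x <- exps n k) divpow z x = \sum_(x <- [:: [ffun=> 0%N]]) divpow z x.
    apply: perm_big; apply: uniq_perm; rewrite ?uniq_exps // => x.
    rewrite mem_exps inE; apply/multidegP/eqP => [kx|->].
      apply/ffunP => X; rewrite ffunE; apply/eqP; rewrite -leqn0.
      by apply: leq_trans (deg_ge x X) _; rewrite kx ?card_proper // k0 ?card_proper.
    by move=> p pn; rewrite k0 // /deg big1 // => X _; rewrite ffunE.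
  rewrite big_seq1 /divpow big1 => [|X _]; last by rewrite ffunE expr0 fact0 divr1.
  rewrite big_nat big1 // => p pn; by rewrite k0 // expr0 fact0 divr1.
pose k' q := if q == p :> nat then (k p).-1 else k q.
have k'p : k p = (k' p).+1 by rewrite /k' eqxx prednK.
have kq (q : nat) : q != p :> nat -> k q = k' q by rewrite /k' => /negPf ->.
have pn := ltn_ord p.
have split (F : nat -> nat) : (\sum_(1 <= q < n) F q = F p + \sum_(1 <= q < n | q != p :> nat) F q)%N.
  by rewrite (bigD1_seq (p : nat)) ?iota_uniq //= mem_index_iota p0 pn.
have splitM (F : nat -> K) : \prod_(1 <= q < n) F q = F p * \prod_(1 <= q < n | q != p :> nat) F q.
  by rewrite (bigD1_seq (p : nat)) ?iota_uniq //= mem_index_iota p0 pn.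
(* k' lowers the degree in the variables of size p by one *)
have {}IH := IH k' _; rewrite splitM.
have k'N : (\sum_(1 <= q < n) k' q < N)%N.
  move: kN; rewrite !split k'p addSn ltnS; apply: leq_ltn_trans.
  by rewrite leq_add2l leq_eqVlt; apply/orP; left; apply/eqP; apply: eq_bigr => q qp; rewrite kq.
have kp0 : (k p)%:R != 0 :> K by rewrite pnatr_eq0 -lt0n.
apply: (mulfI kp0); transitivity ((\sum_(X : proper_sets n | #|val X| == p) z X) *
    \sum_(x <- exps n k') divpow z x).
  rewrite mulr_sumr mulr_suml.
  transitivity (\sum_(x <- exps n k) \sum_(X : proper_sets n | #|val X| == p) (x X)%:R * divpow z x).
    rewrite big_seq [RHS]big_seq; apply: eq_bigr => x; rewrite mem_exps => /multidegP kx.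
    by rewrite -mulr_suml -natr_sum -kx ?p0.
  rewrite exchange_big; apply: eq_bigr => X /eqP Xp /=.
  rewrite (bigID (fun x : ex n => 0 < x X)%N) /= [X in _ + X]big1 ?addr0; last first.
    by move=> x; rewrite -eqn0Ngt => /eqP ->; rewrite mul0r.
  rewrite -big_filter (perm_big _ (exps_succ Xp p0 k'p kq)) /= big_map mulr_sumr.
  by apply: eq_bigr => x _; rewrite -divpow_succ addxE e1E eqxx addn1.
rewrite (IH k'N) splitM mulrA [RHS]mulrA; congr (_ * _); last first.
  by apply: eq_bigr => q qp; rewrite kq.
rewrite k'p factS natrM exprS.
have f0 : (k' p)`!%:R != 0 :> K by rewrite pnatr_eq0 -lt0n fact_gt0.
rewrite k'p in kp0.
by move: (_.+1%:R) (_`!%:R) kp0 f0 (\sum_(_ | _) _) (_ ^+ k' p) => a b a0 b0 c d; field; rewrite a0 b0.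
Qed.
End Multinomial.

(** * The kernel of V and its hermitian form *)

Section Kernel.
Variables (C : numClosedFieldType) (n : nat) (m : nat -> int).
Hypothesis m_noninc : forall p, (1 <= p < n)%N -> m p.+1 <= m p.
Implicit Types (a b g : GL C n) (f h : GL C n -> C) (x y : ex n).

Definition gap p : nat := `|m p - m p.+1|%N.

Lemma gapE p : (0 < p < n)%N -> m p - m p.+1 = Posz (gap p).
Proof. by move=> pn; rewrite /gap gez0_abs // subr_ge0 m_noninc. Qed.

(** The reproducing kernel of V. *)
Definition kern a b : C := \sum_(x <- exps n gap) mono x a * mono x b / xfact C x.

Lemma kern_sym a b : kern a b = kern b a.
Proof. by apply: eq_bigr => x _; rewrite [mono x a * _]mulrC. Qed.

Definition hv (g : 'M[C]_n) : C :=
  \prod_(1 <= p < n) (minor g (seg n p) ^+ gap p / (gap p)`!%:R).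

Lemma highest_vectorE a : highest_vector m a = hv (val a).
Proof.
rewrite /highest_vector /hv big_nat [RHS]big_nat; apply: eq_bigr => p pn.
by rewrite gapE.
Qed.

(** Cauchy-Binet writes the p-th leading minor of a b^T as a sum of D_X(a) D_X(b)
    over |X| = p; the multinomial formula expands its powers. *)
Lemma kernE a b : kern a b = hv (val a *m (val b)^T).
Proof.
transitivity (\sum_(x <- exps n gap) divpow (fun X => minor (val a) (val X) * minor (val b) (val X)) x).
  apply: eq_bigr => x _; rewrite /divpow /xfact /mono -prodfV -!big_split /=.
  by apply: eq_bigr => X _; rewrite exprMn.
rewrite multinomial /hv big_nat [RHS]big_nat; apply: eq_bigr => p /andP [p0 pn].
rewrite minor_mul_tr ?(ltnW pn) //; congr (_ ^+ _ / _).
rewrite [RHS](bigID (fun S : {set 'I_n} => (S != finset.set0) && (S != finset.setT))) /=.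
rewrite [X in _ = _ + X]big1 ?addr0; last first.
  by move=> S /andP [/eqP Sp]; rewrite proper_cardE Sp p0 pn.
rewrite [RHS](reindex_omap (val : proper_sets n -> {set 'I_n}) insub) /=; last first.
  by move=> S /andP [_ Sp]; rewrite insubT.
by apply: eq_bigl => X; rewrite valK eqxx andbT (valP X) andbT.
Qed.

Lemma polyfun_mono x : polyfun (mono x : GL C n -> C).
Proof. by apply: polyfun_prod => X _; apply/polyfunX/polyfun_minor. Qed.

Lemma polyfun_kern b : polyfun (kern^~ b).
Proof.
apply: polyfun_sum => x _; have -> : (fun a => mono x a * mono x b / xfact C x) =
  (fun a => (mono x b / xfact C x) * mono x a) :> (GL C n -> C).
  by apply: funext => a; rewrite -mulrA mulrC.
exact/polyfunZ/polyfun_mono.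
Qed.

Definition trgl g : GL C n :=
  exist _ (val g)^T (eq_ind_r is_true (valP g) (unitmx_tr (val g))).

Definition cgl g : GL C n :=
  exist _ (map_mx Num.conj (val g)) (eq_ind_r is_true (valP g) (map_unitmx Num.conj (val g))).

Definition onegl : GL C n := exist _ 1%:M (unitmx1 C n).

Lemma cglK g : cgl (cgl g) = g.
Proof. by apply: val_inj; apply/matrixP => i j; rewrite /= !mxE conjCK. Qed.

Lemma kern_act a b g : kern (GLmul a g) b = kern a (GLmul b (trgl g)).
Proof. by rewrite !kernE /= trmx_mul trmxK mulmxA. Qed.

Lemma minor_conj (g : 'M[C]_n) X : minor (map_mx Num.conj g) X = (minor g X)^*.
Proof.
rewrite /minor -det_map_mx; congr (\det _); apply/matrixP => i j; rewrite !mxE //.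
Qed.

Lemma mono_conj x g : mono x (cgl g) = (mono x g)^*.
Proof.
rewrite /mono rmorph_prod; apply: eq_bigr => X _.
by rewrite minor_conj rmorphXn.
Qed.

Lemma xfact_conj x : (xfact C x)^* = xfact C x.
Proof. by rewrite rmorph_prod; apply: eq_bigr => X _; rewrite rmorph_nat. Qed.

Lemma kern_conj a b : kern (cgl a) (cgl b) = (kern a b)^*.
Proof.
rewrite rmorph_sum; apply: eq_bigr => x _.
by rewrite !mono_conj /= !rmorphM fmorphV /= xfact_conj.
Qed.

Definition conjf f : GL C n -> C := fun g => (f (cgl g))^*.

Lemma polyfun_conj f : polyfun f -> polyfun (conjf f).
Proof.
elim=> {f} [c|r c|f h _ IHf _ IHh|f h _ IHf _ IHh]; rewrite /conjf.
- exact: polyfun_const.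
- by under eq_fun do rewrite /= mxE conjCK; apply: polyfun_entry.
- by under eq_fun do rewrite rmorphD; apply: polyfunD.
- by under eq_fun do rewrite rmorphM; apply: polyfunM.
Qed.

Lemma lie_conj f i j : polyfun f -> lie i j (conjf f) = conjf (lie i j f).
Proof.
elim=> {f} [c|r c|f h pf IHf ph IHh|f h pf IHf ph IHh].
- by rewrite /conjf !lie_const; apply: funext => g; rewrite rmorph0.
- have -> : conjf (fun g : GL C n => val g r c) = (fun g => val g r c).
    by apply: funext => g; rewrite /conjf /= mxE conjCK.
  rewrite lie_entry; apply: funext => g; rewrite /conjf /= rmorphMn /=.
  by rewrite mxE conjCK.
- have -> : conjf (fun g => f g + h g) = (fun g => conjf f g + conjf h g).
    by apply: funext => g; rewrite /conjf rmorphD.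
  rewrite !lieD //; try exact: polyfun_conj.
  by rewrite IHf IHh; apply: funext => g; rewrite /conjf rmorphD.
- have -> : conjf (fun g => f g * h g) = (fun g => conjf f g * conjf h g).
    by apply: funext => g; rewrite /conjf rmorphM.
  rewrite !lieM //; try exact: polyfun_conj.
  by rewrite IHf IHh; apply: funext => g; rewrite /conjf rmorphD !rmorphM.
Qed.

(** The kernel depends on a b^T only, and a (1 + t E_ij) b^T =
    a (b (1 + t E_ji))^T. *)
Lemma lie_kern i j a b : lie i j (kern^~ b) a = lie j i (kern^~ a) b.
Proof.
have [q Hq] := polyfun_curve a i j (polyfun_kern b).
rewrite (lie_coef Hq); symmetry; apply: lie_coef => t u.
have u' : (1%:M + t *: delta_mx i j : 'M[C]_n) \in unitmx.
  by rewrite -unitmx_tr linearD linearZ /= trmx1 trmx_delta.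
rewrite -Hq // kern_sym !kernE !val_moved // trmx_mul linearD linearZ /= trmx1 trmx_delta.
by rewrite mulmxA.
Qed.

Implicit Types (L M : seq (C * GL C n)).
Definition fn L : GL C n -> C := fun g => \sum_(t <- L) t.1 * kern g t.2.

Definition in_V f := exists L, f = fn L.

Lemma polyfun_fn L : polyfun (fn L).
Proof. by apply: polyfun_sum => t _; apply/polyfunZ/polyfun_kern. Qed.

Lemma in_V_polyfun f : in_V f -> polyfun f.
Proof. by move=> [L ->]; apply: polyfun_fn. Qed.

Lemma in_V_lin c f h : in_V f -> in_V h -> in_V (fun g => c * f g + h g).
Proof.
move=> [L ->] [M ->]; exists ([seq (c * t.1, t.2) | t <- L] ++ M).
apply: funext => g; rewrite /fn big_cat big_map mulr_sumr; congr (_ + _).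
by apply: eq_bigr => t _; rewrite mulrA.
Qed.

Lemma in_V0 : in_V (fun=> 0).
Proof. by exists [::]; apply: funext => g; rewrite /fn big_nil. Qed.

(** The functions kern^~ b contain the highest vector (b = 1) and are permuted by
    right shifts. *)
Lemma rep_V_in_V f : rep_V m f -> in_V f.
Proof.
apply; first by split; [exact: in_V0 | exact: in_V_lin].
  move=> X _ [L ->]; exists [seq (t.1, GLmul t.2 (trgl X)) | t <- L].
  apply: funext => g; rewrite /shift_right /fn big_map; apply: eq_bigr => t _.
  by rewrite kern_act.
exists [:: (1, onegl)]; apply: funext => g.
by rewrite /fn big_seq1 mul1r kernE highest_vectorE /= trmx1 mulmx1.
Qed.

(** The coefficients of fn L in the monomials divided by x!. *)
Definition lfit L x : C := \sum_(t <- L) t.1 * mono x t.2.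

Lemma fn_mono L g : fn L g = \sum_(x <- exps n gap) lfit L x * mono x g / xfact C x.
Proof.
rewrite /fn /lfit; under eq_bigr => t _ do rewrite mulr_sumr.
rewrite exchange_big; apply: eq_bigr => x _ /=; rewrite !mulr_suml.
by apply: eq_bigr => t _; rewrite [mono x g * _]mulrC !mulrA.
Qed.

(** The inner product with fn L; it is well defined because it can also be
    computed from the other argument ([pair_withC]). *)
Definition pair_with f L : C := \sum_(t <- L) (t.1)^* * f (cgl t.2).

Lemma pair_withC L M : pair_with (fn L) M = (pair_with (fn M) L)^*.
Proof.
rewrite /pair_with rmorph_sum /fn /=.
under eq_bigr => t _ do rewrite mulr_sumr.
under [RHS]eq_bigr => t _ do rewrite rmorphM /= conjCK rmorph_sum /= mulr_sumr.
rewrite exchange_big; apply: eq_bigr => s _; apply: eq_bigr => t _.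
by rewrite rmorphM /= -kern_conj cglK kern_sym mulrCA.
Qed.

Lemma pair_with_fn L M : pair_with (fn L) M =
  \sum_(x <- exps n gap) lfit L x * (lfit M x)^* / xfact C x.
Proof.
rewrite /pair_with; under eq_bigr => t _ do rewrite fn_mono mulr_sumr.
rewrite exchange_big; apply: eq_bigr => x _ /=.
rewrite /lfit rmorph_sum /= mulr_sumr mulr_suml; apply: eq_bigr => t _.
by rewrite mono_conj rmorphM !mulrA [_^* * _]mulrC -!mulrA.
Qed.

Lemma xfact_gt0 x : 0 < xfact C x.
Proof. by apply: prodr_gt0 => X _; rewrite ltr0n fact_gt0. Qed.

(** The square of the norm is sum_x |lfit L x|^2 / x!. *)
Lemma pair_with_eq0 L : pair_with (fn L) L = 0 -> fn L = fun=> 0.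
Proof.
rewrite pair_with_fn => /eqP; rewrite psumr_eq0 => [/allP H|x _]; last first.
  by rewrite divr_ge0 ?mul_conjC_ge0 // ltW ?xfact_gt0.
apply: funext => g; rewrite fn_mono big_seq big1 // => x xk.
have := H x xk; rewrite /= mulf_eq0 invr_eq0 (negPf (xfact_neq0 _ _)) orbF.
by rewrite mul_conjC_eq0 => /eqP ->; rewrite !mul0r.
Qed.

Definition rep_of f : seq (C * GL C n) :=
  if pselect (in_V f) is left p then sval (cid p) else [::].

Lemma rep_ofK f : in_V f -> fn (rep_of f) = f.
Proof. by move=> Vf; rewrite /rep_of; case: pselect => // p; case: cid => L /= ->. Qed.

Definition hform f h : C := pair_with f (rep_of h).

Lemma hform_pair f L : in_V f -> hform f (fn L) = pair_with f L.
Proof.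
move=> [M ->]; have VL : in_V (fn L) by exists L.
by rewrite /hform pair_withC (rep_ofK VL) -pair_withC.
Qed.

Lemma hformC f h : in_V f -> in_V h -> hform f h = (hform h f)^*.
Proof.
by move=> Vf Vh; rewrite -{1}(rep_ofK Vf) -{2}(rep_ofK Vh) /hform pair_withC.
Qed.

Lemma hform_linl c f f' h :
  hform (fun g => c * f g + f' g) h = c * hform f h + hform f' h.
Proof.
rewrite /hform /pair_with mulr_sumr -big_split; apply: eq_bigr => t _ /=.
by rewrite mulrDr mulrCA.
Qed.

Lemma hform0l h : hform (fun=> 0) h = 0.
Proof. by rewrite /hform /pair_with big1 // => t _; rewrite mulr0. Qed.

Lemma hform_eq0 f : in_V f -> hform f f = 0 -> f = fun=> 0.
Proof.
by move=> Vf; have := @pair_with_eq0 (rep_of f); rewrite rep_ofK.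
Qed.

Lemma lie_fn i j L : lie i j (fn L) = (fun g => \sum_(t <- L) t.1 * lie i j (kern^~ t.2) g).
Proof.
rewrite /fn lie_sum => [|t]; last exact/polyfunZ/polyfun_kern.
by apply: funext => g; apply: eq_bigr => t _; rewrite lieZ //; apply: polyfun_kern.
Qed.

Lemma hform_lie i j f h : in_V f -> in_V h -> in_V (lie i j f) -> in_V (lie j i h) ->
  hform (lie i j f) h = hform f (lie j i h).
Proof.
move=> Vf Vh Vf' Vh'; rewrite (hformC Vf Vh') -{1}(rep_ofK Vf) -{2}(rep_ofK Vh) /hform.
rewrite /pair_with rmorph_sum /= !lie_fn.
under eq_bigr => t _ do rewrite mulr_sumr.
under [RHS]eq_bigr => t _ do rewrite rmorphM /= conjCK rmorph_sum /= mulr_sumr.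
rewrite exchange_big; apply: eq_bigr => s _; apply: eq_bigr => t _ /=.
rewrite rmorphM /= mulrCA; congr (_ * (_ * _)).
rewrite lie_kern -[RHS]/(conjf (lie j i (kern^~ t.2)) s.2) -lie_conj; last exact: polyfun_kern.
by congr (lie _ _ _ _); apply: funext => g; rewrite /conjf -kern_conj cglK.
Qed.
End Kernel.

(** * Highest weight modules *)

Section HighestWeight.
Variables (C : numClosedFieldType) (n : nat) (m : nat -> int).
Hypothesis m_noninc : forall p, (1 <= p < n)%N -> m p.+1 <= m p.
Implicit Types (f h w : GL C n -> C) (W T : (GL C n -> C) -> Prop) (q : nat).
Local Notation in_V := (@in_V C n m).
Local Notation hform := (@hform C n m).

Lemma hform_linr c f h h' : in_V f -> in_V h -> in_V h' ->
  hform f (fun g => c * h g + h' g) = c^* * hform f h + hform f h'.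
Proof.
move=> Vf Vh Vh'; rewrite hformC ?hform_linl; last exact: in_V_lin; last by [].
by rewrite rmorphD rmorphM /= -!hformC.
Qed.

Lemma hform0r f : in_V f -> hform f (fun=> 0) = 0.
Proof. by move=> Vf; rewrite hformC ?hform0l ?conjC0 //; apply: in_V0. Qed.

(** The candidate for the module generated by a highest weight vector w. *)
Inductive lowered q w : (GL C n -> C) -> Prop :=
| lowered_top : lowered q w w
| lowered0 : lowered q w (fun=> 0)
| lowered_lin c f h : lowered q w f -> lowered q w h -> lowered q w (fun g => c * f g + h g)
| lowered_lie (i j : 'I_n) f : (j <= i)%N -> (i < q)%N -> (j < q)%N -> lowered q w f ->
    lowered q w (lie i j f).

(** Move the raising operator to the right with the commutation relations, until
    it kills w. *)
Lemma lowered_raise q w (a b : 'I_n) f : polyfun w ->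
  (forall i j : 'I_n, (i < j)%N -> (j < q)%N -> forall g, lie i j w g = 0) ->
  (a < b)%N -> (b < q)%N -> lowered q w f -> lowered q w (lie a b f).
Proof.
move=> pw w0 + + lf; suff : polyfun f /\ forall a b : 'I_n, (a < b)%N -> (b < q)%N -> lowered q w (lie a b f).
  by move=> [_]; apply.
elim: lf => {a b f} [||c f h lf [pf IHf] lh [ph IHh]|i j f ji iq jq lf [pf IHf]].
- split=> // a b ab bq; have -> : lie a b w = fun=> 0 by apply: funext => g; apply: w0.
  exact: lowered0.
- split=> [|a b _ _]; first exact: polyfun_const.
  by rewrite lie_const; apply: lowered0.
- split=> [|a b ab bq]; first by apply: polyfunD => //; apply: polyfunZ.
  rewrite lieD //; last exact: polyfunZ.
  by rewrite lieZ //; apply: lowered_lin; auto.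
split=> [|a b ab bq]; first exact: polyfun_lie.
have aq := ltn_trans ab bq.
have any (k l : 'I_n) : (k < q)%N -> (l < q)%N -> lowered q w (lie k l f).
  by move=> kq lq; case: (leqP l k) => kl; [apply: lowered_lie|apply: IHf].
have -> : lie a b (lie i j f) = (fun g => 1 * lie i j (lie a b f) g +
   ((b == i)%:R * lie a j f g + (- (j == a)%:R * lie i b f g + 0))).
  apply: funext => g; rewrite lie_comm //.
  by case: (b == i); case: (j == a); rewrite ?mulr1n ?mulr0n; ring.
apply: lowered_lin; first by apply: lowered_lie => //; apply: IHf.
apply: lowered_lin; first exact: any.
by apply: lowered_lin; [exact: any|exact: lowered0].
Qed.

(** [lowered] is a nonzero submodule of an irreducible module. *)
Lemma irreducible_lowered q (W : set (GL C n -> C)) w :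
  (forall f, W f -> in_V f) -> gl_irreducible q W ->
  W w -> nonzero w ->
  (forall i j : 'I_n, (i < j)%N -> (j < q)%N -> forall g, gl_act i j w g = 0) ->
  forall f, W f -> lowered q w f.
Proof.
move=> WV [[[W0 Wlin] Wact] _ Wmin] Ww nzw w0.
have lW f : lowered q w f -> W f.
  elim=> // [c f' h _ Wf _ Wh|i j f' _ iq jq _ Wf]; first exact: Wlin.
  by rewrite -lieE; apply: Wact.
have -> // : W = lowered q w.
symmetry; apply: Wmin => //; last by exists w; split=> //; apply: lowered_top.
split; first by split; [exact: lowered0|exact: lowered_lin].
move=> i j f iq jq lf; rewrite lieE; case: (leqP j i) => ij; first exact: lowered_lie.
apply: lowered_raise => //; first exact/in_V_polyfun/WV.
by move=> k k' kk' k'q g; rewrite -lieE w0.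
Qed.

(** Adjointness moves the operators that produce f to the stable space T. *)
Lemma lowered_perp q w T f : in_V w ->
  (forall f, lowered q w f -> in_V f) ->
  (forall h, T h -> in_V h) ->
  (forall (i j : 'I_n) h, (i < q)%N -> (j < q)%N -> T h -> T (lie i j h)) ->
  (forall h, T h -> hform w h = 0) ->
  lowered q w f -> forall h, T h -> hform f h = 0.
Proof.
move=> Vw lV TV Tlie wT; elim=> {f} [|h Th|c f f' lf IHf lf' IHf' h Th|i j f ji iq jq lf IH h Th].
- exact: wT.
- by rewrite hform0l.
- by rewrite hform_linl IHf // IHf' // mulr0 addr0.
by rewrite hform_lie ?IH //; auto; apply: lV => //; apply: lowered_lie.
Qed.

(** What is used of an irreducible module with highest weight l. *)
Record hw_data q (W : set (GL C n -> C)) (l : nat -> int) w : Prop := HwData {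
  hw_mem : W w;
  hw_V : forall f, W f -> in_V f;
  hw_low : forall f, W f -> lowered q w f;
  hw_lowW : forall f, lowered q w f -> W f;
  hw_lie : forall (i j : 'I_n) f, (i < q)%N -> (j < q)%N -> W f -> W (lie i j f);
  hw_raise : forall i j : 'I_n, (i < j)%N -> (j < q)%N -> lie i j w = fun=> 0;
  hw_weight : forall i : 'I_n, (i < q)%N -> lie i i w = fun g => (l i.+1)%:~R * w g }.

Lemma hw_dataP q (W : set (GL C n -> C)) (l : nat -> int) :
  (forall f, W f -> in_V f) -> gl_irreducible q W -> has_highest_weight q l W ->
  exists w, hw_data q W l w.
Proof.
move=> WV Wi [w [Ww nzw w0 wl]]; exists w.
have WL := irreducible_lowered WV Wi Ww nzw w0.
have [[[W0 Wlin] Wact] _ _] := Wi.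
split=> //.
- move=> f; elim=> // [c f' h _ Wf _ Wh|i j f' _ iq jq _ Wf]; first exact: Wlin.
  by rewrite -lieE; apply: Wact.
- by move=> i j f iq jq Wf; rewrite -lieE; apply: Wact.
- by move=> i j ij jq; rewrite -lieE; apply: funext => g; apply: w0.
- by move=> i iq; rewrite -lieE; apply: funext => g; apply: wl.
Qed.

(** By [lowered_perp] it is enough to pair w with the module of w', and there
    again, as w is killed by the adjoints of the lowering operators, only with w'
    itself, where the weights differ. *)
Lemma hw_orth q (W W' : set (GL C n -> C)) l l' w w' (i0 : 'I_n) :
  hw_data q W l w -> hw_data q W' l' w' -> (i0 < q)%N -> l i0.+1 != l' i0.+1 ->
  forall f f', W f -> W' f' -> hform f f' = 0.
Proof.
move=> [Ww WV WL LW Wlie w0 wl] [Ww' WV' WL' LW' Wlie' w0' wl'] i0q ll' f f' Wf Wf'.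
have Vw := WV _ Ww; have Vw' := WV' _ Ww'.
apply: (@lowered_perp q w (fun h => W' h) f) => //.
- by move=> h /LW /WV.
- move=> h /WL' lh; elim: lh => {h} [||c h h' lh IHh lh' IHh'|i j h ji iq jq lh IH].
  + have H : hform (lie i0 i0 w) w' = hform w (lie i0 i0 w').
      by apply: hform_lie => //; [apply: WV; apply: Wlie|apply: WV'; apply: Wlie'].
    move: H; rewrite wl // wl' //.
    have -> : (fun g => (l i0.+1)%:~R * w g) = (fun g => (l i0.+1)%:~R * w g + 0).
      by apply: funext => g; rewrite addr0.
    have -> : (fun g => (l' i0.+1)%:~R * w' g) = (fun g => (l' i0.+1)%:~R * w' g + 0).
      by apply: funext => g; rewrite addr0.
    rewrite hform_linl hform_linr //; last exact: in_V0.
    rewrite hform0l hform0r // !addr0 rmorph_int => /eqP; rewrite -subr_eq0 -mulrBl mulf_eq0.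
    by rewrite -rmorphB /= intr_eq0 subr_eq0 (negPf ll') => /eqP.
  + by rewrite hform0r.
  + by rewrite hform_linr ?IHh ?IHh' ?mulr0 ?addr0 //; apply: WV'; apply: LW'.
  + rewrite -hform_lie //; last 3 first.
    * by apply: WV'; apply: LW'.
    * by apply: WV; apply: Wlie.
    * by apply: WV'; apply: Wlie' => //; apply: LW'.
    move: ji; rewrite leq_eqVlt => /predU1P [/val_inj E|ji]; last first.
      by rewrite w0 // hform0l.
    rewrite E wl //.
    have -> : (fun g => (l i.+1)%:~R * w g) = (fun g => (l i.+1)%:~R * w g + 0).
      by apply: funext => g; rewrite addr0.
    by rewrite hform_linl IH hform0l mulr0 addr0.
- exact: WL.
Qed.

End HighestWeight.

(** * The action of gl_n on monomials *)

Section LieMono.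
Variables (K : numFieldType) (n : nat).
Implicit Types (x y : ex n) (X Y : proper_sets n) (i j : 'I_n) (g : GL K n).

Lemma lie_prod (I : eqType) (r : seq I) (F : I -> GL K n -> K) i j : uniq r ->
  (forall k, polyfun (F k)) ->
  lie i j (fun g => \prod_(k <- r) F k g) =
  (fun g => \sum_(k <- r) lie i j (F k) g * \prod_(l <- r | l != k) F l g).
Proof.
move=> + PF; elim: r => [_|a r IH /= /andP [ar ur]].
  have -> : (fun g => \prod_(k <- [::]) F k g) = fun=> 1 by apply: funext => g; rewrite big_nil.
  by rewrite lie_const; apply: funext => g; rewrite big_nil.
have -> : (fun g => \prod_(k <- a :: r) F k g) = (fun g => F a g * \prod_(k <- r) F k g).
  by apply: funext => g; rewrite big_cons.
rewrite lieM //; last by apply: polyfun_prod.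
rewrite IH //; apply: funext => g; rewrite big_cons big_cons eqxx /=; congr (_ * _ + _).
  rewrite big_seq_cond [RHS]big_seq_cond; apply: eq_bigl => k.
  by case: (boolP (k \in r)) => //= kr; apply/esym; apply: contraNneq ar => <-.
rewrite mulr_sumr; apply: eq_big_seq => k kr.
rewrite big_cons ifT; last by apply: contraNneq ar => ->.
by rewrite mulrCA.
Qed.

Lemma lieX f k i j : polyfun f ->
  lie i j (fun g => f g ^+ k) = (fun g => k%:R * f g ^+ k.-1 * lie i j f g) :> (GL K n -> K).
Proof.
move=> pf; elim: k => [|k IH].
  by rewrite lie_const; apply: funext => g; rewrite !mul0r.
have -> : (fun g => f g ^+ k.+1) = (fun g => f g * f g ^+ k) by apply: funext => g; rewrite exprS.
rewrite lieM //; last exact: polyfunX.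
rewrite IH; apply: funext => g; case: k {IH} => [|k]; first by rewrite !mulr0n expr0 /=; ring.
by rewrite /= [(k.+2)%:R]mulrS exprS; ring.
Qed.

Lemma polyfun_row_ext r c : polyfun (fun g : GL K n => row_ext (val g) r c).
Proof. by rewrite /row_ext; case: insub => [r'|]; [apply: polyfun_entry|apply: polyfun_const]. Qed.

Lemma lie_row_ext r c i j :
  lie i j (fun g : GL K n => row_ext (val g) r c) = (fun g => row_ext (val g) r i *+ (j == c)).
Proof.
rewrite /row_ext; case: insub => [r'|]; first exact: lie_entry.
by rewrite lie_const; apply: funext => g; rewrite mul0rn.
Qed.

Definition replace_col p (c : 'I_p -> 'I_n) k0 i : 'I_p -> 'I_n :=
  fun k => if k == k0 then i else c k.

Lemma lie_mdet p (c : 'I_p -> 'I_n) i j :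
  lie i j (fun g : GL K n => mdet (val g) c) =
  (fun g => \sum_(k0 < p) mdet (val g) (replace_col c k0 i) *+ (j == c k0)).
Proof.
have -> : (fun g : GL K n => mdet (val g) c) =
   (fun g => \sum_(s : 'S_p) (-1) ^+ s * \prod_k row_ext (val g) (s k) (c k)).
  by apply: funext => g; rewrite mdet_sum.
have pp (s : 'S_p) : polyfun (fun g : GL K n => \prod_k row_ext (val g) (s k) (c k)).
  by apply: polyfun_prod => k _; apply: polyfun_row_ext.
rewrite lie_sum; last by move=> s; apply: polyfunZ.
apply: funext => g.
rewrite (eq_bigr (fun s : 'S_p => \sum_k0 (-1) ^+ s *
    (lie i j (fun g : GL K n => row_ext (val g) (s k0) (c k0)) g *
     \prod_(k | k != k0) row_ext (val g) (s k) (c k)))); last first.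
  move=> s _; rewrite lieZ // lie_prod ?index_enum_uniq // ?mulr_sumr // => k.
  exact: polyfun_row_ext.
rewrite exchange_big; apply: eq_bigr => k0 _ /=.
rewrite mdet_sum -sumrMnl; apply: eq_bigr => s _.
rewrite lie_row_ext [in RHS](bigD1 k0) //= /replace_col eqxx.
rewrite -mulrnAr -mulrnAl; congr (_ * (_ * _)).
by apply: eq_bigr => k /negPf ->.
Qed.

Lemma lie_minor_diag (S : {set 'I_n}) i :
  lie i i (fun g : GL K n => minor (val g) S) = (fun g => (i \in S)%:R * minor (val g) S).
Proof.
have -> : (fun g : GL K n => minor (val g) S) = (fun g => mdet (val g) (fun k : 'I_#|S| => enum_val k)).
  by apply: funext => g; rewrite minorE.
rewrite lie_mdet; apply: funext => g.
transitivity (\sum_(k0 < #|S|) (i == enum_val k0)%:R * mdet (val g) (fun k : 'I_#|S| => enum_val k)).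
  apply: eq_bigr => k0 _; case: eqP => [ik|_]; rewrite ?mulr1n ?mul1r ?mulr0n ?mul0r //.
  by apply: eq_mdet => k; rewrite /replace_col; case: eqP => [->|].
rewrite -mulr_suml; congr (_ * _); last by rewrite minorE.
case: (boolP (i \in S)) => iS.
  rewrite (bigD1 (enum_rank_in iS i)) //= enum_rankK_in // eqxx big1 ?addr0 // => k kr.
  case: eqP => // ik; case/eqP: kr; apply: enum_val_inj; rewrite enum_rankK_in //.
by rewrite big1 // => k _; case: eqP => // ik; rewrite ik enum_valP in iS.
Qed.

(** E_ij replaces the column j by the column i; the sign c sorts the columns. *)
Lemma lie_minor (S : {set 'I_n}) i j : i != j ->
  exists c : K, (c != 0 -> (j \in S) && (i \notin S)) /\
    lie i j (fun g : GL K n => minor (val g) S) =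
    (fun g => c * minor (val g) (i |: (S :\ j))%SET).
Proof.
move=> ij.
have E0 : (fun g : GL K n => minor (val g) S) = (fun g => mdet (val g) (fun k : 'I_#|S| => enum_val k)).
  by apply: funext => g; rewrite minorE.
rewrite E0 lie_mdet; case: (boolP (j \in S)) => jS; last first.
  exists 0; rewrite eqxx; split=> //; apply: funext => g; rewrite mul0r big1 // => k _.
  by case: eqP => // jk; rewrite jk enum_valP in jS.
pose k0 := enum_rank_in jS j.
have k0E : enum_val k0 = j by rewrite enum_rankK_in.
have -> : (fun g : GL K n => \sum_(k1 < #|S|) mdet (val g) (replace_col enum_val k1 i) *+ (j == enum_val k1))
  = (fun g => mdet (val g) (replace_col (fun k : 'I_#|S| => enum_val k) k0 i)).
  apply: funext => g; rewrite (bigD1 k0) //= k0E eqxx big1 ?addr0 // => k kk.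
  case: eqP => // jk; case/eqP: kk; apply: enum_val_inj; by rewrite k0E.
case: (boolP (i \in S)) => iS.
  exists 0; rewrite eqxx; split=> //; apply: funext => g; rewrite mul0r.
  apply: (@mdet_alt _ _ _ _ _ k0 (enum_rank_in iS i)).
    by apply: contraNneq ij => E; rewrite -k0E E enum_rankK_in.
  rewrite /replace_col eqxx; case: eqP => // _; by rewrite enum_rankK_in.
set c := replace_col _ _ _.
have cinj : injective c.
  move=> k l; rewrite /c /replace_col; case: eqP => [->|_]; case: eqP => [->|_] //.
  - by move=> il; rewrite il enum_valP in iS.
  - by move=> il; rewrite -il enum_valP in iS.
  - exact: enum_val_inj.
have [b bP] := mdet_set K cinj; exists ((-1) ^+ b); split=> //.
apply: funext => g; rewrite bP; congr (_ * minor _ _).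
apply/setP => y; rewrite !inE; apply/imsetP/idP => [[k _ ->]|].
  rewrite /c /replace_col; case: (k =P k0) => [_|kk]; first by rewrite eqxx.
  rewrite enum_valP andbT; apply/orP; right; apply/eqP => E; apply: kk.
  by apply: enum_val_inj; rewrite k0E.
case/orP => [/eqP ->|/andP [yj yS]].
  by exists k0 => //; rewrite /c /replace_col eqxx.
exists (enum_rank_in yS y) => //; rewrite /c /replace_col enum_rankK_in //.
by case: eqP => // E; case/eqP: yj; rewrite -k0E -E enum_rankK_in.
Qed.

(** The Leibniz rule; t X is x with one factor X removed. *)
Lemma lie_mono x i j : exists t : proper_sets n -> ex n,
  (forall X, (0 < x X)%N -> x = addx (t X) (e1 X)) /\
  lie i j (mono x) = (fun g : GL K n => \sum_X (x X)%:R * (mono (t X) g *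
    lie i j (fun g => minor (val g) (val X)) g)).
Proof.
have H X : exists y, (0 < x X)%N -> x = addx y (e1 X).
  by case: (posnP (x X)) => [_|/exB [y yE]]; [exists x|exists y].
have [t tE] := choice H; exists t; split=> //.
have -> : mono x = (fun g : GL K n => \prod_X minor (val g) (val X) ^+ x X) by [].
rewrite lie_prod ?index_enum_uniq //; last by move=> X; apply/polyfunX/polyfun_minor.
apply: funext => g; apply: eq_bigr => X _.
rewrite lieX; last exact: polyfun_minor.
case: (posnP (x X)) => [->|xX]; first by rewrite !mul0r.
rewrite -!mulrA; congr (_ * _); rewrite mulrCA mulrC; congr (_ * _).
have xE := tE X xX; rewrite [RHS](bigD1 X) //=; congr (_ * _).
  by congr (_ ^+ _); rewrite {1}xE addxE e1E eqxx addn1.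
by apply: eq_bigr => Y YX; rewrite {1}xE addxE e1E (negPf YX) addn0.
Qed.

Lemma lie_mono_diag x i :
  lie i i (mono x) = (fun g : GL K n => (\sum_(X : proper_sets n | i \in val X) x X)%:R * mono x g).
Proof.
have [t [tE ->]] := lie_mono x i i; apply: funext => g.
rewrite natr_sum mulr_suml [RHS]big_mkcond; apply: eq_bigr => X _ /=.
rewrite lie_minor_diag; case: (posnP (x X)) => [->|/tE xE]; first by rewrite !mul0r if_same.
case: (i \in _); last by rewrite mul0r !mulr0.
by rewrite mul1r [in mono x g]xE mono_add mono_e1.
Qed.

Lemma lie_mono_span x i j : i != j ->
  in_span (fun y => exists X X' z, [/\ x = addx z (e1 X), y = addx z (e1 X'),
     j \in val X, i \notin val X & val X' = (i |: (val X :\ j))%SET])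
    (lie i j (mono x : GL K n -> K)).
Proof.
move=> ij; have [t [tE ->]] := lie_mono x i j.
apply: in_span_sum => X _; case: (posnP (x X)) => [->|/tE xE].
  set P := (fun y => _); have := @in_span0 K n P; congr in_span.
  by apply: funext => g; rewrite mul0r.
apply: in_spanZ; have [c [cP ->]] := lie_minor (val X) ij.
case: (eqVneq c 0) => [->|/cP /andP [jX iX]].
  set P := (fun y => _); have := @in_span0 K n P; congr in_span.
  by apply: funext => g; rewrite mul0r mulr0.
have pX' : ((i |: (val X :\ j)) != finset.set0)%SET && ((i |: (val X :\ j)) != finset.setT)%SET.
  have cX : #|(i |: (val X :\ j))%SET| = #|val X|.
    by rewrite cardsU1 !inE (negPf iX) andbF /= [RHS](cardsD1 j) jX.
  by rewrite proper_cardE cX -proper_cardE; apply: (valP X).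
have [X' X'E] : exists X' : proper_sets n, val X' = (i |: (val X :\ j))%SET.
  by exists (Sub (i |: (val X :\ j))%SET pX').
have -> : (fun g : GL K n => mono (t X) g * (c * minor (val g) (i |: (val X :\ j))%SET)) =
   (fun g => c * mono (addx (t X) (e1 X')) g).
  by apply: funext => g; rewrite mono_add mono_e1 X'E mulrCA.
by apply/in_spanZ/in_span_mono; exists X, X', (t X).
Qed.
End LieMono.

(** * Gelfand-Tsetlin vectors and monomials *)

Section GTMono.
Variables (C : numClosedFieldType) (n : nat) (m : nat -> int).
Hypothesis m_noninc : forall p, (1 <= p < n)%N -> m p.+1 <= m p.
Implicit Types (x y : ex n) (X Y : proper_sets n) (f h w : GL C n -> C).
Local Notation in_V := (@in_V C n m).
Local Notation hform := (@hform C n m).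

Lemma rsum_add x y p q : rsum (addx x y) p q = (rsum x p q + rsum y p q)%N.
Proof. by rewrite /rsum -big_split; apply: eq_bigr => X _; rewrite addxE. Qed.

Lemma rsum_e1 X p q : rsum (e1 X) p q = (p <= #|val X :&: seg n q|)%N.
Proof.
rewrite /rsum -[RHS]muln1 -(sum_e1 (fun X => p <= #|val X :&: seg n q|)%N (fun=> 1%N)).
by apply: eq_bigr => Y _; rewrite muln1.
Qed.

Definition wt x (i : 'I_n) : nat := \sum_(X : proper_sets n | i \in val X) x X.

Lemma sum_rsum x q j :
  (\sum_(1 <= p < j.+1) rsum x p q = \sum_X x X * minn j #|val X :&: seg n q|)%N.
Proof.
elim: j => [|j IH].
  by rewrite big_geq // big1 // => X _; rewrite min0n muln0.
rewrite big_nat_recr //= IH /rsum [X in (_ + X)%N]big_mkcond -big_split /=.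
apply: eq_bigr => X _; set a := #|_|.
have -> : (minn j.+1 a = minn j a + (j < a))%N by lia.
by rewrite mulnDr; case: (j < a)%N; rewrite ?muln1 ?muln0.
Qed.

(** If the q-th row of d is the weight of x, its partial sums count the entries
    of columns below j. *)
Lemma sum_wt x (d : nat -> nat -> int) q j : (j <= q <= n)%N ->
  (forall i : 'I_n, (i < q)%N -> d i.+1 q = wt x i) ->
  \sum_(1 <= p < j.+1) d p q = (\sum_X x X * #|val X :&: seg n j|)%N.
Proof.
move=> jq dx; elim: j jq => [|j IH] jq.
  rewrite big_geq // big1 // => X _; apply/eqP; rewrite muln_eq0 cards_eq0; apply/orP; right.
  by apply/eqP/setP => z; rewrite !inE ltn0 andbF.
have jn : (j < n)%N by case/andP: jq => ? ?; lia.
rewrite big_nat_recr //= IH ?(dx (Ordinal jn)) /=; try lia.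
rewrite -PoszD; congr Posz; rewrite /wt [X in (_ + X)%N]big_mkcond -big_split /=.
apply: eq_bigr => X _; rewrite (card_segS (val X) (Ordinal jn)) mulnDr addnC /=.
by case: (_ \in _); rewrite ?muln1 ?muln0.
Qed.

Lemma in_span_ind (P : ex n -> Prop) (Q : (GL C n -> C) -> Prop) :
  Q (fun=> 0) -> (forall c x f, P x -> Q f -> Q (fun g => c * mono x g + f g)) ->
  forall f, in_span P f -> Q f.
Proof.
move=> Q0 QD f [L LP LE]; have -> : f = (fun g => \sum_(t <- L) t.1 * mono t.2 g) by apply: funext.
elim: L LP {LE} => [|t L IH] LP; first by under eq_fun do rewrite big_nil.
under eq_fun do rewrite big_cons.
by apply: QD; [apply: LP; rewrite mem_head|apply: IH => s sL; apply: LP; rewrite inE sL orbT].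
Qed.

Lemma in_span_lie (P Q : ex n -> Prop) i j f :
  (forall y, P y -> in_span Q (lie i j (mono y : GL C n -> C))) ->
  in_span P f -> in_span Q (lie i j f).
Proof.
move=> PQ [L LP LE]; have -> : f = (fun g => \sum_(t <- L) t.1 * mono t.2 g) by apply: funext.
rewrite lie_sum => [|t]; last exact/polyfunZ/polyfun_mono.
apply: in_span_sum => t tL; rewrite lieZ; last exact: polyfun_mono.
by apply/in_spanZ/PQ/LP.
Qed.

Lemma card_replace (S : {set 'I_n}) (i j : 'I_n) q : (i < q)%N -> (j < q)%N ->
  j \in S -> i \notin S -> #|(i |: (S :\ j)) :&: seg n q| = #|S :&: seg n q|.
Proof.
move=> iq jq jS iS.
have -> : ((i |: (S :\ j)) :&: seg n q = i |: ((S :&: seg n q) :\ j))%SET.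
  apply/setP => z; rewrite !inE; case: eqP => [->|] //=; rewrite ?iq //.
  by rewrite andbA.
by rewrite cardsU1 !inE (negPf iS) /= andbF /= [RHS](cardsD1 j) !inE jS jq.
Qed.

(** The exponents that share the q-th row of the diagram of x; the span of their
    monomials is stable under gl_q. *)
Definition row_class q x y := multideg (gap m) y /\ forall p, rsum y p q = rsum x p q.

Lemma row_class_lie q x (i j : 'I_n) h : (i < q)%N -> (j < q)%N -> (q <= n)%N ->
  in_span (row_class q x) h -> in_span (row_class q x) (lie i j h).
Proof.
move=> iq jq qn; apply: in_span_lie => y [ky ry].
case: (eqVneq i j) => [<-|ij].
  by rewrite lie_mono_diag; apply/in_spanZ/in_span_mono.
apply: in_spanW (lie_mono_span _ _ ij) => z [X [X' [u [yE -> jX iX X'E]]]].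
split.
  apply/multidegP => p pn; have /multidegP/(_ p pn) <- := ky.
  rewrite yE !deg_add !deg_e1 X'E.
  suff -> : #|(i |: (val X :\ j))%SET| = #|val X| by [].
  by rewrite cardsU1 !inE (negPf iX) andbF /= [RHS](cardsD1 j) jX.
by move=> p; rewrite -ry yE !rsum_add !rsum_e1 X'E card_replace.
Qed.

(** Dominance order, in each row. *)
Definition dominated (d d' : nat -> nat -> int) :=
  forall q j, (0 < q <= n)%N -> (j <= q)%N ->
    \sum_(1 <= p < j.+1) d p q <= \sum_(1 <= p < j.+1) d' p q /\
    (j = q -> \sum_(1 <= p < j.+1) d p q = \sum_(1 <= p < j.+1) d' p q).

Definition diagram x p q : int :=
  if [&& 1 <= p, p <= q & q <= n]%N then Posz (rsum x p q) else 0.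

Lemma GT_hw d f q : GT_vector m d f -> (1 <= q <= n)%N ->
  exists (W : set (GL C n -> C)) w, hw_data m q W (fun p => d p q) w /\ W f.
Proof.
move=> [_ _ H] /H [W [WV Wi Whw Wf]].
have [w wP] := hw_dataP (fun f Wf => rep_V_in_V m_noninc (WV f Wf)) Wi Whw.
by exists W, w.
Qed.

Lemma GT_in_V d f : GT_vector m d f -> in_V f.
Proof. by move=> [/(rep_V_in_V m_noninc)]. Qed.

Lemma GT_norm d f : GT_vector m d f -> hform f f != 0.
Proof.
move=> Gf; apply/eqP => /(hform_eq0 (GT_in_V Gf)) f0.
by have [_ [g]] := Gf; rewrite f0 eqxx.
Qed.

Lemma GT_orth d d' f f' : GT_diagram n m d -> GT_diagram n m d' -> d <> d' ->
  GT_vector m d f -> GT_vector m d' f' -> hform f f' = 0.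
Proof.
move=> Gd Gd' dd' Gf Gf'; apply/eqP/negPn/negP => /eqP ff'; apply: dd'.
apply: funext => p; apply: funext => q.
case: (boolP [&& 1 <= p, p <= q & q <= n]%N) => [/and3P [p1 pq qn]|npq]; last first.
  by have [_ _ ->] := Gd => //; have [_ _ ->] := Gd'.
apply/eqP/negPn/negP => ne; apply: ff'.
have q1 : (1 <= q <= n)%N by rewrite (leq_trans p1 pq).
have [W [w [hw Wf]]] := GT_hw Gf q1; have [W' [w' [hw' Wf']]] := GT_hw Gf' q1.
have pn : (p.-1 < n)%N by rewrite prednK // (leq_trans pq).
by apply: (hw_orth hw hw' (i0 := Ordinal pn)) => //=; rewrite prednK.
Qed.

(** f lies in a gl_q-module generated by a highest weight vector w of weight the
    q-th row of d. The span of the row class of x is gl_q-stable and not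
    orthogonal to f, so w pairs with a monomial y of the class, whose weight is
    then the q-th row of d. A column has at most j entries below j, so the partial
    sums of the weight of y are at most those of its row sums. *)
Lemma GT_triangular d f x :
  (forall y, multideg (gap m) y -> in_V (mono y)) ->
  GT_diagram n m d -> GT_vector m d f -> multideg (gap m) x -> hform f (mono x) != 0 ->
  dominated d (diagram x).
Proof.
move=> MV Gd Gf kx fx q j /andP [q1 qn] jq.
have diagE i : (i <= q)%N -> \sum_(1 <= p < i.+1) diagram x p q = (\sum_(1 <= p < i.+1) rsum x p q)%N.
  move=> iq; rewrite (big_morph Posz PoszD (erefl _)).
  by apply: eq_big_nat => p /andP [p1 pi]; rewrite /diagram p1 qn (leq_trans _ iq).
have [W [w [hw Wf]]] := GT_hw Gf (introT andP (conj q1 qn)).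
have Vw := hw_V hw (hw_mem hw).
have TV h : in_span (row_class q x) h -> in_V h.
  apply: in_span_ind => [|c y f' [ky _] Vf']; first exact: in_V0.
  exact/in_V_lin/Vf'/MV.
(* some monomial of the row class pairs with the highest weight vector *)
have [y [ky ry] wy] : exists2 y, row_class q x y & hform w (mono y) != 0.
  apply: contrapT => H; case/eqP: fx.
  apply: (@lowered_perp C n m q w (in_span (row_class q x))) => //.
  - by move=> f' /(hw_lowW hw) /(hw_V hw).
  - by move=> a b h aq bq; apply: row_class_lie.
  - move=> h Th; suff [] : in_V h /\ hform w h = 0 by [].
    move: h Th; apply: in_span_ind => [|c y f' ry [Vf' f'0]].
      by split; [exact: in_V0|rewrite hform0r].
    have Vy : in_V (mono y) by apply: MV; case: ry.
    split; first exact: in_V_lin.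
    rewrite hform_linr // f'0 addr0; case: (eqVneq (hform w (mono y)) 0) => [->|ne].
      by rewrite mulr0.
    by case: H; exists y.
  - exact: (hw_low hw Wf).
  - by apply: in_span_mono.
have Vy := MV y ky.
(* weight vectors of different weights are orthogonal *)
have dwt (i : 'I_n) : (i < q)%N -> d i.+1 q = wt y i.
  move=> iq.
  have Vw' : in_V (lie i i w) by apply: (hw_V hw); apply: (hw_lie hw) => //; apply: hw_mem hw.
  have Vy' : in_V (lie i i (mono y)).
    by apply/TV/row_class_lie => //; apply: in_span_mono.
  have := hform_lie Vw Vy Vw' Vy'; rewrite (hw_weight hw) // lie_mono_diag.
  have -> : (fun g => (d i.+1 q)%:~R * w g) = (fun g => (d i.+1 q)%:~R * w g + 0).
    by apply: funext => g; rewrite addr0.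
  have -> : (fun g : GL C n => (\sum_(X : proper_sets n | i \in val X) y X)%:R * mono y g) =
     (fun g => (wt y i)%:R * mono y g + 0).
    by apply: funext => g; rewrite addr0.
  rewrite hform_linl hform_linr //; last exact: in_V0.
  rewrite hform0l hform0r // !addr0 rmorph_nat => /(mulIf wy) H.
  by apply/eqP; rewrite -(@eqr_int C) H.
(* a column has at most j elements below j, and no more than below q *)
have le X : (y X * #|val X :&: seg n j| <= y X * minn j #|val X :&: seg n q|)%N.
  rewrite leq_mul2l; apply/orP; right; rewrite leq_min; apply/andP; split.
    have jn := leq_trans jq qn.
    by rewrite -[leqRHS](card_seg jn); apply/subset_leq_card/finset.subsetIr.
  apply/subset_leq_card/finset.setIS/fintype.subsetP => z; rewrite !inE.
  by move=> zj; apply: leq_trans jq.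
rewrite (sum_wt _ dwt) ?jq ?qn // diagE // (eq_bigr (fun p => rsum y p q)) => [|p _]; last first.
  by rewrite ry.
rewrite sum_rsum; split=> [|jE].
  by rewrite lez_nat; apply: leq_sum => X _; apply: le.
congr Posz; rewrite jE; apply: eq_bigr => X _; congr muln.
symmetry; apply/minn_idPr; rewrite -[leqRHS](card_seg qn).
exact/subset_leq_card/finset.subsetIr.
Qed.
End GTMono.

(** * Counting standard monomials *)

(** Induction along the order, on the equations of T A = 1. *)
Lemma triangular_inverse (K : fieldType) (I : finType) (le : I -> I -> Prop) (T A : I -> I -> K) :
  (forall i, le i i) -> (forall i j k, le i j -> le j k -> le i k) ->
  (forall i j, le i j -> le j i -> i = j) ->
  (forall i j, \sum_k T i k * A k j = (i == j)%:R) ->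
  (forall i j, T i j != 0 -> le j i) ->
  forall i, A i i != 0 /\ forall j, A i j != 0 -> le j i.
Proof.
move=> ler letr leas TA Tle i.
(* the number of elements below i, which makes the order well founded *)
pose rk i := #|[set j | `[< le j i >]]%SET|.
have rk_lt k j : le k j -> k != j -> (rk k < rk j)%N.
  move=> kj nkj; apply: proper_card; apply/properP; split.
    apply/fintype.subsetP => l; rewrite !finset.in_set => /asboolP lk; apply/asboolP.
    exact: (letr _ _ _ lk kj).
  exists j; rewrite finset.in_set; first exact/asboolP.
  by apply/asboolP => jk; case/eqP: nkj; apply: leas.
have [N] := ubnP (rk i); elim: N i => [//|N IH] i iN.
have sumE j : (i == j)%:R = T i i * A i j + \sum_(k | k != i) T i k * A k j.
  by rewrite -TA (bigD1 i).
have low k : T i k != 0 -> k != i -> forall j, A k j != 0 -> le j k /\ le k i.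
  move=> Tik ki j Akj; have ki' := Tle _ _ Tik; split=> //.
  have [|_] := IH k; first by have := rk_lt k i ki' ki; move: iN; lia.
  by apply.
have TAii : T i i * A i i = 1.
  have := sumE i; rewrite eqxx big1 ?addr0 // => k ki.
  apply/eqP; rewrite mulf_eq0; case: (eqVneq (T i k) 0) => //= Tik.
  apply/negPn/negP => Aki; have [ik ki'] := low k Tik ki i Aki.
  by case/eqP: ki; apply: leas.
have Aii : A i i != 0 by apply: contraTneq isT => A0; move: TAii; rewrite A0 mulr0 => /eqP; rewrite eq_sym oner_eq0.
have Tii : T i i != 0 by apply: contraTneq isT => A0; move: TAii; rewrite A0 mul0r => /eqP; rewrite eq_sym oner_eq0.
split=> // j Aij; apply: contrapT => nji.
have ij : i != j by apply/eqP => E; apply: nji; rewrite E.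
have := sumE j; rewrite (negPf ij) big1 ?addr0 => [/esym/eqP|k ki].
  by rewrite mulf_eq0 (negPf Tii) (negPf Aij).
apply/eqP; rewrite mulf_eq0; case: (eqVneq (T i k) 0) => //= Tik.
apply/negPn/negP => Akj; have [jk ki'] := low k Tik ki j Akj.
by apply: nji; exact: (letr _ _ _ jk ki').
Qed.

Section Counting.
Variables (C : numClosedFieldType) (n : nat) (m : nat -> int).
Hypothesis m_noninc : forall p, (1 <= p < n)%N -> m p.+1 <= m p.
Hypothesis m_n : m n = 0.
Implicit Types (x y : ex n) (X Y : proper_sets n) (f h w : GL C n -> C).
Local Notation in_V := (@in_V C n m).
Local Notation hform := (@hform C n m).
Local Notation deg_m := (multideg (gap m)).

Lemma dominated_refl (d : nat -> nat -> int) : dominated n d d.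
Proof. by []. Qed.

Lemma dominated_trans d1 d2 d3 : dominated n d1 d2 -> dominated n d2 d3 -> dominated n d1 d3.
Proof.
move=> H1 H2 q j qn jq; have [a1 b1] := H1 q j qn jq; have [a2 b2] := H2 q j qn jq.
by split=> [|E]; [apply: le_trans a2|rewrite b1 ?b2].
Qed.

Lemma dominated_anti x y : standard x -> standard y ->
  dominated n (diagram x) (diagram y) -> dominated n (diagram y) (diagram x) -> x = y.
Proof.
move=> sx sy H1 H2; apply: standard_inj => // p q p1 pq qn.
have q0 : (0 < q <= n)%N by rewrite qn (leq_trans p1).
have S j : (j <= q)%N -> \sum_(1 <= p < j.+1) diagram x p q = \sum_(1 <= p < j.+1) diagram y p q.
  by move=> jq; apply/eqP; rewrite eq_le (H1 q j q0 jq).1 (H2 q j q0 jq).1.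
have := S p pq; case: p p1 pq => // p _ pq; rewrite big_nat_recr //= [in RHS]big_nat_recr //= (S p (ltnW pq)) => /addrI.
by rewrite /diagram /= pq qn => -[].
Qed.

Lemma rsum_top x p : deg_m x -> (1 <= p <= n)%N -> Posz (rsum x p n) = m p.
Proof.
move=> /multidegP kx /andP [p1 pn].
have -> : rsum x p n = (\sum_(p <= r < n) deg x r)%N.
  rewrite /rsum /deg (exchange_big_dep xpredT) //= big_mkcond.
  apply: eq_bigr => X _; have -> : (val X :&: seg n n = val X)%SET.
    by apply/setP => z; rewrite !inE ltn_ord andbT.
  have /andP [_ Xn] := card_proper X.
  rewrite (eq_bigl (fun r => r == #|val X|)) => [|r]; last exact: eq_sym.
  by rewrite big_nat1_eq Xn andbT.
rewrite (big_morph Posz PoszD (erefl _)).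
rewrite (@eq_big_nat _ _ _ _ _ _ (fun r => - (m r.+1 - m r))) => [|r /andP [pr rn]].
  by rewrite sumrN telescope_sumr // opprB m_n subr0.
have r0 : (0 < r < n)%N by rewrite (leq_trans p1 pr).
by rewrite kx // opprB (gapE m_noninc).
Qed.

Lemma diagram_GT x : deg_m x -> GT_diagram n m (diagram x).
Proof.
move=> kx; split=> [p /andP [p1 pn]|p q /andP [p1 pq] qn|p q npq].
- by rewrite /diagram p1 pn leqnn rsum_top // p1.
- have pq' : (p <= q.+1)%N := leqW pq; have pq2 : (p < q.+1)%N := pq.
  rewrite /diagram p1 pq' pq2 pq qn (ltnW qn) /= !lez_nat.
  split; rewrite /rsum big_mkcond [leqRHS]big_mkcond; apply: leq_sum => X _.
    case: ifP => // pX; rewrite ifT //; apply: leq_trans pX _.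
    apply/subset_leq_card/finset.setIS/fintype.subsetP => z; rewrite !inE.
    by move=> zq; apply: ltnW.
  have qX := card_segS (val X) (Ordinal qn); case: ifP => // pX; rewrite ifT //.
  by move: pX; rewrite qX /=; case: (_ \in _); rewrite ?add1n ?add0n // => /ltnW.
- by rewrite /diagram (negPf npq).
Qed.

Variable G : (nat -> nat -> int) -> GL C n -> C.
Hypothesis GP : forall d, GT_diagram n m d -> GT_vector m d (G d).

Definition stds : seq (ex n) := [seq x <- exps n (gap m) | standard x].
Local Notation N := (size stds).
Definition std_nth (i : 'I_N) : ex n := tnth (in_tuple stds) i.
Definition std_diag (i : 'I_N) := diagram (std_nth i).

Lemma std_nthP i : standard (std_nth i) /\ deg_m (std_nth i).
Proof.
have := mem_tnth i (in_tuple stds); rewrite mem_filter mem_exps => /andP [].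
by [].
Qed.

Lemma std_nth_inj : injective std_nth.
Proof. by apply/tuple_uniqP; apply/filter_uniq/uniq_exps. Qed.

Lemma std_diag_GT i : GT_diagram n m (std_diag i).
Proof. by apply: diagram_GT; case: (std_nthP i). Qed.

Lemma std_diag_inj : injective std_diag.
Proof.
move=> i j ij; apply: std_nth_inj.
have [si _] := std_nthP i; have [sj _] := std_nthP j.
by apply: dominated_anti => //; rewrite -[diagram (std_nth i)]/(std_diag i) ij.
Qed.

Lemma std_span (P : ex n -> Prop) f : (forall x, P x -> deg_m x) -> in_span P f ->
  exists a : 'I_N -> C, f = (fun g => \sum_i a i * mono (std_nth i) g).
Proof.
move=> Pdeg Pf; have : in_span (fun y => standard y /\ deg_m y) f.
  apply: in_span_trans Pf => x /Pdeg /multidegP kx.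
  apply: in_spanW (mono_straighten C x) => y [sy dy]; split=> //.
  by apply/multidegP => p pn; rewrite dy kx.
move: f {Pf}; apply: in_span_ind => [|c x f [sx kx] [a ->]].
  by exists (fun=> 0); apply: funext => g; rewrite big1 // => i _; rewrite mul0r.
have /tnthP [i xi] : x \in in_tuple stds by rewrite mem_filter sx mem_exps.
exists (fun j => c * (j == i)%:R + a j); apply: funext => g.
under [RHS]eq_bigr => j _ do rewrite mulrDl.
rewrite big_split /=; congr (_ + _); rewrite [RHS](bigD1 i) //= big1 ?addr0 => [|j /negPf ->].
  by rewrite eqxx mulr1 /std_nth -xi.
by rewrite mulr0 mul0r.
Qed.

Lemma in_V_std f : in_V f -> exists a : 'I_N -> C, f = (fun g => \sum_i a i * mono (std_nth i) g).
Proof.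
move=> [L ->]; apply: (@std_span deg_m) => //.
have -> : fn m L = (fun g => \sum_(x <- exps n (gap m)) lfit L x / xfact C x * mono x g).
  by apply: funext => g; rewrite fn_mono; apply: eq_bigr => x _; rewrite mulrAC.
by apply: in_span_sum => x; rewrite mem_exps => kx; apply/in_spanZ/in_span_mono.
Qed.

Lemma hform_sum (I : Type) (r : seq I) (c : I -> C) (F : I -> GL C n -> C) h :
  hform (fun g => \sum_(k <- r) c k * F k g) h = \sum_(k <- r) c k * hform (F k) h.
Proof.
elim: r => [|k r IH].
  by under eq_fun do rewrite big_nil; rewrite hform0l big_nil.
by under eq_fun do rewrite big_cons; rewrite hform_linl IH big_cons.
Qed.

Lemma in_V_sum (I : Type) (r : seq I) (c : I -> C) (F : I -> GL C n -> C) :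
  (forall k, in_V (F k)) -> in_V (fun g => \sum_(k <- r) c k * F k g).
Proof.
move=> VF; elim: r => [|k r IH].
  by under eq_fun do rewrite big_nil; apply: in_V0.
by under eq_fun do rewrite big_cons; apply: in_V_lin.
Qed.

(** Gelfand-Tsetlin vectors are orthogonal and nonzero, so the square matrix of
    their coordinates has independent rows. *)
Lemma std_matrix : exists A T : 'M[C]_N, [/\ A *m T = 1%:M, T *m A = 1%:M,
  forall i, G (std_diag i) = (fun g => \sum_j A i j * mono (std_nth j) g) &
  forall i, mono (std_nth i) = (fun g => \sum_j T i j * G (std_diag j) g)].
Proof.
have H i : exists a : 'I_N -> C, G (std_diag i) = (fun g => \sum_j a j * mono (std_nth j) g).
  by apply: in_V_std; apply: GT_in_V (GP (std_diag_GT i)).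
have [a aE] := choice H; pose A := \matrix_(i, j) a i j.
have AE i : G (std_diag i) = (fun g => \sum_j A i j * mono (std_nth j) g).
  by rewrite aE; apply: funext => g; apply: eq_bigr => j _; rewrite mxE.
have Au : A \in unitmx.
  rewrite -row_free_unit -kermx_eq0; apply/eqP/row_matrixP => r; rewrite row0.
  set v := row r _; have vA : v *m A = 0 by rewrite -row_mul mulmx_ker row0.
  have vG : (fun g => \sum_i v 0 i * G (std_diag i) g) = fun=> 0.
    apply: funext => g; transitivity (\sum_j (v *m A) 0 j * mono (std_nth j) g).
      under eq_bigr => i _ do rewrite AE mulr_sumr.
      rewrite exchange_big; apply: eq_bigr => j _ /=.
      by rewrite mxE mulr_suml; apply: eq_bigr => i _; rewrite mulrA.
    by rewrite vA big1 // => j _; rewrite mxE mul0r.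
  apply/rowP => k; rewrite [RHS]mxE.
  have := hform0l m (G (std_diag k)); rewrite -vG hform_sum (bigD1 k) //= big1 ?addr0.
    move/eqP; rewrite mulf_eq0 (negPf (GT_norm m_noninc (GP (std_diag_GT k)))) orbF.
    by move/eqP.
  move=> i ik; rewrite (GT_orth m_noninc (std_diag_GT i) (std_diag_GT k)) ?mulr0 //; try exact/GP/std_diag_GT.
  by move=> /std_diag_inj E; rewrite E eqxx in ik.
exists A, (invmx A); split=> //; rewrite ?mulmxV ?mulVmx // => i.
apply: funext => g; transitivity (\sum_j (invmx A *m A) i j * mono (std_nth j) g).
  rewrite mulVmx // (bigD1 i) //= big1 => [|j ji]; rewrite mxE ?eqxx ?mul1r ?addr0 //.
  by rewrite eq_sym (negPf ji) mul0r.
under [RHS]eq_bigr => k _ do rewrite AE mulr_sumr.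
rewrite exchange_big; apply: eq_bigr => j _ /=.
by rewrite mxE mulr_suml; apply: eq_bigr => k _; rewrite mulrA.
Qed.

Lemma mono_in_V y : deg_m y -> in_V (mono y).
Proof.
move=> ky; have [A [T [_ _ _ TE]]] := std_matrix.
have [a ->] := @std_span deg_m _ (fun x kx => kx) (in_span_mono C ky).
apply: in_V_sum => i; rewrite TE; apply: in_V_sum => j.
exact: GT_in_V (GP (std_diag_GT j)).
Qed.

(** The Gelfand-Tsetlin vector of any further diagram would be orthogonal to all
    the others, which span V by [std_matrix]. *)
Lemma std_diag_surj d : GT_diagram n m d -> exists i, d = std_diag i.
Proof.
move=> Gd; apply: contrapT => nd; have [A [T [_ _ _ TE]]] := std_matrix.
have [a aE] := in_V_std (GT_in_V m_noninc (GP Gd)).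
case/eqP: (GT_norm m_noninc (GP Gd)); rewrite {1}aE hform_sum big1 // => i _.
rewrite TE hform_sum big1 ?mulr0 // => j _.
rewrite (GT_orth m_noninc (std_diag_GT j) Gd) ?mulr0 //; try exact: GP.
  by move=> E; apply: nd; exists j.
exact/GP/std_diag_GT.
Qed.

(** By [GT_triangular] the standard monomials are triangular in the
    Gelfand-Tsetlin vectors; the inverse matrix is triangular too. *)
Lemma GT_expansion : exists A : 'I_N -> 'I_N -> C,
  (forall i, G (std_diag i) = (fun g => \sum_j A i j * mono (std_nth j) g)) /\
  forall i, A i i != 0 /\ forall j, A i j != 0 -> dominated n (std_diag j) (std_diag i).
Proof.
have [A [T [_ TA AE TE]]] := std_matrix; exists A; split=> // i.
apply: (@triangular_inverse _ _ (fun i j => dominated n (std_diag i) (std_diag j)) T A).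
- by move=> j; apply: dominated_refl.
- by move=> i1 i2 i3; apply: dominated_trans.
- move=> i1 i2 H1 H2; apply: std_nth_inj; apply: dominated_anti => //; by case: (std_nthP i1); case: (std_nthP i2).
- by move=> i1 i2; move/matrixP/(_ i1 i2): TA; rewrite !mxE.
move=> i1 i2 Tne; have [s1 k1] := std_nthP i1.
apply: (GT_triangular m_noninc mono_in_V (std_diag_GT i2) (GP (std_diag_GT i2)) k1).
rewrite hformC; [|exact: GT_in_V (GP (std_diag_GT i2))|exact: mono_in_V].
rewrite conjC_eq0 TE hform_sum (bigD1 i2) //= big1 ?addr0.
  by apply: mulf_neq0 => //; apply: (GT_norm m_noninc (GP (std_diag_GT i2))).
move=> k ki; rewrite (GT_orth m_noninc (std_diag_GT k) (std_diag_GT i2)) ?mulr0 //; try exact/GP/std_diag_GT.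
by move=> /std_diag_inj E; rewrite E eqxx in ki.
Qed.
End Counting.

(** * Row sums of the vectors v and r *)

Section Lattice.
Variable n : nat.
Implicit Types (u v y : lattice n) (S T U X : {set 'I_n}) (Y Z : proper_sets n) (a b : quad n).

Definition lat (x : ex n) : lattice n := [ffun Y => Posz (x Y)].

Lemma row_sumD p q u v : row_sum p q (u + v) = row_sum p q u + row_sum p q v.
Proof. by rewrite /row_sum -big_split; apply: eq_bigr => Y _; rewrite ffunE. Qed.

Lemma row_sumN p q u : row_sum p q (- u) = - row_sum p q u.
Proof. by rewrite /row_sum -sumrN; apply: eq_bigr => Y _; rewrite ffunE. Qed.

Lemma row_sum0 p q : row_sum p q (0 : lattice n) = 0.
Proof. by rewrite /row_sum big1 // => Y _; rewrite ffunE. Qed.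

Lemma row_sum_sum p q (I : Type) (r : seq I) (F : I -> lattice n) :
  row_sum p q (\sum_(k <- r) F k) = \sum_(k <- r) row_sum p q (F k).
Proof.
elim: r => [|k r IH]; first by rewrite !big_nil row_sum0.
by rewrite !big_cons row_sumD IH.
Qed.

Lemma row_sumMn p q u k : row_sum p q (u *+ k) = row_sum p q u *+ k.
Proof. by elim: k => [|k IH]; rewrite ?mulr0n ?row_sum0 // !mulrS row_sumD IH. Qed.

Lemma row_sumMz p q u (k : int) : row_sum p q (u *~ k) = row_sum p q u *~ k.
Proof.
by case: k => k; rewrite ?NegzE ?mulrNz ?row_sumN -?pmulrn row_sumMn.
Qed.

Lemma row_sum_lat p q x : row_sum p q (lat x) = Posz (rsum x p q).
Proof.
by rewrite /rsum (big_morph Posz PoszD (erefl _)); apply: eq_bigr => Y _; rewrite ffunE.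
Qed.

Lemma row_sum_evec p q S : (0 < #|S| < n)%N ->
  row_sum p q (evec S) = ((p <= #|S :&: seg n q|)%N : nat).
Proof.
rewrite -proper_cardE => Sp; pose Y : proper_sets n := Sub S Sp.
rewrite /row_sum big_mkcond (bigD1 Y) //= big1 ?addr0 => [|Z ZY].
  by rewrite ffunE /= eqxx; case: ifP.
rewrite ffunE; have /negPf -> : val Z != S by apply: contraNneq ZY => E; apply/eqP/val_inj.
by rewrite if_same.
Qed.

Lemma cnt_sum S q : #|S :&: seg n q| = (\sum_z (z \in S) * (z < q))%N.
Proof.
rewrite -sum1_card big_mkcond; apply: eq_bigr => z _; rewrite !inE.
by case: (z \in S); case: (z < q)%N.
Qed.

Lemma cnt_seg i q : (i <= n)%N -> (\sum_(z < n) (z < i) * (z < q) = minn i q)%N.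
Proof.
move=> i_n; rewrite -[RHS](@sum_ltn_lead (minn i q) n); last by rewrite geq_min i_n.
by apply: eq_bigr => z _; rewrite leq_min; case: (z < i)%N; case: (z < q)%N.
Qed.

Lemma cnt_one (c : 'I_n) q : (\sum_(z < n) (z == c) * (z < q) = (c < q))%N.
Proof.
rewrite (bigD1 c) //= eqxx mul1n big1 ?addn0 // => z /negPf ->.
by rewrite mul0n.
Qed.

Lemma cnt1 (i c : 'I_n) X q : (i <= c)%N -> (forall z : 'I_n, z \in X -> (c < z)%N) ->
  #|(seg n i :|: [set c] :|: X) :&: seg n q| =
  (minn i q + (c < q) + #|X :&: seg n q|)%N.
Proof.
move=> ic cX; rewrite !cnt_sum -(cnt_seg q (ltnW (ltn_ord i))) -(cnt_one c q) -!big_split /=.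
apply: eq_bigr => z _; rewrite !inE -!mulnDl; congr muln.
have := cX z; case: (z \in X) => [/(_ isT)|_]; case: eqP => [->|/eqP zc] /=; try lia.
Qed.

Lemma cnt2 (i c e : 'I_n) X q : (i <= c)%N -> (c < e)%N -> (forall z : 'I_n, z \in X -> (e < z)%N) ->
  #|(seg n i :|: [set c; e] :|: X) :&: seg n q| =
  (minn i q + (c < q) + (e < q) + #|X :&: seg n q|)%N.
Proof.
move=> ic ce cX; rewrite !cnt_sum -(cnt_seg q (ltnW (ltn_ord i))) -(cnt_one c q) -(cnt_one e q).
rewrite -!big_split /=; apply: eq_bigr => z _; rewrite !inE -!mulnDl; congr muln.
have := cX z; rewrite -!val_eqE /=; case: (z \in X) => [/(_ isT)|_]; case: eqP => zc; case: eqP => ze /=; lia.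
Qed.

Lemma cnt_full S : #|S :&: seg n n| = #|S|.
Proof. by congr (#|pred_of_set _|); apply/setP => z; rewrite !inE ltn_ord andbT. Qed.

Lemma proper_witness S (w z : 'I_n) : w \in S -> z \notin S -> (0 < #|S| < n)%N.
Proof.
move=> wS zS; apply/andP; split; first by apply/card_gt0P; exists w.
rewrite -[n in (_ < n)%N]card_ord; apply: proper_card; apply/properP; split.
  exact/fintype.subsetP.
by exists z.
Qed.

Definition base_col a : {set 'I_n} := let: (i, j, x, X) := val a in (seg n i :|: [set i] :|: X)%SET.
(** This column set determines the quadruple ([top_col_inj]), and it has the
    largest excess of the six ([excess_other]); so v can be used to eliminate it. *)
Definition top_col a : {set 'I_n} := let: (i, j, x, X) := val a in (seg n i :|: [set j; x] :|: X)%SET.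

Definition minus_cols a : {set 'I_n} * {set 'I_n} :=
  let: (i, j, x, X) := val a in
  (seg n i :|: [set j] :|: X, seg n i :|: [set i; x] :|: X)%SET.

Definition zero_cols a : {set 'I_n} * {set 'I_n} :=
  let: (i, j, x, X) := val a in
  (seg n i :|: [set x] :|: X, seg n i :|: [set i; j] :|: X)%SET.

Lemma v_plusE a : v_plus a = evec (base_col a) + evec (top_col a).
Proof. by case: a => [[[[i j] x] X] aP]. Qed.

Lemma v_minusE a : v_minus a = evec (minus_cols a).1 + evec (minus_cols a).2.
Proof. by case: a => [[[[i j] x] X] aP]. Qed.

Lemma v_zeroE a : v_zero a = evec (zero_cols a).1 + evec (zero_cols a).2.
Proof. by case: a => [[[[i j] x] X] aP]. Qed.

Definition other_cols a : seq {set 'I_n} :=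
  [:: base_col a; (minus_cols a).1; (minus_cols a).2; (zero_cols a).1; (zero_cols a).2].

Definition properS S := (0 < #|S| < n)%N.

Lemma cols_proper a : properS (top_col a) && all properS (other_cols a).
Proof.
case: a => [[[[i j] x] X] aP]; have /and3P [ij jx /forall_inP xX] := aP.
rewrite /other_cols /top_col /base_col /minus_cols /zero_cols /=.
have ix := ltn_trans ij jx.
have iN : i \in X = false by apply/negP => /xX; lia.
have jN : j \in X = false by apply/negP => /xX; lia.
have xN : x \in X = false by apply/negP => /xX; lia.
have ij' : (i == j) = false by apply/negP => /eqP E; rewrite E ltnn in ij.
have ix' : (i == x) = false by apply/negP => /eqP E; rewrite E ltnn in ix.
have jx' : (j == x) = false by apply/negP => /eqP E; rewrite E ltnn in jx.
have ji' : (j < i)%N = false by lia.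
have xi' : (x < i)%N = false by lia.
have ji2 : (j == i) = false by rewrite eq_sym.
have xi2 : (x == i) = false by rewrite eq_sym.
have xj2 : (x == j) = false by rewrite eq_sym.
have E := (eqxx, orbT, ltnn, iN, jN, xN, ij', ix', jx', (ji', xi', ji2, xi2, xj2)).
apply/and5P; split; [| | | |apply/and3P; split=> //].
- by apply: (@proper_witness _ j i); rewrite !inE ?E.
- by apply: (@proper_witness _ i j); rewrite !inE ?E.
- by apply: (@proper_witness _ j i); rewrite !inE ?E.
- by apply: (@proper_witness _ i j); rewrite !inE ?E.
- by apply: (@proper_witness _ x i); rewrite !inE ?E.
- by apply: (@proper_witness _ i x); rewrite !inE ?E.
Qed.

(** The two columns of v_plus and of v_minus have the same numbers of elements
    below q, up to order. Those of v_zero differ only if j < q <= x, where they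
    are i and i + 2 instead of i + 1 twice. *)
Lemma quad_rows a p q : (0 < p)%N ->
  row_sum p q (v_plus a) = row_sum p q (v_minus a) /\
  row_sum p q (v_zero a) - row_sum p q (v_plus a) =
    let: (i, j, x, X) := val a in
    Posz ((j < q) && (q <= x))%N * (Posz (p == i.+2) - Posz (p == i.+1)).
Proof.
move=> p0; have /andP [tp /allP op] := cols_proper a.
have tc : (0 < #|top_col a| < n)%N by [].
have oc S : S \in other_cols a -> (0 < #|S| < n)%N by apply: op.
rewrite v_plusE v_minusE v_zeroE !row_sumD !row_sum_evec ?tc ?oc ?inE ?eqxx ?orbT //.
case: a {tp op tc oc} => [[[[i j] x] X] aP]; have /and3P [ij jx /forall_inP xX] := aP.
rewrite /base_col /top_col /minus_cols /zero_cols /=.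
have ix := ltn_trans ij jx.
have iX (z : 'I_n) : z \in X -> (i < z)%N by move=> /xX; lia.
have jX (z : 'I_n) : z \in X -> (j < z)%N by move=> /xX; lia.
rewrite !cnt1 ?cnt2 ?(ltnW ij) ?(ltnW ix) //.
have hX : (q <= x)%N -> #|X :&: seg n q| = 0%N.
  move=> qx; apply/eqP; rewrite cards_eq0; apply/eqP/setP => z; rewrite !inE.
  by case: (boolP (z \in X)) => //= /xX; lia.
move: (#|X :&: seg n q|) hX => h hX.
have [xq|qx] := ltnP x q; last rewrite hX //.
  clear -p0 ij jx ix xq; have iq := ltn_trans ix xq; have jq := ltn_trans jx xq.
  by rewrite jq iq (minn_idPl (ltnW iq)) /=; split; [congr (_ + _)%R|]; lia.
clear -p0 ij jx ix qx.
have [jq|qj] := ltnP j q.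
  have iq := ltn_trans ij jq.
  by rewrite iq (minn_idPl (ltnW iq)) /=; split; lia.
by have [iq|qi] := ltnP i q; split; lia.
Qed.

Lemma tv_rows (t : {ffun quad n -> int}) p q : (0 < p)%N -> row_sum p q (tv t) = 0.
Proof.
move=> p0; rewrite /tv row_sum_sum big1 // => a _.
by rewrite row_sumMz row_sumD row_sumN (quad_rows a q p0).1 subrr mul0rz.
Qed.

(** A functional that vanishes on the v and is at least 1 on the r, so that it
    bounds the multiplicities of the r in a given vector. *)
Definition height u : int := \sum_(q < n.+1) \sum_(1 <= p < n.+1) Posz p * row_sum p q u.

Lemma heightD u v : height (u + v) = height u + height v.
Proof.
rewrite /height -big_split; apply: eq_bigr => q _; rewrite -big_split; apply: eq_bigr => p _.
by rewrite row_sumD mulrDr.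
Qed.


Lemma height_tv (t : {ffun quad n -> int}) : height (tv t) = 0.
Proof.
rewrite /height big1 // => q _; rewrite big_nat big1 // => p /andP [p0 _].
by rewrite tv_rows // mulr0.
Qed.

Lemma height_r a : 1 <= height (v_zero a - v_plus a).
Proof.
have E q p : (0 < p)%N -> row_sum p q (v_zero a - v_plus a) = let: (i, j, x, X) := val a in
    Posz ((j < q) && (q <= x))%N * (Posz (p == i.+2) - Posz (p == i.+1)).
  by move=> p0; rewrite -(quad_rows a q p0).2 row_sumD row_sumN.
rewrite /height; under eq_bigr do under eq_big_nat => p /andP [p0 _] do rewrite E //.
case: a E => [[[[i j] x] X] aP] _ /=; have /and3P [ij jx _] := aP.
have H (q : nat) : \sum_(1 <= p < n.+1) Posz p * (Posz ((j < q) && (q <= x))%N * (Posz (p == i.+2) - Posz (p == i.+1)))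
   = Posz ((j < q) && (q <= x))%N.
  have i2 : (i.+1 < n)%N by have := ltn_ord x; lia.
  rewrite (big_cat_nat (n := i.+1)) //= ?(ltnW i2) //; last by lia.
  rewrite big_nat big1 => [|p /andP [_ pi]]; last first.
    by rewrite !(ltn_eqF) ?subrr ?mulr0 // ltnW.
  rewrite add0r big_ltn ?ltnS ?(ltnW i2) // big_ltn ?ltnS // big_nat big1 => [|p /andP [pi _]]; last first.
    by rewrite !(gtn_eqF) ?subrr ?mulr0 // ltnW.
  rewrite eqxx !eqn_leq !ltnn leqnn /= !andbF /=; case: (_ && _); lia.
under eq_bigr do rewrite H.
rewrite (bigD1 (widen_ord (leqnSn n) x)) //= jx leqnn /= lerDl.
by apply: sumr_ge0 => q _.
Qed.

Lemma height_sr (s : {ffun quad n -> nat}) : (\sum_a s a)%:Z <= height (sr s).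
Proof.
have height0 : height 0 = 0.
  by rewrite /height big1 // => q _; rewrite big1 // => p _; rewrite row_sum0 mulr0.
have heightMn u k : height (u *+ k) = height u *+ k.
  by elim: k => [|k IH]; rewrite ?mulr0n // !mulrS heightD IH.
have -> : height (sr s) = \sum_a height (v_zero a - v_plus a) *+ s a.
  by rewrite /sr; elim/big_rec2: _ => [|a h u _ <-] //; exact: (etrans (heightD _ _) (f_equal (fun z => z + height u) (heightMn _ _))).
rewrite (big_morph Posz PoszD (erefl _)); apply: ler_sum => a _.
by rewrite -[leRHS]mulr_natr natz ler_peMl ?height_r.
Qed.
End Lattice.

(** * Elimination by excess, and a base of B *)

Section Columns.
Variable n : nat.
Implicit Types (u v y : lattice n) (S T U X : {set 'I_n}) (Y Z : proper_sets n) (a b : quad n).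

(** The number of elements of S above its first gap. *)
Definition excess S := #|[set z in S | ~~ (seg n z \subset S)]|.

Lemma excess_le S U (i : nat) : (seg n i \subset S) -> (S \subset seg n i :|: U)%SET -> (excess S <= #|U|)%N.
Proof.
move=> iS SU; apply/subset_leq_card/fintype.subsetP => z; rewrite inE => /andP [zS zN].
have := fintype.subsetP SU _ zS; rewrite !inE => /orP [zi|//].
case/negP: zN; apply: fintype.subset_trans iS; apply/fintype.subsetP => w; rewrite !inE.
by move=> /ltn_trans; apply.
Qed.

Lemma excess_ge S U (i : 'I_n) : i \notin S -> (U \subset S) -> (forall z : 'I_n, z \in U -> (i < z)%N) ->
  (#|U| <= excess S)%N.
Proof.
move=> iS US iU; apply/subset_leq_card/fintype.subsetP => z zU; rewrite inE (fintype.subsetP US) //=.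
by apply: contra iS => /fintype.subsetP; apply; rewrite inE iU.
Qed.

Lemma excess_le_n S : (excess S <= n)%N.
Proof. exact: card_set_ord. Qed.

Lemma segS_sub S (i : 'I_n) : (seg n i \subset S) -> i \in S -> (seg n i.+1 \subset S).
Proof.
move=> /fintype.subsetP iS ii; apply/fintype.subsetP => z; rewrite inE ltnS leq_eqVlt => /orP [/eqP zi|zi].
  by rewrite (val_inj zi).
by rewrite iS ?inE.
Qed.

Lemma excess_other a S : S \in other_cols a -> (excess S < excess (top_col a))%N.
Proof.
case: a => [[[[i j] x] X] aP]; have /and3P [ij jx /forall_inP xX] := aP => SO.
have ix := ltn_trans ij jx.
have jN : j \notin X by apply/negP => /xX; lia.
have xN : x \notin X by apply/negP => /xX; lia.
have top : (#|X|.+2 <= excess (top_col (exist _ (i, j, x, X) aP)))%N.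
  have -> : (#|X|.+2 = #|j |: (x |: X)|)%N.
    rewrite !cardsU1 xN inE (negPf jN) orbF inE.
    by have /negPf -> : j != x by apply/eqP => E; rewrite E ltnn in jx.
  apply: (@excess_ge _ _ i) => /=.
  - rewrite !inE ltnn /= !negb_or -!val_eqE /= neq_ltn ij neq_ltn ix /=.
    by apply/negP => /xX; lia.
  - by apply/fintype.subsetP => z; rewrite !inE -!orbA => /or3P [] ->; rewrite ?orbT.
  - by move=> z; rewrite !inE => /or3P [/eqP ->|/eqP ->|/xX]; lia.
apply: leq_trans top.
have cU1 (c : 'I_n) : (#|c |: X| <= #|X|.+1)%N by rewrite cardsU1; case: (_ \notin _).
have E (c : 'I_n) T : (T = seg n i :|: [set c] :|: X)%SET -> (excess T <= #|X|.+1)%N.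
  move=> ->; apply: leq_trans (cU1 c); apply: (@excess_le _ _ i).
    by rewrite -finset.setUA; apply: finset.subsetUl.
  by rewrite finset.setUA.
have E2 (c : 'I_n) T : (T = seg n i :|: [set i; c] :|: X)%SET -> (excess T <= #|X|.+1)%N.
  move=> ->; apply: leq_trans (cU1 c); apply: (@excess_le _ _ i.+1).
    apply: segS_sub; last by rewrite !inE eqxx ?orbT.
    by rewrite -finset.setUA; apply: finset.subsetUl.
  apply/fintype.subsetP => z; rewrite !inE -!orbA ltnS.
  by case/or4P => [/ltnW ->|/eqP ->|->|->]; rewrite ?leqnn ?orbT.
move: SO; rewrite /other_cols /= !inE ltnS => /or4P [|||/orP []] /eqP ->;
  by [apply: E|apply: E2].
Qed.

Lemma top_col_inj : injective (@top_col n).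
Proof.
move=> [[[[i j] x] X] aP] [[[[i' j'] x'] X'] bP] /= E; apply: val_inj => /=.
have /and3P [ij jx /forall_inP xX] := aP; have /and3P [ij' jx' /forall_inP xX'] := bP.
have H (z : 'I_n) : [|| (z < i)%N, z == j, z == x | z \in X] = [|| (z < i')%N, z == j', z == x' | z \in X'].
  by have /setP /(_ z) := E; rewrite !inE -!orbA.
have xXb (z : 'I_n) : (z \in X) ==> (x < z)%N by apply/implyP => /xX.
have xXb' (z : 'I_n) : (z \in X') ==> (x' < z)%N by apply/implyP => /xX'.
have ii : i = i'.
  apply: val_inj => /=; have := H i; have := H i'; have := xXb i'; have := xXb' i; have := xXb i; have := xXb' i'.
  rewrite -!val_eqE /=; clear -ij jx ij' jx'.
  by case: (i \in X); case: (i' \in X); case: (i \in X'); case: (i' \in X'); rewrite ?orbT ?orbF /=; lia.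
subst i'; have jj : j = j'.
  apply: val_inj => /=; have := H j; have := H j'; have := xXb j'; have := xXb' j; have := xXb j; have := xXb' j'.
  rewrite -!val_eqE /= !eqxx ?orbT; clear -ij jx ij' jx'.
  by case: (j \in X); case: (j' \in X); case: (j \in X'); case: (j' \in X'); rewrite ?orbT ?orbF /=; lia.
subst j'; have xx : x = x'.
  apply: val_inj => /=; have := H x; have := H x'; have := xXb x'; have := xXb' x; have := xXb x; have := xXb' x'.
  rewrite -!val_eqE /= !eqxx ?orbT; clear -ij jx ij' jx'.
  by case: (x \in X); case: (x' \in X); case: (x \in X'); case: (x' \in X'); rewrite ?orbT ?orbF /=; lia.
subst x'; congr (_, _); apply/setP => z.
have := H z; have := xXb z; have := xXb' z.
rewrite -!val_eqE /=; clear -ij jx ij' jx'.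
by case: (z \in X); case: (z \in X') => //=; lia.
Qed.

Definition seed S := exists i j : 'I_n, (i <= j)%N /\ S = (seg n i :|: [set j])%SET.

(** With i the first gap, j < x the first elements above it, and X the rest, S is
    the column set of (i, j, x, X). If one of j, x is missing, S is a seed. *)
Lemma top_or_seed S : properS S -> (exists a, S = top_col a) \/ seed S.
Proof.
move=> /andP [S0 Sn].
have [i0 i0S] : exists i : 'I_n, i \notin S.
  apply/existsP; rewrite -negb_forall; apply: contraL Sn => /forallP allS.
  have -> : S = finset.setT by apply/setP => z; rewrite inE allS.
  by rewrite cardsT card_ord ltnn.
case: (@arg_minnP _ i0 (fun i => i \notin S) val i0S) => i iS imin.
have Si (z : 'I_n) : (z < i)%N -> z \in S.
  by move=> zi; apply: contraLR zi => /imin; rewrite -leqNgt.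
have neqi (z : 'I_n) : z \in S -> (z < i)%N = false -> (i < z)%N.
  move=> zS zi; rewrite ltn_neqAle leqNgt zi andbT.
  by apply: contraNneq iS => E; rewrite (val_inj E).
case: (pickP (fun z : 'I_n => (z \in S) && (i < z)%N)) => [j0 j0P|noj]; last first.
  right; have i1 : (0 < i)%N.
    have /card_gt0P [z zS] := S0; have := noj z; rewrite zS /= => iz.
    rewrite lt0n; apply/eqP => i00; have := neqi z zS; rewrite iz i00 ltn0.
    by move/(_ (erefl _)).
  have i1n : (i.-1 < n)%N by have := ltn_ord i; lia.
  exists (Ordinal i1n), (Ordinal i1n); split=> //; apply/setP => z; rewrite !inE -val_eqE /=.
  have -> : (z < i.-1)%N || (z == i.-1 :> nat) = (z < i)%N.
    by rewrite orbC -leq_eqVlt -ltnS prednK.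
  apply/idP/idP => [zS|/Si //]; have := noj z; rewrite zS /=.
  by apply: contraFT => /negPf /(neqi _ zS).
case: (@arg_minnP _ j0 (fun z => (z \in S) && (i < z)%N) val j0P) => j /andP [jS ij] jmin.
case: (pickP (fun z : 'I_n => (z \in S) && (j < z)%N)) => [x0 x0P|nox]; last first.
  right; exists i, j; split; first exact: ltnW.
  apply/setP => z; rewrite !inE; apply/idP/idP => [zS|/orP [/Si|/eqP ->] //].
  have [//|zi] := boolP (z < i)%N; have iz := neqi z zS (negPf zi).
  have /= := jmin z; rewrite zS iz => /(_ isT) jz; have := nox z; rewrite zS /=.
  by move/negbT; rewrite -leqNgt -val_eqE /= eqn_leq jz andbT.
case: (@arg_minnP _ x0 (fun z => (z \in S) && (j < z)%N) val x0P) => x /andP [xS jx] xmin.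
left; have aP : is_quad (i, j, x, [set z in S | (x < z)%N]%SET).
  by apply/and3P; split=> //; apply/forall_inP => z; rewrite inE => /andP [].
exists (exist (@is_quad n) _ aP); rewrite /top_col /=; apply/setP => z; rewrite !inE -!orbA.
apply/idP/idP => [zS|/or4P [/Si|/eqP ->|/eqP ->|/andP []] //].
have [//|zi] := boolP (z < i)%N; have iz := neqi z zS (negPf zi).
have /= := jmin z; rewrite zS iz => /(_ isT) jz.
have := xmin z; rewrite zS /= -!val_eqE /= => xz.
move: jz; rewrite leq_eqVlt => /orP [/eqP ->|jz]; first by rewrite eqxx.
by move: (xz jz); rewrite leq_eqVlt => /orP [/eqP ->|->]; rewrite ?eqxx ?orbT.
Qed.

(** The other five columns of a quadruple have smaller excess than the top, so the
    v form a unitriangular system on the tops. *)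
Lemma excess_plus a b : (excess (top_col a) <= excess (top_col b))%N ->
  forall Y, val Y = top_col b -> (v_plus a - v_minus a) Y = (a == b)%:R.
Proof.
move=> ab Y YE; rewrite v_plusE v_minusE !ffunE YE.
have neq S : S \in other_cols a -> (top_col b == S) = false.
  move=> /excess_other Sa; apply/negP => /eqP E.
  by move: (leq_trans Sa ab); rewrite E ltnn.
have -> : (top_col b == top_col a) = (a == b) by apply/eqP/eqP => [/top_col_inj ->|->].
rewrite !neq ?inE ?eqxx ?orbT //.
by case: (a == b).
Qed.

Definition top_ps a : proper_sets n :=
  Sub (top_col a) (etrans (@proper_cardE n (top_col a)) (proj1 (andP (cols_proper a)))).

Lemma tv_at (t : {ffun quad n -> int}) N b : (N <= excess (top_col b))%N ->
  (forall a, t a != 0 -> (excess (top_col a) <= N)%N) -> tv t (top_ps b) = t b.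
Proof.
move=> bN tN; rewrite /tv sum_ffunE (bigD1 b) //= ffunMzE (excess_plus (leqnn _)) // eqxx.
rewrite intz big1 ?addr0 // => a ab; rewrite ffunMzE.
have [->|/tN ta] := eqVneq (t a) 0; first by rewrite mulr0z.
by rewrite (excess_plus (leq_trans ta bN)) // (negPf ab) mul0rz.
Qed.

Lemma tv_eq0 (t : {ffun quad n -> int}) : tv t = 0 -> t = 0.
Proof.
move=> t0; apply/ffunP => a; rewrite [RHS]ffunE; apply/eqP/negPn/negP => ta.
case: (@arg_maxnP _ a (fun a => t a != 0) (fun a => excess (top_col a)) ta) => b tb bmax.
by case/eqP: tb; rewrite -(@tv_at t (excess (top_col b)) b) // t0 ffunE.
Qed.

Lemma tvD (t t' : {ffun quad n -> int}) : tv (t + t') = tv t + tv t'.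
Proof. by rewrite /tv -big_split; apply: eq_bigr => a _; rewrite ffunE mulrzDr. Qed.

(** Gaussian elimination, by decreasing excess. *)
Lemma tv_clear y : exists t : {ffun quad n -> int}, forall a, (y - tv t) (top_ps a) = 0.
Proof.
have H N : forall y, (forall a, (N <= excess (top_col a))%N -> y (top_ps a) = 0) ->
    exists t : {ffun quad n -> int}, forall a, (y - tv t) (top_ps a) = 0.
  elim: N => [|N IH] {}y yN.
    by exists 0 => a; rewrite /tv big1 ?subr0 ?yN // => b _; rewrite ffunE mulr0z.
  pose t := [ffun a => if excess (top_col a) == N then y (top_ps a) else 0] : {ffun quad n -> int}.
  have [a Na|t' t'E] := IH (y - tv t).
    rewrite ffunE [X in _ + X]ffunE (@tv_at t N a) // => [|b].
      rewrite ffunE; case: eqP => [_|/eqP aN]; first by rewrite subrr.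
      by rewrite subr0 yN // ltn_neqAle eq_sym aN.
    by rewrite ffunE; case: ifP => [/eqP -> //|]; rewrite eqxx.
  by exists (t + t') => a; rewrite tvD opprD addrA.
by apply: (H n.+1 y) => a; rewrite leqNgt ltnS excess_le_n.
Qed.

(** Downward induction on the size i + 1 and upward induction on the last element j
    of a seed: among the seeds left, only seg i + {j} has i + 1 elements below
    j + 1, so that its coefficient is a row sum. *)
Lemma seed_rows y : (forall a, y (top_ps a) = 0) -> in_B y -> y = 0.
Proof.
move=> yt yB.
have yseed Y : y Y != 0 -> seed (val Y).
  move=> yY; have := valP Y; rewrite proper_cardE => /top_or_seed [[a aE]|//].
  by case/eqP: yY; rewrite -(yt a); congr (y _); apply: val_inj.
have card_seed (i j : 'I_n) q : (i <= j)%N -> #|(seg n i :|: [set j]) :&: seg n q| = (minn i q + (j < q))%N.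
  move=> ij; rewrite -[(_ :|: _)%SET]finset.setU0 cnt1 // => [|z]; last by rewrite inE.
  by rewrite finset.set0I cards0 addn0.
suff H k (i j : 'I_n) Y : (n <= i + k)%N -> (i <= j)%N -> val Y = (seg n i :|: [set j])%SET -> y Y = 0.
  apply/ffunP => Y; rewrite [RHS]ffunE; apply/eqP/negPn/negP => yY; case/eqP: (yY).
  by have [i [j [ij YE]]] := yseed Y yY; apply: (H n i j Y) => //; rewrite leq_addl.
elim: k i j Y => [|k IHk] i j Y nik ij YE; first by move: nik (ltn_ord i); lia.
have [w] := ubnP j; elim: w j Y ij YE => // w IHw j Y ij YE jw.
have := yB i.+1 j.+1 (ltn0Sn i) ij (ltn_ord j); rewrite /row_sum big_mkcond (bigD1 Y) //=.
have minij : minn i j.+1 = i by apply/minn_idPl; apply: leqW.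
rewrite YE card_seed // minij ltnSn addn1 leqnn big1 ?addr0 // => Z ZY.
apply/eqP; case: ifP => // iZ; apply/negPn/negP => yZ; case/eqP: (yZ).
have [i' [j' [ij' ZE]]] := yseed Z yZ.
move: iZ; rewrite ZE card_seed // => iZ.
have [ii|ii] := ltnP i i'; first by apply: (IHk i' j' Z) => //; lia.
have iE : i' = i by apply: val_inj => /=; move: iZ; rewrite /minn; case: ifP; case: (j' < j.+1)%N; lia.
have jj : (j' <= j)%N by move: iZ; rewrite /minn; case: ifP; case: (ltnP j' j.+1); lia.
subst i'; apply: (IHw j' Z) => //.
suff : j' != j :> nat by lia.
by apply: contraNneq ZY => /val_inj jE; apply/eqP/val_inj; rewrite /= YE ZE jE.
Qed.

Lemma in_BP y : in_B y <-> exists t, y = tv t.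
Proof.
split=> [yB|[t ->] p q p1 _ _]; last exact: tv_rows.
have [t tE] := tv_clear y; exists t; apply/eqP; rewrite -subr_eq0; apply/eqP/seed_rows => // p q p1 pq qn.
by rewrite row_sumD row_sumN tv_rows // subr0 yB.
Qed.

Lemma tv_inj : injective (@tv n).
Proof.
move=> t t' tt; apply/eqP; rewrite -subr_eq0; apply/eqP/tv_eq0.
apply/eqP; rewrite -(subrr (tv t')) -{1}tt; apply/eqP.
rewrite tvD; congr (_ + _); apply/eqP; rewrite -[_ == _]subr_eq0 opprK -tvD addNr.
by rewrite /tv big1 // => b _; rewrite ffunE mulr0z.
Qed.
End Columns.

(** * The coefficient function of F *)

Section Coefficients.
Variable n : nat.
Variable K : numFieldType.
Local Notation SS := {ffun quad n -> nat}.
Local Notation TT := {ffun quad n -> int}.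
Implicit Types (u v w y : lattice n) (s : SS) (t : TT) (a b : quad n).

Definition coef1 (k : nat) (z : int) : K :=
  (-1) ^+ k / k`!%:R * (\prod_(1 <= l < k.+1) (z + l%:Z))%:~R.

Lemma coef10 z : coef1 0 z = 1.
Proof. by rewrite /coef1 big_geq // expr0 fact0 divr1 mulr1. Qed.

(** Up to sign, coef1 k z is the binomial coefficient of z + k over k. *)
Lemma coef1_pascal k z : coef1 k.+1 z - coef1 k.+1 (z - 1) + coef1 k z = 0.
Proof.
rewrite /coef1 big_nat_recr //= [X in _ - _ / _ * X%:~R + _]big_nat_recl //=.
have -> : \prod_(1 <= l < k.+1) (z - 1 + l.+1%:Z) = \prod_(1 <= l < k.+1) (z + l%:Z).
  by apply: eq_bigr => l _; rewrite -addn1 PoszD; ring.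
have -> : z - 1 + 1%:Z = z by ring.
move: (\prod_(_ <= _ < _) _) => P; rewrite factS natrM !rmorphM rmorphD /= exprS.
have k0 : k.+1%:R != 0 :> K by rewrite pnatr_eq0.
have f0 : k`!%:R != 0 :> K by rewrite pnatr_eq0 -lt0n fact_gt0.
have -> : (k.+1%:Z)%:~R = k.+1%:R :> K by [].
by move: (z%:~R) (P%:~R) ((-1) ^+ k) => z' P' e; field; rewrite f0 nat1r k0.
Qed.

Definition coef s t : K := \prod_a coef1 (s a) (t a).

Definition pred_s s a : SS := [ffun b => s b - (b == a)]%N.
Definition succ_s s a : SS := [ffun b => s b + (b == a)]%N.
Definition pred_t t a : TT := [ffun b => t b - (b == a)%:R].

Lemma coefD1 a s t : coef s t = coef1 (s a) (t a) * \prod_(b | b != a) coef1 (s b) (t b).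
Proof. by rewrite /coef (bigD1 a). Qed.

Lemma coef_pascal s t a :
  coef s t - coef s (pred_t t a) + (if (0 < s a)%N then coef (pred_s s a) t else 0) = 0.
Proof.
rewrite !(coefD1 a) !ffunE eqxx.
under [X in _ - _ * X]eq_bigr => b /negPf ba do rewrite ffunE ba subr0.
under [X in if _ then _ * X else _]eq_bigr => b /negPf ba do rewrite ffunE ba subn0.
case: (s a) => [|k] /=; first by rewrite !coef10 addr0 subrr.
by rewrite subn1 /= -mulrBl -mulrDl coef1_pascal mul0r.
Qed.

(** Only meaningful on B, where it inverts tv. *)
Definition tinv w : TT := xget 0 [set t | tv t = w]%classic.

Lemma tvK t : tinv (tv t) = t.
Proof. by apply: tv_inj; rewrite /tinv; case: xgetP => [t' _ //|/(_ t) /=]; case. Qed.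

Lemma tinvK w : in_B w <-> tv (tinv w) = w.
Proof. by split=> [/in_BP [t ->]|wE]; [rewrite tvK|apply/in_BP; exists (tinv w)]. Qed.

(** The term of s in the coefficient function, as a function of w = u + sr. *)
Definition psi s w : K := if tv (tinv w) == w then coef s (tinv w) else 0.

Lemma psi_tv s t : psi s (tv t) = coef s t.
Proof. by rewrite /psi tvK eqxx. Qed.

Lemma psi_neq0 s w : psi s w != 0 -> in_B w.
Proof. by rewrite /psi; case: ifP => [/eqP /tinvK //|]; rewrite eqxx. Qed.

Lemma tv_pred t a : tv (pred_t t a) = tv t - (v_plus a - v_minus a).
Proof.
rewrite /tv (bigD1 a) //= (eq_bigr (fun b => (v_plus b - v_minus b) *~ t b)) => [|b /negPf ba]; last first.
  by rewrite ffunE ba subr0.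
by rewrite [in RHS](bigD1 a) //= ffunE eqxx mulrzBr mulr1z addrAC.
Qed.

Lemma psi_pascal s w a :
  psi s w - psi s (w - (v_plus a - v_minus a)) + (if (0 < s a)%N then psi (pred_s s a) w else 0) = 0.
Proof.
have [/in_BP [t ->]|wB] := pselect (in_B w).
  by rewrite -tv_pred !psi_tv coef_pascal.
have nz s' w' : ~ in_B w' -> psi s' w' = 0.
  by move=> w'B; apply/eqP/negPn/negP => /psi_neq0.
rewrite !nz ?if_same ?subr0 ?addr0 // => wB'; apply: wB => p q p1 pq qn.
have := wB' p q p1 pq qn; have [E _] := quad_rows a q p1.
by rewrite !(row_sumD, row_sumN) E subrr subr0.
Qed.

(** The coefficient of z^x / x! in F_gamma is the value of Phi at x - gamma. *)
Definition Phi u : K := \sum_(s \in [set: SS]%classic) psi s (u + sr s).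

(** By [psi_height], for each u only those s contribute to Phi u that lie in a
    large box. *)
Definition boxes N : seq SS :=
  [seq [ffun a => f a : nat] | f : {ffun quad n -> 'I_N.+1} <- enum {ffun quad n -> 'I_N.+1}].

Lemma boxes_uniq N : uniq (boxes N).
Proof.
rewrite map_inj_uniq ?enum_uniq // => f g /ffunP fg.
by apply/ffunP => X; apply: val_inj; have := fg X; rewrite !ffunE.
Qed.

Lemma mem_boxes N s : (\sum_a s a <= N)%N -> s \in boxes N.
Proof.
move=> sN; apply/mapP; exists [ffun a => inord (s a)]; first by rewrite mem_enum.
apply/ffunP => a; rewrite !ffunE inordK // ltnS (leq_trans _ sN) //.
by rewrite (bigD1 a) //= leq_addr.
Qed.

Lemma sum_boxes N (f : SS -> K) : (forall s, f s != 0 -> (\sum_a s a <= N)%N) ->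
  \sum_(s \in [set: SS]%classic) f s = \sum_(s <- boxes N) f s.
Proof.
move=> fN; rewrite (fsbigE (boxes N)) ?boxes_uniq // => [|s _ sN].
  by apply: eq_bigl => s; rewrite in_setT.
by apply/eqP; apply: contraNT sN => /fN /mem_boxes.
Qed.

Lemma psi_height s u : psi s (u + sr s) != 0 -> (\sum_a s a)%:Z <= - height u.
Proof.
move=> /psi_neq0 /in_BP [t tE]; apply: le_trans (height_sr s) _.
by have := height_tv t; rewrite -tE heightD => /eqP; rewrite addr_eq0 => /eqP ->; rewrite opprK.
Qed.

Lemma Phi_boxes N u : - height u <= N%:Z -> Phi u = \sum_(s <- boxes N) psi s (u + sr s).
Proof. by move=> uN; apply: sum_boxes => s /psi_height sN; have := le_trans sN uN. Qed.

Lemma Phi_neq0 u : Phi u != 0 -> exists s, in_B (u + sr s).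
Proof.
rewrite (@Phi_boxes `|height u|%N); last by rewrite abszE -normrN ler_norm.
move=> H; apply: contrapT => ns; case/eqP: H; rewrite big1 // => s _.
by apply/eqP/negPn/negP => /psi_neq0 sB; apply: ns; exists s.
Qed.

Lemma Phi_B u : in_B u -> Phi u = 1.
Proof.
move=> /in_BP [t ->]; rewrite (@Phi_boxes 0) ?height_tv // (bigD1_seq [ffun=> 0%N]) ?boxes_uniq //=; last first.
  by apply: mem_boxes; rewrite big1 // => a _; rewrite ffunE.
have -> : sr [ffun=> 0%N] = 0 :> lattice n by rewrite /sr big1 // => a _; rewrite ffunE mulr0n.
rewrite addr0 psi_tv /coef big1 => [|a _]; last by rewrite ffunE coef10.
rewrite big1 ?addr0 // => s s0; apply/eqP/negPn/negP => /psi_height.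
rewrite height_tv oppr0 lez_nat leqn0 sum_nat_eq0 => /forall_inP sa; case/eqP: s0.
by apply/ffunP => a; rewrite ffunE; apply/eqP/sa.
Qed.

Lemma sr_pred s a : (0 < s a)%N -> sr s = sr (pred_s s a) + (v_zero a - v_plus a).
Proof.
move=> sa; have E : \sum_(b | b != a) (v_zero b - v_plus b) *+ pred_s s a b =
    \sum_(b | b != a) (v_zero b - v_plus b) *+ s b.
  by apply: eq_bigr => b /negPf ba; rewrite ffunE ba subn0.
rewrite /sr [in RHS](bigD1 a) //= E (bigD1 a) //= ffunE eqxx [in RHS]addrAC -mulrSr -subSn //.
by rewrite subn1.
Qed.

Lemma succK s a : pred_s (succ_s s a) a = s.
Proof. by apply/ffunP => b; rewrite !ffunE addnK. Qed.

Definition agkz (Psi : lattice n -> K) : Prop := forall u a,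
  Psi (u + v_plus a) - Psi (u + v_minus a) + Psi (u + v_zero a) = 0.

(** The identity of [psi_pascal], summed over s; in the last term s is replaced by
    s + e_a. *)
Lemma Phi_agkz : agkz Phi.
Proof.
move=> u a; pose u' : lattice n := u + v_plus a; rewrite -[u + v_plus a]/u'.
pose H s : K := if (0 < s a)%N then psi (pred_s s a) (u' + sr s) else 0.
have E0 : Phi (u + v_zero a) = \sum_(s \in [set: SS]%classic) H s.
  rewrite -(@fsbig_widen SS K 0 _ ((fun s => succ_s s a) @` setT)%classic) //=; last first.
    move=> s [_ /= sn]; rewrite /H; case: ifP => // sa; case: sn; exists (pred_s s a) => //.
    by apply/ffunP => b; rewrite !ffunE; case: eqP => [->|_]; rewrite ?subnK // subn0 addn0.
  rewrite (@fsbig_image K 0 _ SS SS) => [|s s' _ _ ss]; last by rewrite -(succK s a) ss succK.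
  apply: eq_fsbigr => s _; rewrite /H ffunE eqxx addn1 /= succK.
  rewrite (@sr_pred (succ_s s a) a) ?ffunE ?eqxx ?addn1 // succK /u'; congr (psi _ _).
  by move: (v_plus a) (v_zero a) (sr s) => p z r; apply/ffunP => Y; rewrite !ffunE; ring.
have E1 : Phi (u + v_minus a) = \sum_(s \in [set: SS]%classic) psi s (u' + sr s - (v_plus a - v_minus a)).
  apply: eq_fsbigr => s _; congr (psi _ _); rewrite /u'.
  by move: (v_plus a) (v_minus a) (sr s) => p z r; apply/ffunP => Y; rewrite !ffunE; ring.
have hN v : - height v <= Posz `|height v|%N by rewrite abszE -normrN ler_norm.
(* a common box for the three sums; the successor makes room for the shift of s *)
pose N := ((absz (height u')).+1 + absz (height (u + v_minus a)%R))%N.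
have HN (s : SS) : H s != 0 -> (\sum_b s b <= N)%N.
  move=> Hs; suff : (\sum_b s b <= `|height u'|.+1)%N by move/leq_trans; apply; rewrite leq_addr.
  move: Hs; rewrite /H; case: ifP => [sa|]; last by rewrite eqxx.
  rewrite (sr_pred sa) addrA addrAC => /psi_height h1.
  have -> : (\sum_b s b = (\sum_b pred_s s a b).+1)%N.
    rewrite (bigD1 a) //= [in RHS](bigD1 a) //= ffunE eqxx subn1 -addSn prednK //.
    by congr (_ + _)%N; apply: eq_bigr => b /negPf ba; rewrite ffunE ba subn0.
  rewrite ltnS -lez_nat; apply: le_trans h1 _; apply: le_trans _ (hN u').
  by rewrite heightD opprD gerDl oppr_le0 (le_trans _ (height_r a)).
rewrite E0 E1 /Phi !(@sum_boxes N) // => [|s|s].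
- rewrite -sumrN -!big_split big1 // => s _; rewrite /H.
  exact: psi_pascal.
- rewrite (_ : _ - _ = u + v_minus a + sr s) => [/psi_height h1|]; last first.
    by rewrite /u'; move: (v_plus a) (v_minus a) (sr s) => p z r; apply/ffunP => Y; rewrite !ffunE; ring.
  by rewrite -lez_nat; apply: le_trans h1 _; apply: le_trans (hN _) _; rewrite lez_nat leq_addl.
- move=> /psi_height h1; rewrite -lez_nat; apply: le_trans h1 _; apply: le_trans (hN _) _.
  by rewrite lez_nat /N addSn leqW // leq_addr.
Qed.

Variable m : nat -> int.
Hypothesis m_noninc : forall p, (1 <= p < n)%N -> m p.+1 <= m p.

Lemma rsum_n_succ (x : ex n) p : (rsum x p n = deg x p + rsum x p.+1 n)%N.
Proof.
rewrite /rsum (bigID (fun X : proper_sets n => #|val X| == p)) /=; congr addn.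
  by apply: eq_bigl => X; rewrite cnt_full; case: eqP => [->|]; rewrite ?leqnn ?andbF.
by apply: eq_bigl => X; rewrite cnt_full ltn_neqAle eq_sym andbC.
Qed.

Lemma row_top_r a p : (0 < p)%N -> row_sum p n (v_zero a - v_plus a) = 0.
Proof.
move=> p0; rewrite row_sumD row_sumN (quad_rows a n p0).2.
case: a => [[[[i j] x] X] aP] /=.
by rewrite [(n <= x)%N]leqNgt (ltn_ord x) andbF mul0r.
Qed.

Lemma row_top_sr s p : (0 < p)%N -> row_sum p n (sr s) = 0.
Proof.
by move=> p0; rewrite /sr row_sum_sum big1 // => a _; rewrite row_sumMn row_top_r // mul0rn.
Qed.

Lemma lat_of_ge0 w : (forall Y, 0 <= w Y) ->
  (forall p, (1 <= p <= n)%N -> row_sum p n w = m p) ->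
  exists2 x, x \in exps n (gap m) & w = lat x.
Proof.
move=> w0 wm; pose x : ex n := [ffun Y => absz (w Y)].
have wx : w = lat x by apply/ffunP => Y; rewrite !ffunE gez0_abs.
exists x => //; rewrite mem_exps; apply/multidegP => p /andP [p0 pn].
have mE q : (1 <= q <= n)%N -> m q = Posz (rsum x q n) by move=> /wm <-; rewrite wx row_sum_lat.
apply/eqP; rewrite -eqz_nat; apply/eqP.
rewrite -(gapE m_noninc); last by rewrite p0.
rewrite (mE p) ?p0 1?ltnW // (mE p.+1) //.
by rewrite rsum_n_succ PoszD addrK.
Qed.

Lemma coefE s t : coef s t = (-1) ^+ (\sum_(a : quad n) s a)%N / (\prod_(a : quad n) (s a)`!)%N%:R *
  (\prod_(a : quad n) \prod_(1 <= l < (s a).+1) (t a + l%:Z))%:~R.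
Proof.
rewrite /coef /coef1 !big_split /=; congr (_ * _ * _).
- by rewrite -prodrXr.
- by rewrite natr_prod -prodfV.
- by rewrite rmorph_prod.
Qed.

(** The terms with a negative exponent vanish, and the remaining exponents
    gamma - sr + tv have the multidegree of gamma, as v and r do not change the
    n-th row sums. So t is replaced by the exponent x, which determines it. *)
Lemma F_a_expansion (gamma : lattice n) (g : GL K n) :
  (forall p, (1 <= p <= n)%N -> row_sum p n gamma = m p) ->
  F_a gamma g = \sum_(x <- exps n (gap m)) Phi (lat x - gamma) * mono x g / xfact K x.
Proof.
move=> gm; pose z (X : proper_sets n) : K := minor (val g) (val X).
have E s : (-1) ^+ (\sum_(a : quad n) s a)%N / (\prod_(a : quad n) (s a)`!)%N%:R * J s (gamma - sr s) z
    = \sum_(x <- exps n (gap m)) psi s (lat x - gamma + sr s) * (mono x g / xfact K x).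
  pose h x := tinv (lat x - gamma + sr s).
  pose r := [seq x <- exps n (gap m) | tv (h x) == lat x - gamma + sr s].
  have rE x : x \in r -> gamma - sr s + tv (h x) = lat x.
    rewrite mem_filter => /andP [/eqP -> _].
    by move: (sr s) => q; apply/ffunP => Y; rewrite !ffunE; ring.
  pose f t : K := (\prod_(a : quad n) \prod_(1 <= l < (s a).+1) (t a + l%:Z))%:~R
     * (\prod_(X : proper_sets n) inv_fact K ((gamma - sr s + tv t) X))
     * (\prod_(X : proper_sets n) z X ^ ((gamma - sr s + tv t) X)).
  have -> : J s (gamma - sr s) z = \sum_(x <- r) f (h x).
    rewrite (@fsbig_seq K 0 +%R _ r (fun x => f (h x))); last exact/filter_uniq/uniq_exps.
    rewrite -(@fsbig_image K 0 _ _ TT) => [|x y]; rewrite ?inE; last first.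
      move=> /= xr yr xy; have := rE x xr; rewrite xy (rE y yr) => /ffunP xyE.
      by apply/ffunP => Y; have := xyE Y; rewrite !ffunE => -[].
    apply/esym/fsbig_widen => // t [_ /= tr].
    apply/eqP/negPn/negP => /eqP ft; apply: tr.
    pose w : lattice n := gamma - sr s + tv t.
    have w0 Y : 0 <= w Y.
      case wY: (w Y) => [//|k]; case: ft.
      by rewrite /f -/w [X in _ * X * _](bigD1 Y) //= wY mul0r mulr0 mul0r.
    have wm p : (1 <= p <= n)%N -> row_sum p n w = m p.
      move=> pn; have /andP [p0 _] := pn.
      by rewrite /w !row_sumD row_sumN row_top_sr // tv_rows // subr0 addr0 gm.
    have [x xe wx] := lat_of_ge0 w0 wm.
    have tE : tv t = lat x - gamma + sr s.
      by rewrite -wx /w; move: (sr s) (tv t) => q q'; apply/ffunP => Y; rewrite !ffunE; ring.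
    exists x; last by rewrite /h -tE tvK.
    by rewrite /= mem_filter xe andbT /h -tE tvK.
  rewrite mulr_sumr big_filter big_mkcond.
  apply: eq_big_seq => x xe; rewrite /psi -/(h x); case: ifP => [hx|_]; last by rewrite mul0r.
  have xr : x \in r by rewrite mem_filter hx.
  rewrite /f (rE x xr) coefE -!mulrA; do 3!congr (_ * _).
  rewrite mulrC; congr (_ * _).
    by apply: eq_bigr => X _; rewrite ffunE.
  by rewrite /xfact -prodfV; apply: eq_bigr => X _; rewrite ffunE.
have -> : F_a gamma g = \sum_(s \in [set: SS]%classic)
    \sum_(x <- exps n (gap m)) psi s (lat x - gamma + sr s) * (mono x g / xfact K x).
  by apply: eq_fsbigr => s _; apply: E.
have hN v : - height v <= Posz `|height v|%N by rewrite abszE -normrN ler_norm.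
pose N := (\sum_(x <- exps n (gap m)) absz (height (lat x - gamma)%R))%N.
have xN x : x \in exps n (gap m) -> - height (lat x - gamma) <= Posz N.
  move=> xe; apply: le_trans (hN _) _.
  by rewrite lez_nat /N (bigD1_seq x) ?uniq_exps //= leq_addr.
rewrite (@sum_boxes N) => [|s sn]; last first.
  have [x xe px] : exists2 x, x \in exps n (gap m) & psi s (lat x - gamma + sr s) != 0.
    apply: contrapT => nx; case/eqP: sn; rewrite big_seq big1 // => x xe.
    have [->|px] := eqVneq (psi s (lat x - gamma + sr s)) 0; first by rewrite mul0r.
    by case: nx; exists x.
  by rewrite -lez_nat; apply: le_trans (psi_height px) (xN x xe).
rewrite exchange_big; apply: eq_big_seq => x xe.
by rewrite (Phi_boxes (xN x xe)) -mulr_suml mulrA.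
Qed.
End Coefficients.

Lemma Phi_conj (n : nat) (C : numClosedFieldType) (u : lattice n) : (Phi C u)^* = Phi C u.
Proof.
rewrite (@Phi_boxes _ _ `|height u|%N); last by rewrite abszE -normrN ler_norm.
rewrite rmorph_sum; apply: eq_bigr => s _; rewrite /psi; case: ifP => _; last exact: rmorph0.
rewrite coefE rmorphM rmorph_int rmorphM fmorphV rmorph_nat.
by rewrite rmorphXn rmorphN1.
Qed.

(** * Algebraic independence of the remaining minors *)

Section SeedMinors.
Variables (n : nat) (K : numFieldType).
Implicit Types (z : nat -> nat -> K).

Definition diag_prev z (i : nat) : K := if i is i'.+1 then z i' i' else 1.

(** An upper triangular matrix; the entries are scaled so that the product
    z_00 / 1 * z_11 / z_00 * ... of the diagonal telescopes and the minor of the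
    seed seg i + {j} is z_ij. *)
Definition seed_mx z : 'M[K]_n :=
  \matrix_(r, c) if (r <= c)%N then z r c / diag_prev z r else 0.

Lemma diag_prev_neq0 z i : (forall i, z i i != 0) -> diag_prev z i != 0.
Proof. by case: i => [|i] zi //=; rewrite oner_eq0. Qed.

Lemma diag_telescope z i : (forall i, z i i != 0) ->
  \prod_(k < i) (z k k / diag_prev z k) = diag_prev z i.
Proof.
move=> zi; elim: i => [|i IH]; first by rewrite big_ord0.
by rewrite big_ord_recr /= IH mulrC divfK ?diag_prev_neq0.
Qed.

Lemma det_upper p (A : 'M[K]_p) : (forall r c : 'I_p, (c < r)%N -> A r c = 0) -> \det A = \prod_r A r r.
Proof.
move=> A0; rewrite -det_tr det_trig; last by apply/is_trig_mxP => r c rc; rewrite mxE A0.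
by apply: eq_bigr => r _; rewrite mxE.
Qed.

Lemma seed_mx_unit z : (forall i, z i i != 0) -> seed_mx z \in unitmx.
Proof.
move=> zi; rewrite unitmxE unitfE det_upper => [|r c rc]; last by rewrite mxE leqNgt rc.
apply/prodf_neq0 => r _; rewrite mxE leqnn mulf_neq0 ?invr_neq0 ?diag_prev_neq0 //.
Qed.

Lemma seed_minor z (i j : 'I_n) : (forall i, z i i != 0) -> (i <= j)%N ->
  minor (seed_mx z) (seg n i :|: [set j])%SET = z i j.
Proof.
move=> zi ij.
have kn (k : 'I_i.+1) : (k < n)%N by apply: leq_trans (ltn_ord k) (ltn_ord i).
pose c (k : 'I_i.+1) : 'I_n := if (k < i)%N then Ordinal (kn k) else j.
rewrite -(@mdet_mono _ _ _ _ _ c).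
- have rE (r : 'I_i.+1) k : row_ext (seed_mx z) r (c k) = seed_mx z (Ordinal (kn r)) (c k).
    rewrite /row_ext insubT; first exact: kn.
    by move=> rn; congr (seed_mx z _ _); apply: val_inj.
  rewrite /mdet det_upper => [|r k kr]; last first.
    rewrite mxE rE mxE /= /c.
    have ki : (k < i)%N by have := ltn_ord r; rewrite ltnS; apply: leq_trans.
    by rewrite ki /= leqNgt kr.
  rewrite big_ord_recr /= mxE rE mxE /= /c /= ltnn ij.
  rewrite (eq_bigr (fun k : 'I_i => z k k / diag_prev z k)) => [|k _]; last first.
    by rewrite mxE rE mxE /= /c /= ltn_ord /= leqnn.
  by rewrite diag_telescope // mulrC divfK ?diag_prev_neq0.
- rewrite -[in leqRHS](card_seg (ltnW (ltn_ord i))) -addn1 -(cards1 j) cardsU; exact: leq_subr.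
- move=> k l kl; rewrite /c.
  have ki : (k < i)%N by have := ltn_ord l; rewrite ltnS; apply: leq_trans.
  by rewrite ki; case: ifP => //= _; apply: leq_trans ki ij.
- move=> k; rewrite /c !inE; case: ifP => [->//|_]; by rewrite eqxx orbT.
Qed.

(** Uniqueness of digits in base b. *)
Lemma digits_inj b M (f f' : nat -> nat) : (forall k, (f k < b)%N) -> (forall k, (f' k < b)%N) ->
  (\sum_(k < M) f k * b ^ k = \sum_(k < M) f' k * b ^ k)%N -> forall k, (k < M)%N -> f k = f' k.
Proof.
elim: M f f' => [|M IH] f f' fb fb' // E.
have b0 : (0 < b)%N by apply: leq_ltn_trans (fb 0%N).
have S (h : nat -> nat) : (\sum_(k < M.+1) h k * b ^ k = (\sum_(k < M) h k.+1 * b ^ k) * b + h 0)%N.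
  rewrite big_ord_recl /= expn0 muln1 addnC big_distrl; congr (_ + _)%N.
  by apply: eq_bigr => k _; rewrite /= expnS -mulnA [(b ^ k * b)%N]mulnC.
move: E; rewrite !S => E.
have E0 : f 0%N = f' 0%N.
  have := congr1 (modn^~ b) E.
  by rewrite /= !modnMDl !modn_small.
move: E; rewrite E0 => /addIn /eqP; rewrite eqn_pmul2r // => /eqP E.
case=> [//|k]; rewrite ltnS => kM.
by apply: (IH (fun k => f k.+1) (fun k => f' k.+1)) E k kM => l.
Qed.

Lemma digits_fin_inj (T : finType) b (f f' : T -> nat) : (forall Y, (f Y < b)%N) -> (forall Y, (f' Y < b)%N) ->
  (\sum_Y f Y * b ^ (enum_rank Y) = \sum_Y f' Y * b ^ (enum_rank Y))%N -> f =1 f'.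
Proof.
move=> fb fb' E Y; pose F (h : T -> nat) k := nth 0%N [seq h Z | Z <- enum T] k.
have FE h Z : F h (enum_rank Z) = h Z.
  by rewrite /F (nth_map Z) ?nth_enum_rank // -cardE ltn_ord.
have Fb h : (forall Z, (h Z < b)%N) -> forall k, (F h k < b)%N.
  move=> hb k; rewrite /F; have [kT|kT] := ltnP k (size [seq h Z | Z <- enum T]); last first.
    by rewrite nth_default //; apply: leq_ltn_trans (hb Y).
  by have /mapP [Z _ ->] := mem_nth 0%N kT.
have S h : (\sum_Y h Y * b ^ (enum_rank Y) = \sum_(k < #|T|) F h k * b ^ k)%N.
  rewrite (reindex (@enum_rank T)) /=; last by exists enum_val => k _; rewrite ?enum_valK ?enum_rankK.
  by apply: eq_bigr => Z _; rewrite FE.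
rewrite -(FE f) -(FE f'); apply: (digits_inj (Fb f fb) (Fb f' fb')) (ltn_ord _).
by rewrite -!S.
Qed.

Lemma poly_vanish (p : {poly K}) : (forall t : K, t != 0 -> p.[t] = 0) -> p = 0.
Proof.
move=> pt; apply/eqP/negPn/negP => p0.
have := @max_poly_roots K p [seq k.+1%:R | k <- iota 0 (size p)] p0.
rewrite size_map size_iota ltnn map_inj_uniq ?iota_uniq => [|k l /eqP]; last by rewrite eqr_nat => /eqP [].
move=> H; suff: false by []; apply: H => //; apply/allP => t /mapP [k _ ->].
by apply/eqP/pt; rewrite pnatr_eq0.
Qed.

(** Give the seeds the values tau^(b^k), with distinct k and b larger than all the
    exponents. Distinct monomials become distinct powers of tau. *)
Lemma seeds_independent (L : seq (K * ex n)) :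
  (forall t, t \in L -> forall Y, t.2 Y != 0%N -> seed (val Y)) ->
  (forall g, \sum_(t <- L) t.1 * mono t.2 g = 0) ->
  forall h : ex n -> K, \sum_(t <- L) t.1 * h t.2 = 0.
Proof.
move=> Ls Lg h.
pose b := (\sum_(t <- L) \sum_Y t.2 Y).+1.
pose idx (Y : proper_sets n) := enum_rank Y.
pose N (x : ex n) := (\sum_Y x Y * b ^ (idx Y))%N.
have Nb t : t \in L -> forall Y, (t.2 Y < b)%N.
  move=> tL Y; rewrite /b ltnS (big_rem t) //= (bigD1 Y) //= -addnA leq_addr //.
have Ninj t t' : t \in L -> t' \in L -> N t.2 = N t'.2 -> t.2 = t'.2.
  by move=> tL tL' /(digits_fin_inj (Nb t tL) (Nb t' tL')) E; apply/ffunP.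
pose p : {poly K} := \sum_(t <- L) t.1 *: 'X^(N t.2).
have p0 : p = 0.
  apply: poly_vanish => t t0.
  (* the full column set is not proper; it gets the nonzero default value 1 *)
  pose z i j : K := if insub (seg n i :|: [set y | val y == j])%SET is Some Y then t ^+ (b ^ idx Y) else 1.
  have zi i : z i i != 0 by rewrite /z; case: insub => [Y|]; rewrite ?oner_eq0 ?expf_neq0.
  rewrite /p horner_sum -[RHS](Lg (exist (fun g : 'M[K]_n => g \in unitmx) _ (seed_mx_unit zi))).
  apply: eq_big_seq => u uL; rewrite hornerZ hornerXn; congr (_ * _).
  rewrite /mono /N -prodrXr; apply: eq_bigr => Y _ /=.
  have [->|uY] := eqVneq (u.2 Y) 0%N; first by rewrite mul0n !expr0.
  have [i [j [ij YE]]] := Ls u uL Y uY.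
  rewrite YE seed_minor // /z.
  have -> : (seg n i :|: [set y : 'I_n | val y == val j])%SET = val Y.
    by rewrite YE; apply/setP => y; rewrite !inE.
  by rewrite valK -exprM mulnC.
have cx t : t \in L -> \sum_(u <- L | u.2 == t.2) u.1 = 0.
  move=> tL; have := congr1 (fun q : {poly K} => q`_(N t.2)) p0.
  rewrite coef0 /p coef_sum => E; rewrite -[RHS]E big_mkcond; apply: eq_big_seq => u uL.
  rewrite coefZ coefXn [N _ == _]eq_sym; case: eqP => [->|ne]; first by rewrite eqxx mulr1.
  by case: eqP => [/(Ninj _ _ uL tL) //|_]; rewrite mulr0.
pose U := undup [seq t.2 | t <- L].
rewrite (eq_big_seq (fun t => \sum_(x <- U | x == t.2) t.1 * h x)) => [|t tL]; last first.
  rewrite (big_rem t.2) ?mem_undup ?map_f //= eqxx big_seq_cond big1 ?addr0 // => x.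
  by rewrite mem_rem_uniq ?undup_uniq // inE /= => /andP [/andP [/negPf ->]].
rewrite (exchange_big_dep xpredT) //= big_seq big1 // => x; rewrite mem_undup => /mapP [t tL ->].
rewrite -mulr_suml; under eq_bigl do rewrite eq_sym.
by rewrite cx // mul0r.
Qed.
End SeedMinors.

(** * Relations between monomials *)

Section KeyLemma.
Variables (n : nat) (K : numFieldType).
Implicit Types (a b c : quad n) (x y u v : ex n) (S : {set 'I_n}) (L : seq (K * ex n)).

Definition ind S : ex n := [ffun Y : proper_sets n => (val Y == S) : nat].
Definition plus_ex a := addx (ind (base_col a)) (ind (top_col a)).
Definition minus_ex a := addx (ind (minus_cols a).1) (ind (minus_cols a).2).
Definition zero_ex a := addx (ind (zero_cols a).1) (ind (zero_cols a).2).

Lemma mono_ind S (g : GL K n) : properS S -> mono (ind S) g = minor (val g) S.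
Proof.
rewrite /properS -proper_cardE => SP; rewrite -(mono_e1 (Sub S SP : proper_sets n)).
by congr (mono _ g); apply/ffunP => Y; rewrite ffunE e1E.
Qed.

Lemma lat_ind S : lat (ind S) = evec S.
Proof. by apply/ffunP => Y; rewrite !ffunE -natz. Qed.

Lemma lat_add x y : lat (addx x y) = lat x + lat y.
Proof. by apply/ffunP => Y; rewrite !ffunE addxE PoszD. Qed.

Definition agkz_ex (psi : ex n -> K) := forall u a,
  psi (addx u (plus_ex a)) - psi (addx u (minus_ex a)) + psi (addx u (zero_ex a)) = 0.

Lemma mono_agkz (g : GL K n) : agkz_ex (fun x => mono x g).
Proof.
move=> u a; rewrite !mono_add -!mulrBr -!mulrDr.
have /andP [tp /allP op] := cols_proper a.
rewrite !mono_ind // ?op ?inE ?eqxx ?orbT //.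
have := minor_quad (val g) a; rewrite /base_col /top_col /minus_cols /zero_cols.
by case: a {tp op} => [[[[i j] x] X] aP] /= ->; rewrite mulr0.
Qed.

Lemma agkz_lat (Psi : lattice n -> K) w : agkz Psi -> agkz_ex (fun x => Psi (lat x - w)).
Proof.
move=> HP u a; rewrite -(HP (lat u - w) a) v_plusE v_minusE v_zeroE !lat_add !lat_ind.
by rewrite ![lat u - w + _]addrAC.
Qed.

(** Expansion of (v_plus)^k as (v_minus - v_zero)^k, with coefficients. *)
Fixpoint reduce a k (c : K) u : seq (K * ex n) :=
  if k is k'.+1 then reduce a k' c (addx u (minus_ex a)) ++ reduce a k' (- c) (addx u (zero_ex a))
  else [:: (c, u)].

Definition add_plus a k u : ex n := [ffun Y => u Y + k * plus_ex a Y]%N.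

Lemma reduceE psi a k (c : K) u : agkz_ex psi ->
  \sum_(t <- reduce a k c u) t.1 * psi t.2 = c * psi (add_plus a k u).
Proof.
move=> psiP; elim: k c u => [|k IH] c u /=.
  by rewrite big_seq1 /=; congr (_ * psi _); apply/ffunP => Y; rewrite ffunE addn0.
rewrite big_cat /= !IH mulNr -mulrBr; congr (_ * _).
have E v : add_plus a k (addx u v) = addx (add_plus a k u) v.
  by rewrite /add_plus; move: (plus_ex a) => p; apply/ffunP => Y; rewrite !(ffunE, addxE) addnAC.
have -> : add_plus a k.+1 u = addx (add_plus a k u) (plus_ex a).
  by rewrite /add_plus; move: (plus_ex a) => p; apply/ffunP => Y; rewrite !(ffunE, addxE) mulSnr addnA.
rewrite !E; have /eqP := psiP (add_plus a k u) a.
by rewrite addrAC subr_eq0 => /eqP <-; rewrite addrK.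
Qed.

Lemma ind_top_ps S b : ind S (top_ps b) = (top_col b == S) :> nat.
Proof. by rewrite ffunE. Qed.

Lemma other_top a b S : (excess (top_col a) <= excess (top_col b))%N -> S \in other_cols a ->
  (top_col b == S) = false.
Proof.
move=> ab /excess_other Sa; apply/negP => /eqP E.
by move: (leq_trans Sa ab); rewrite E ltnn.
Qed.

Lemma reduce_top a b k (c : K) u t : (excess (top_col a) <= excess (top_col b))%N ->
  t \in reduce a k c u -> t.2 (top_ps b) = u (top_ps b).
Proof.
move=> ab; elim: k c u => [|k IH] c u /=; first by rewrite inE => /eqP ->.
rewrite mem_cat => /orP [] /IH ->; rewrite !addxE !ind_top_ps !(other_top ab) ?addn0 //;
  by rewrite !inE eqxx ?orbT.
Qed.

(** Induction on the set Q of quadruples whose tops may occur. Take a in Q of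
    largest excess, and multiply the relation by a power of its base column.
    Each power of the top is then paired with the base column, and the
    three-term relation replaces their product by products of columns of smaller
    excess. When Q is empty, only seeds are left. *)
Lemma key_elim (Psi : lattice n -> K) : agkz Psi -> forall (Q : {set quad n}),
  (forall b c, c \in Q -> b \notin Q -> (excess (top_col c) <= excess (top_col b))%N) ->
  forall L, (forall t, t \in L -> forall b, b \notin Q -> t.2 (top_ps b) = 0%N) ->
  (forall g : GL K n, \sum_(t <- L) t.1 * mono t.2 g = 0) ->
  forall w, \sum_(t <- L) t.1 * Psi (lat t.2 - w) = 0.
Proof.
move=> PsiP Q; have [N] := ubnP #|Q|; elim: N Q => // N IH Q QN Qex L LQ Lg w.
have [Q0|[a0 a0Q]] := set_0Vmem Q.
  apply: (seeds_independent _ Lg (fun x => Psi (lat x - w))) => t tL Y tY.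
  have := valP Y; rewrite proper_cardE => /top_or_seed [[b bE]|//].
  case/eqP: tY; rewrite -(LQ t tL b) ?Q0 ?finset.in_set0 //.
  by congr (t.2 _); apply: val_inj.
case: (@arg_maxnP _ a0 (mem Q) (fun a => excess (top_col a)) a0Q) => a aQ amax.
pose e := (\sum_(t <- L) t.2 (top_ps a))%N.
have te t : t \in L -> (t.2 (top_ps a) <= e)%N.
  by move=> tL; rewrite /e (big_rem t) //= leq_addr.
pose m : ex n := [ffun Y : proper_sets n => e * (val Y == base_col a)]%N.
(* x, times the e-th power of the base column, is the product of U x and of as
   many pairs of base and top as x has tops *)
pose U x : ex n := [ffun Y => if Y == top_ps a then 0%N
  else (x Y + (e - x (top_ps a)) * (val Y == base_col a))%N].
pose L' := flatten [seq reduce a (t.2 (top_ps a)) t.1 (U t.2) | t : K * ex n <- L].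
have L'E psi : agkz_ex psi -> \sum_(t <- L') t.1 * psi t.2 = \sum_(t <- L) t.1 * psi (addx t.2 m).
  move=> psiP; rewrite big_flatten big_map; apply: eq_big_seq => t tL.
  rewrite reduceE //; congr (_ * psi _); apply/ffunP => Y.
  rewrite !ffunE !addxE !ffunE.
  have [->|Ya] := eqVneq Y (top_ps a).
    by rewrite /= (@other_top a a) // ?eqxx ?inE ?eqxx // add0n muln1 muln0 addn0.
  have -> : (val Y == top_col a) = false.
    by apply: contraNF Ya => /eqP E; apply/eqP/val_inj.
  by rewrite addn0 -addnA -mulnDl subnK ?te.
have maxN b : b \notin Q :\ a -> (excess (top_col a) <= excess (top_col b))%N.
  by rewrite !inE negb_and negbK => /orP [/eqP ->//|bQ]; apply: Qex bQ.
have -> : \sum_(t <- L) t.1 * Psi (lat t.2 - w) = \sum_(t <- L') t.1 * Psi (lat t.2 - (w + lat m)).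
  rewrite (L'E (fun x => Psi (lat x - (w + lat m)))); last exact: agkz_lat.
  apply: eq_bigr => t _; congr (_ * Psi _); rewrite lat_add.
  by move: (lat m) (lat t.2) => p q; apply/ffunP => Y; rewrite !ffunE; ring.
apply: (IH (Q :\ a)).
- by move: QN; rewrite (cardsD1 a Q) (aQ : a \in Q).
- move=> b c; rewrite in_setD1 => /andP [_ cQ] /maxN; apply: leq_trans; exact: amax.
- move=> t /flatten_mapP [t' tL tR] b bQ; have ab := maxN b bQ.
  rewrite (reduce_top ab tR) ffunE; case: eqP => // /eqP ba.
  rewrite /= (@other_top a b) // ?inE ?eqxx // muln0 addn0 LQ //.
  apply: contraNN bQ => bQ; rewrite !inE bQ andbT.
  by apply: contraNneq ba => ->.
- move=> g; rewrite (L'E (fun x => mono x g) (mono_agkz g)).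
  under eq_bigr do rewrite mono_add mulrA.
  by rewrite -mulr_suml Lg mul0r.
Qed.

(** Linear relations between monomials in minors hold for all solutions of the
    three-term relations. *)
Lemma relation_agkz (Psi : lattice n -> K) L w : agkz Psi ->
  (forall g : GL K n, \sum_(t <- L) t.1 * mono t.2 g = 0) ->
  \sum_(t <- L) t.1 * Psi (lat t.2 - w) = 0.
Proof.
move=> PsiP Lg; apply: (key_elim PsiP (Q := [set: quad n]%SET)) => //.
  by move=> b c _; rewrite finset.in_setT.
by move=> t _ b; rewrite finset.in_setT.
Qed.
End KeyLemma.

(** * The order on shift vectors and dominance *)

Section Order.
Variable n : nat.
Implicit Types (u v : lattice n) (a : quad n) (d : nat -> nat -> int).

(** Whether r_a lowers the J-th partial sum of the q-th row. *)
Definition drops a (J q : nat) : bool :=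
  let: (i, j, x, X) := val a in [&& J == i.+1, j < q & q <= x]%N.

Lemma partial_r a q J :
  \sum_(1 <= p < J.+1) row_sum p q (v_zero a - v_plus a) = - Posz (drops a J q).
Proof.
have E p : (0 < p)%N -> row_sum p q (v_zero a - v_plus a) = let: (i, j, x, X) := val a in
    Posz ((j < q) && (q <= x))%N * (Posz (p == i.+2) - Posz (p == i.+1)).
  by move=> p0; rewrite -(quad_rows a q p0).2 row_sumD row_sumN.
under eq_big_nat => p /andP [p0 _] do rewrite E //.
rewrite /drops; case: a E => [[[[i j] x] X] aP] _ /=; rewrite -mulr_sumr.
have -> : \sum_(1 <= p < J.+1) (Posz (p == i.+2) - Posz (p == i.+1)) = - Posz (J == i.+1).
  elim: J => [|J IH]; first by rewrite big_geq.
  rewrite big_nat_recr //= IH !eqSS; lia.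
by case: (J == i.+1); case: (_ && _).
Qed.

Lemma partial_sr (s : {ffun quad n -> nat}) q J :
  \sum_(1 <= p < J.+1) row_sum p q (sr s) = - Posz (\sum_a drops a J q * s a)%N.
Proof.
rewrite (big_morph Posz PoszD (erefl _)) /sr -sumrN; under eq_bigr do rewrite row_sum_sum.
rewrite exchange_big; apply: eq_bigr => a _.
under eq_bigr do rewrite row_sumMn.
by rewrite sumrMnl partial_r PoszM mulNrn -mulr_natr natz.
Qed.

Lemma drops_top a q : drops a q q = false.
Proof.
rewrite /drops; case: a => [[[[i j] x] X] aP] /=; have /and3P [ij _ _] := aP.
by apply/negP => /and3P [/eqP -> ji _]; move: (leq_ltn_trans ij ji); rewrite ltnn.
Qed.

Lemma drops_n a J : drops a J n = false.
Proof.
by rewrite /drops; case: a => [[[[i j] x] X] aP] /=; rewrite [(n <= x)%N]leqNgt (ltn_ord x) !andbF.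
Qed.

Lemma prec_dominated d (gamma : lattice n) (x : ex n) (s : {ffun quad n -> nat}) :
  shift_vector d gamma -> in_B (lat x - gamma + sr s) -> dominated n d (diagram x).
Proof.
move=> gd xB q j /andP [q0 qn] jq.
have -> : \sum_(1 <= p < j.+1) diagram x p q =
    \sum_(1 <= p < j.+1) d p q - \sum_(1 <= p < j.+1) row_sum p q (sr s).
  rewrite -sumrB; apply: eq_big_nat => p /andP [p1 pj].
  have pq : (p <= q)%N by apply: leq_trans jq; rewrite -ltnS.
  have := xB p q p1 pq qn; rewrite !row_sumD row_sumN row_sum_lat gd // /diagram p1 pq qn /=.
  by move: (row_sum p q (sr s)) (d p q) => r e; lia.
rewrite partial_sr opprK; split=> [|->]; first by rewrite lerDl.
by rewrite [X in Posz X]big1 ?addr0 // => a _; rewrite drops_top.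
Qed.

(** The difference of the partial sums of length i + 1 in the q-th rows is the
    multiplicity of the quadruple (i, q - 1, q, empty set), where the three numbers
    start from 0: its r lowers that partial sum and no other. *)
Lemma dominated_prec (m : nat -> int) d d' (gamma gamma' : lattice n) :
  GT_diagram n m d -> GT_diagram n m d' -> shift_vector d gamma -> shift_vector d' gamma' ->
  dominated n d d' -> prec gamma' gamma.
Proof.
move=> [dn _ _] [dn' _ _] gd gd' dd.
pose D J q : int := \sum_(1 <= p < J.+1) d' p q - \sum_(1 <= p < J.+1) d p q.
pose f (a : quad n) : nat := let: (i, j, x, X) := val a in
  if (X == finset.set0) && (x == j.+1 :> nat) then `|D i.+1 x|%N else 0%N.
pose s : {ffun quad n -> nat} := [ffun a => f a].
have D0 q J : (0 < q <= n)%N -> (J <= q)%N -> 0 <= D J q.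
  by move=> qn Jq; rewrite subr_ge0; case: (dd q J qn Jq).
have sE q J : (0 < q <= n)%N -> (J <= q)%N -> Posz (\sum_a drops a J q * s a)%N = D J q.
  move=> qn Jq; have [Jq'|Jq'] := eqVneq J q.
    subst J; rewrite big1 => [|a _]; last by rewrite drops_top.
    by rewrite /D; have [_ ->] := dd q q qn Jq; rewrite ?subrr.
  have [qn'|qn'] := eqVneq q n.
    subst q; rewrite big1 => [|a _]; last by rewrite drops_n.
    rewrite /D (eq_big_nat _ _ (F2 := fun p => d p n)) ?subrr // => p /andP [p1 pJ].
    by rewrite dn ?dn' // p1 (leq_trans _ Jq).
  case: J Jq Jq' => [|J] Jq Jq'.
    rewrite /D !big_geq // subrr big1 // => a _.
    by rewrite /drops; case: a => [[[[i j] x] X] aP].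
  have {}Jq' : (J.+1 < q)%N by rewrite ltn_neqAle Jq'.
  have {}qn' : (q < n)%N by rewrite ltn_neqAle qn'; case/andP: qn.
  have q1n : (q.-1 < n)%N by lia.
  have Jn : (J < n)%N by lia.
  have aP : is_quad (Ordinal Jn, Ordinal q1n, Ordinal qn', finset.set0).
    by apply/and3P; split=> /=; [lia|lia|apply/forall_inP => z; rewrite inE].
  rewrite (bigD1 (exist (@is_quad n) _ aP)) //= big1 ?addn0 => [|[[[[i j] x] X] bP] ne].
    rewrite ffunE /f /drops /= prednK; last by lia.
    by rewrite !eqxx !leqnn /= mul1n gez0_abs ?D0.
  rewrite ffunE /f /drops /=; case: (X =P _) => [X0|_] /=; last by rewrite muln0.
  case: (x =P j.+1 :> nat) => [xj|_]; last by rewrite muln0.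
  case: and3P => [[/eqP [iJ] jq qx]|_]; last by rewrite mul0n.
  case/eqP: ne; apply: val_inj; rewrite /= X0; congr (_, _, _, _); apply: val_inj => /=; lia.
exists s => p q p1 pq qn; rewrite !row_sumD row_sumN gd // gd' //.
have H J : (J <= q)%N -> \sum_(1 <= p < J.+1) row_sum p q (sr s) = - D J q.
  by move=> Jq; rewrite partial_sr sE // qn (leq_trans _ pq).
have := H p pq; have := H p.-1 (leq_trans (leq_pred p) pq); rewrite /D prednK //.
rewrite !(big_nat_recr p) //=.
move=> ->; move: (row_sum p q (sr s)) (d' p q) (d p q) (\sum_(1 <= i < p) d i q) => r e e' b.
by move: (\sum_(1 <= i < p) d' i q) => b'; clear; lia.
Qed.
End Order.

(** * Expansion of F in the Gelfand-Tsetlin base *)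

Section Expansion.
Variables (C : numClosedFieldType) (n : nat) (m : nat -> int).
Hypothesis m_noninc : forall p, (1 <= p < n)%N -> m p.+1 <= m p.
Hypothesis m_n : m n = 0.
Variable gamma : (nat -> nat -> int) -> lattice n.
Hypothesis gammaP : forall d, GT_diagram n m d -> shift_vector d (gamma d).
Variable G : (nat -> nat -> int) -> GL C n -> C.
Hypothesis GP : forall d, GT_diagram n m d -> GT_vector m d (G d).
Local Notation in_V := (@in_V C n m).
Local Notation hform := (@hform C n m).
Local Notation deg_m := (multideg (gap m)).

Lemma F_a_sum d g : GT_diagram n m d ->
  F_a (gamma d) g = \sum_(x <- exps n (gap m)) Phi C (lat x - gamma d) * mono x g / xfact C x.
Proof.
move=> Gd; apply: (F_a_expansion m_noninc) => p pn; have [dn _ _] := Gd; have /andP [p1 pn'] := pn.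
by rewrite gammaP // dn.
Qed.

Lemma F_a_in_V d : GT_diagram n m d -> in_V (F_a (gamma d)).
Proof.
move=> Gd.
have : in_span deg_m (F_a (gamma d) : GL C n -> C).
  have -> : F_a (gamma d) = (fun g : GL C n => \sum_(x <- exps n (gap m))
      Phi C (lat x - gamma d) / xfact C x * mono x g).
    by apply: funext => g; rewrite F_a_sum //; apply: eq_bigr => x _; rewrite mulrAC.
  apply: in_span_sum => x; rewrite mem_exps => dx.
  by apply: in_spanZ; apply: in_span_mono.
move=> /(std_span (fun x dx => dx)) [a ->]; apply: in_V_sum => k.
by apply: (mono_in_V m_noninc m_n GP); case: (std_nthP k).
Qed.

(** Write D^x as fn L. Comparing the expansion of fn L with D^x is a
    linear relation between monomials, which Phi respects. *)
Lemma hform_F_mono d x : GT_diagram n m d -> deg_m x ->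
  hform (F_a (gamma d)) (mono x) = Phi C (lat x - gamma d).
Proof.
move=> Gd dx; have [L LE] := mono_in_V m_noninc m_n GP dx.
rewrite LE hform_pair; last exact: F_a_in_V.
have := @relation_agkz n C (Phi C)
  ((-1, x) :: [seq (lfit L y / xfact C y, y) | y <- exps n (gap m)]) (gamma d) (@Phi_agkz n C).
rewrite big_cons big_map /= => H.
have {H} : -1 * Phi C (lat x - gamma d) +
    \sum_(y <- exps n (gap m)) lfit L y / xfact C y * Phi C (lat y - gamma d) = 0.
  apply: H => g; rewrite big_cons big_map /= mulN1r LE fn_mono.
  apply/eqP; rewrite addrC subr_eq0; apply/eqP; apply: eq_bigr => y _.
  by rewrite mulrAC.
rewrite mulN1r addrC => /subr0_eq SE; rewrite /pair_with.
have E t : F_a (gamma d) (cgl t.2) = (\sum_(y <- exps n (gap m))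
    Phi C (lat y - gamma d) / xfact C y * mono y t.2)^*.
  rewrite F_a_sum // rmorph_sum; apply: eq_bigr => y _.
  by rewrite mono_conj rmorphM /= rmorphM /= fmorphV /= Phi_conj xfact_conj mulrAC.
under eq_bigr do rewrite E -rmorphM.
rewrite -rmorph_sum /=.
have -> : \sum_(t <- L) t.1 * (\sum_(y <- exps n (gap m)) Phi C (lat y - gamma d) / xfact C y * mono y t.2)
   = \sum_(y <- exps n (gap m)) lfit L y / xfact C y * Phi C (lat y - gamma d).
  under eq_bigr do rewrite mulr_sumr.
  rewrite exchange_big; apply: eq_bigr => y _; move: (Phi C (lat y - gamma d)) => P.
  rewrite /lfit !mulr_suml; apply: eq_bigr => t _.
  by rewrite -!mulrA; congr (_ * _); rewrite mulrCA (mulrC P) mulrCA.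
by rewrite SE Phi_conj.
Qed.

Local Notation N := (size (stds n m)).

Lemma hform_F_GT (A : 'I_N -> 'I_N -> C) d k : GT_diagram n m d ->
  G (std_diag k) = (fun g => \sum_j A k j * mono (std_nth j) g) ->
  hform (F_a (gamma d)) (G (std_diag k)) =
  \sum_j (A k j)^* * Phi C (lat (std_nth j) - gamma d).
Proof.
move=> Gd AE; have VF := F_a_in_V Gd.
have VM (j : 'I_N) : in_V (mono (std_nth j)) by apply: (mono_in_V m_noninc m_n GP); case: (std_nthP j).
rewrite hformC //; last exact: (GT_in_V m_noninc (GP (std_diag_GT m_noninc m_n k))).
rewrite AE hform_sum rmorph_sum; apply: eq_bigr => j _.
rewrite hformC // hform_F_mono //; last by case: (std_nthP j).
by rewrite rmorphM /= conjCK.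
Qed.

Lemma F_expansion_GT : exists c : (nat -> nat -> int) -> (nat -> nat -> int) -> C,
  (forall d d', GT_diagram n m d -> GT_diagram n m d' -> c d d' != 0 -> prec (gamma d') (gamma d)) /\
  forall d, GT_diagram n m d -> c d d != 0 /\
    forall g, F_a (gamma d) g = \sum_(k < N) c d (std_diag k) * G (std_diag k) g.
Proof.
have [A [AE AP]] := GT_expansion m_noninc m_n GP.
have GTk k := std_diag_GT m_noninc m_n k : GT_diagram n m (@std_diag n m k).
pose c d d' := hform (F_a (gamma d)) (G d') / hform (G d') (G d').
exists c; split=> [d d' Gd Gd' | d Gd].
  have [k d'E] := std_diag_surj m_noninc m_n GP Gd'; rewrite {}d'E in Gd' *.
  rewrite /c mulf_eq0 negb_or => /andP [+ _]; rewrite (hform_F_GT Gd (AE k)) => H.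
  have [j Aj Pj] : exists2 j, A k j != 0 & Phi C (lat (std_nth j) - gamma d) != 0.
    apply: contrapT => nj; case/eqP: H; rewrite big1 // => j _.
    have [->|Aj] := eqVneq (A k j) 0; first by rewrite conjC0 mul0r.
    have [->|Pj] := eqVneq (Phi C (lat (std_nth j) - gamma d)) 0; first by rewrite mulr0.
    by case: nj; exists j.
  have [s sB] := Phi_neq0 Pj; have dj := prec_dominated (gammaP Gd) sB.
  apply: (dominated_prec Gd Gd' (gammaP Gd) (gammaP Gd')).
  exact: dominated_trans dj ((AP k).2 j Aj).
have [i dE] := std_diag_surj m_noninc m_n GP Gd.
split.
  (* antisymmetry of dominance leaves only the standard monomial of d *)
  rewrite /c mulf_neq0 ?invr_neq0 ?(GT_norm m_noninc (GP Gd)) //.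
  rewrite [in X in hform _ X]dE (hform_F_GT Gd (AE i)) (bigD1 i) //= big1 ?addr0 => [|j ji].
    rewrite Phi_B ?mulr1 ?conjC_eq0 ?(AP i).1 // => p q p1 pq qn.
    by rewrite row_sumD row_sumN row_sum_lat (gammaP Gd) // dE /std_diag /diagram p1 pq qn subrr.
  apply/eqP/negPn/negP; rewrite mulf_eq0 negb_or conjC_eq0 => /andP [Aj Pj].
  have [s sB] := Phi_neq0 Pj; have := prec_dominated (gammaP Gd) sB.
  rewrite dE => dj; case/eqP: ji; apply: (@std_nth_inj n m).
  have [sj _] := std_nthP j; have [si _] := std_nthP i.
  by apply: dominated_anti => //; apply: (AP i).2.
have [a aE] := in_V_std (F_a_in_V Gd).
have [_ [T [_ _ _ TE]]] := std_matrix m_noninc m_n GP.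
have [b bE] : exists b : 'I_N -> C, F_a (gamma d) = (fun g => \sum_k b k * G (std_diag k) g).
  exists (fun k => \sum_j a j * T j k); rewrite aE; apply: funext => g.
  under eq_bigr do rewrite TE mulr_sumr.
  rewrite exchange_big; apply: eq_bigr => k _; rewrite mulr_suml.
  by apply: eq_bigr => j _; rewrite mulrA.
move=> g; rewrite {1}bE; apply: eq_bigr => k _; congr (_ * _).
have nk := GT_norm m_noninc (GP (GTk k)).
rewrite /c bE hform_sum (bigD1 k) //= big1 ?addr0 ?mulfK // => j jk.
rewrite (GT_orth m_noninc (GTk j) (GTk k)) ?mulr0 //; try exact: GP.
by move=> /(@std_diag_inj n m) E; rewrite E eqxx in jk.
Qed.
End Expansion.

Local Open Scope classical_set_scope.

Theorem corollary2 (R : realType) (n : nat) (n_ge2 : (2 <= n)%N)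
  (m : nat -> int)
  (m_noninc : forall p, (1 <= p < n)%N -> m p.+1 <= m p) (m_n : m n = 0)
  (gamma : (nat -> nat -> int) -> lattice n)
  (gammaP : forall d, GT_diagram n m d -> shift_vector d (gamma d))
  (G : (nat -> nat -> int) -> GL R[i] n -> R[i])
  (GP : forall d, GT_diagram n m d -> GT_vector m d (G d)) :
  exists c : (nat -> nat -> int) -> (nat -> nat -> int) -> R[i],
    forall d, GT_diagram n m d ->
      c d d != 0 /\
      forall g : GL R[i] n,
        F_a (gamma d) g =
        \sum_(d' \in [set d' | GT_diagram n m d' /\ prec (gamma d') (gamma d)])
          (c d d' * G d' g).
Proof.
have [c [cP cE]] := F_expansion_GT m_noninc m_n gammaP GP.
exists c => d Gd; have [cd FE] := cE d Gd; split=> // g; rewrite FE.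
(* adding the diagrams with zero coefficient gives those of standard monomials *)
rewrite (@fsbig_widen _ _ _ _ _ ((@std_diag n m) @` setT)) /=; first last.
- move=> _ [[k _ <-]] nk /=; have Gk := std_diag_GT m_noninc m_n k.
  apply/eqP; rewrite mulf_eq0; apply/orP; left; apply/negPn/negP => ck.
  by apply: nk; split=> //; apply: cP.
- move=> d' [Gd' _]; have [k ->] := std_diag_surj m_noninc m_n GP Gd'.
  by exists k.
rewrite fsbig_image => [|k l _ _]; last exact: std_diag_inj.
rewrite (fsbigE (index_enum 'I_(size (stds n m)))) ?index_enum_uniq // => [|k _].
  by apply: eq_bigl => k; rewrite in_setT.
by rewrite mem_index_enum.
Qed.
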